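(* Let $k$ be a field, $A$ a finite dimensional elementary $k$-algebra of finite global dimension, $M$ a perfect $A$-bimodule complex, and $\Psi_M:=-C_MC_A^{-1}$ the dual Coxeter matrix of $M$. Then $$h^{HH_\bullet}(M)\ \ge\ \log\rho(\Psi_M),$$ where $\rho(\Psi_M)$ is the spectral radius of $\Psi_M$.
   Context: $A$ is elementary if $A/\mathrm{rad}\,A$ is a finite product of copies of $k$. $A^e=A^{\mathrm{op}}\otimes_k A$; a perfect $A$-bimodule complex is an object of the perfect derived category $\mathrm{per}(A^e)$. Cartan matrices: let $e_1,\dots,e_r$ be a complete set of orthogonal primitive idempotents of $A$. The Cartan matrix of a finite dimensional $A$-bimodule $N$ is the $r\times r$ integer matrix $C_N=(c_{ij})$ with $c_{ij}=\dim_k e_jNe_i$. For an $A$-bimodule complex $M$ with finite dimensional total cohomology, $C_M=\sum_{l\in\mathbb{Z}}(-1)^l C_{H^l(M)}$. $C_A$ is the Cartan matrix of $A$ as a bimodule over itself; since $A$ is elementary of finite global dimension, $\det C_A=\pm1$, so $C_A$ is invertible. Hochschild homology entropy: for a complex $X$ of $k$-vector spaces with finite dimensional total cohomology put $\mathrm{tdim}_k(X)=\sum_{i}\dim_k H^i(X)$. Then $$h^{HH_\bullet}(M)=\limsup_{n\to\infty}\tfrac1n\log\mathrm{tdim}_k\,(A\otimes^L_{A^e}M^{\otimes^L_A n}).$$ The spectral radius of a square matrix is the maximal absolute value of its complex eigenvalues. Convention: $\log 0=-\infty$. *)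

(* Defs.v *)
From HB Require Import structures.
From mathcomp Require Import all_boot all_order all_algebra all_field.
From mathcomp Require Import complex.
From mathcomp Require Import all_classical all_reals all_analysis.

Set Implicit Arguments.
Unset Strict Implicit.
Unset Printing Implicit Defensive.

Import Order.TTheory GRing.Theory Num.Theory.

Local Open Scope classical_set_scope.
Local Open Scope ring_scope.

(* A complex of vector spaces or of bimodules is encoded by its
   total space, the direct sum V of its terms: [gr i] is the projection of V
   onto the term of degree i, and the differential [df] raises degrees by 1.
   Terms of arbitrary dimension and complexes unbounded on both sides are
   allowed for V : lmodType k; the case V : vectType k is that of bounded
   complexes with finite dimensional terms. *)

Section Algebra.
Variables (k : fieldType) (A : falgType k).

Definition left_ideal (J : set A) : Prop :=
  [/\ J 0, forall x y, J x -> J y -> J (x + y)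
    & forall a x, J x -> J (a * x)].

Definition maximal_left_ideal (J : set A) : Prop :=
  [/\ left_ideal J, J != setT &
      forall J' : set A, left_ideal J' -> J `<=` J' -> J' != setT -> J' = J].

Definition jacobson_radical : set A :=
  [set x | forall J, maximal_left_ideal J -> J x].

(* A/rad A is isomorphic to k^r, through the r components of the quotient map *)
Definition elementary : Prop :=
  exists (r : nat) (phi : 'I_r -> {lrmorphism A -> k^o}),
    (forall t : 'I_r -> k, exists a, forall i, phi i a = t i) /\
    (forall a, (forall i, phi i a = 0) <-> jacobson_radical a).

Definition projective_module (P : lmodType A) : Prop :=
  forall (X Y : lmodType A) (f : {linear X -> Y}) (g : {linear P -> Y}),
    (forall y, exists x, f x = y) ->
    exists h : {linear P -> X}, forall p, f (h p) = g p.

Fixpoint pdim_le (n : nat) (X : lmodType A) : Prop :=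
  match n with
  | 0%N => projective_module X
  | n'.+1 =>
      exists (P K : lmodType A) (i : {linear K -> P}) (f : {linear P -> X}),
        [/\ projective_module P, injective i,
            forall p, f p = 0 <-> exists y, p = i y,
            forall x, exists p, f p = x
          & pdim_le n' K]
  end.

Definition finite_global_dimension : Prop :=
  exists n, forall X : lmodType A, pdim_le n X.

Definition primitive_idempotent (e : A) : Prop :=
  [/\ e != 0, e * e = e &
      forall f g, f * f = f -> g * g = g -> f * g = 0 -> g * f = 0 ->
        e = f + g -> f = 0 \/ g = 0].

Definition complete_primitive_idempotents (r : nat) (e : 'I_r -> A) : Prop :=
  [/\ forall i, primitive_idempotent (e i),
      forall i j, i != j -> e i * e j = 0
    & \sum_i e i = 1].

End Algebra.

Record complexes (k : fieldType) (V : lmodType k) := Complexes {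
  gr : int -> {linear V -> V};
  df : {linear V -> V};
  gr_gr : forall i j x, gr i (gr j x) = if i == j then gr j x else 0;
  gr_sum : forall x, exists2 s : seq int, uniq s & x = \sum_(i <- s) gr i x;
  df_gr : forall i x, df (gr i x) = gr (i + 1) (df x);
  df_df : forall x, df (df x) = 0
}.

(* [lact a x] is a x and [ract a x] is x a; k acts centrally since both
   actions are k-linear in a. *)
Record bimodule (k : fieldType) (A : falgType k) (V : lmodType k) := Bimodule {
  lact : A -> {linear V -> V};
  ract : A -> {linear V -> V};
  lact_lin : forall x, linear (fun a => lact a x);
  ract_lin : forall x, linear (fun a => ract a x);
  lact1 : forall x, lact 1 x = x;
  ract1 : forall x, ract 1 x = x;
  lactM : forall a b x, lact (a * b) x = lact a (lact b x);
  ractM : forall a b x, ract (a * b) x = ract b (ract a x);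
  lract : forall a b x, lact a (ract b x) = ract b (lact a x)
}.

Record bimodule_complex (k : fieldType) (A : falgType k) (V : lmodType k) :=
  BimoduleComplex {
  bc_bimod :> bimodule A V;
  bc_complex :> complexes V;
  gr_lact : forall i a x,
    gr bc_complex i (lact bc_bimod a x) = lact bc_bimod a (gr bc_complex i x);
  gr_ract : forall i a x,
    gr bc_complex i (ract bc_bimod a x) = ract bc_bimod a (gr bc_complex i x);
  df_lact : forall a x,
    df bc_complex (lact bc_bimod a x) = lact bc_bimod a (df bc_complex x);
  df_ract : forall a x,
    df bc_complex (ract bc_bimod a x) = ract bc_bimod a (df bc_complex x)
}.

Section Cohomology.
Variables (k : fieldType) (V : lmodType k).

(* For subspaces B and S of V, [is_qdim S B n] says that the image of S in V/B
   has dimension n. *)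
Definition is_qdim (S B : set V) (n : nat) : Prop :=
  exists b : 'I_n -> V,
    [/\ forall i, S (b i),
        forall c : 'I_n -> k, B (\sum_i c i *: b i) -> forall i, c i = 0
      & forall x, S x -> exists c : 'I_n -> k, B (x - \sum_i c i *: b i)].

Definition qdim (S B : set V) : nat := xget 0%N [set n | is_qdim S B n].

Variable C : complexes V.

Definition cocycles (i : int) : set V := [set x | gr C i x = x /\ df C x = 0].

Definition coboundaries (i : int) : set V :=
  [set x | exists2 y, gr C (i - 1) y = y & x = df C y].

Definition tdim : nat :=
  \sum_(i \in [set: int]) qdim (cocycles i) (coboundaries i).

End Cohomology.

Section Homs.
Variables (k : fieldType) (A : falgType k).

Definition bimodule_hom (V W : lmodType k) (X : bimodule A V)
    (Y : bimodule A W) (f : V -> W) : Prop :=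
  forall a x, f (lact X a x) = lact Y a (f x) /\ f (ract X a x) = ract Y a (f x).

Definition projective_bimodule (V : lmodType k) (P : bimodule A V) : Prop :=
  forall (V1 V2 : lmodType k) (X : bimodule A V1) (Y : bimodule A V2)
    (f : {linear V1 -> V2}) (g : {linear V -> V2}),
    bimodule_hom X Y f -> bimodule_hom P Y g -> (forall y, exists x, f x = y) ->
    exists2 h : {linear V -> V1}, bimodule_hom P X h & forall p, f (h p) = g p.

Definition quasi_isomorphism (V W : lmodType k) (X : bimodule_complex A V)
    (Y : bimodule_complex A W) (f : {linear V -> W}) : Prop :=
  [/\ bimodule_hom X Y f,
      forall i x, f (gr X i x) = gr Y i (f x),
      forall x, f (df X x) = df Y (f x),
      forall i x, cocycles X i x -> coboundaries Y i (f x) -> coboundaries X i x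
    & forall i y, cocycles Y i y ->
        exists2 x, cocycles X i x & coboundaries Y i (y - f x)].

End Homs.

Section Tensor.
Variables (k : fieldType) (V W : vectType k).
Let bV := vbasis {:V}.
Let bW := vbasis {:W}.

(* V (x)_k W in coordinates: tensors of basis vectors are matrix units *)
Definition tens : vectType k := 'M[k]_(\dim {:V}, \dim {:W}).

Definition tensor (v : V) (w : W) : tens :=
  \matrix_(i, j) (coord bV i v * coord bW j w).

Definition tmap_fun (f : V -> V) (g : W -> W) (X : tens) : tens :=
  \sum_i \sum_j (X : 'M[k]_(_, _)) i j *: tensor (f bV`_i) (g bW`_j).

Definition tmap (f : V -> V) (g : W -> W) : 'End(tens) :=
  linfun (tmap_fun f g).

Lemma tensor_linl w : linear (tensor ^~ w).
Proof.
by move=> c v v'; apply/matrixP => i j; rewrite !mxE linearP mulrDl mulrA.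
Qed.

Lemma tensor_linr v : linear (tensor v).
Proof.
by move=> c w w'; apply/matrixP => i j; rewrite !mxE linearP mulrDr mulrCA.
Qed.

Definition tensor_flip w v := tensor v w.

HB.instance Definition _ w :=
  GRing.isLinear.Build k V tens _ (tensor_flip w) (tensor_linl w).
HB.instance Definition _ v :=
  GRing.isLinear.Build k W tens _ (tensor v) (tensor_linr v).

Lemma tensorZl c v w : tensor (c *: v) w = c *: tensor v w.
Proof. exact: (linearZZ (tensor_flip w)). Qed.

Lemma tensorZr c v w : tensor v (c *: w) = c *: tensor v w.
Proof. exact: (linearZZ (tensor v) c w). Qed.

Lemma tensor0l w : tensor 0 w = 0.
Proof. exact: (linear0 (tensor_flip w)). Qed.

Lemma tensor0r v : tensor v 0 = 0.
Proof. exact: linear0. Qed.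

Lemma tensor_suml I (s : seq I) (F : I -> V) w :
  tensor (\sum_(i <- s) F i) w = \sum_(i <- s) tensor (F i) w.
Proof. exact: (linear_sum (tensor_flip w)). Qed.

Lemma tensor_sumr I (s : seq I) (F : I -> W) v :
  tensor v (\sum_(i <- s) F i) = \sum_(i <- s) tensor v (F i).
Proof. exact: linear_sum. Qed.

Lemma tmap_fun_linear f g : linear (tmap_fun f g).
Proof.
move=> c X Y; rewrite /tmap_fun scaler_sumr -big_split; apply: eq_bigr => i _ /=.
rewrite scaler_sumr -big_split; apply: eq_bigr => j _ /=.
by rewrite !mxE scalerDl scalerA.
Qed.

HB.instance Definition _ f g :=
  GRing.isLinear.Build k tens tens _ (tmap_fun f g) (tmap_fun_linear f g).

Lemma tmapE (f : {linear V -> V}) (g : {linear W -> W}) v w :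
  tmap f g (tensor v w) = tensor (f v) (g w).
Proof.
rewrite lfunE /= /tmap_fun {2}(coord_vbasis (memvf v)) {2}(coord_vbasis (memvf w)).
rewrite (linear_sum f) (linear_sum g) tensor_suml; apply: eq_bigr => i _ /=.
rewrite tensor_sumr; apply: eq_bigr => j _ /=.
by rewrite mxE (linearZZ f) (linearZZ g) tensorZl tensorZr scalerA.
Qed.

Lemma tens_decomp (X : tens) :
  X = \sum_i \sum_j (X : 'M[k]_(_, _)) i j *: tensor bV`_i bW`_j.
Proof.
rewrite [LHS](matrix_sum_delta (X : 'M[k]_(_, _))).
apply: eq_bigr => i _; apply: eq_bigr => j _; congr (_ *: _).
apply/matrixP => a b; rewrite !mxE.
have freeb (U : vectType k) : free (vbasis {:U}).
  exact: basis_free (vbasisP _).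
by rewrite !coord_free // -natrM mulnb [i == _]eq_sym [j == _]eq_sym.
Qed.

Lemma tens_ext (f g : 'End(tens)) :
  (forall v w, f (tensor v w) = g (tensor v w)) -> f = g.
Proof.
move=> fg; apply/lfunP => X; rewrite [X]tens_decomp !linear_sum.
apply: eq_bigr => i _; rewrite !linear_sum; apply: eq_bigr => j _.
by rewrite !linearZ_LR /= fg.
Qed.

End Tensor.

Section Quotient.
Variables (k : fieldType) (V : vectType k).

Lemma vspan_exists (S : set V) : exists U : {vspace V},
  (forall x, S x -> x \in U) /\
  (forall U' : {vspace V}, (forall x, S x -> x \in U') -> (U <= U')%VS).
Proof.
pose P n := `[< exists2 X : seq V, {in X, forall x, S x} & \dim <<X>> = n >].
have exP : exists n, P n.
  by exists (\dim <<[::] : seq V>>); apply/asboolP; exists [::].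
have ubP n : P n -> (n <= dim V)%N.
  by move=> /asboolP[X _ <-]; rewrite -dimvf dimvS ?subvf.
have [m /asboolP[X XS dX] maxm] := ex_maxnP exP ubP.
exists <<X>>%VS; split=> [x Sx|U' SU']; last first.
  by apply/span_subvP => x /XS; exact: SU'.
have : (\dim <<x :: X>> <= \dim <<X>>)%N.
  rewrite dX; apply: maxm; apply/asboolP; exists (x :: X) => // y.
  by rewrite inE => /predU1P[->//|/XS].
move=> le; have sub : (<<X>> <= <<x :: X>>)%VS by rewrite span_cons addvSr.
have /eqP -> : (<<X>> == <<x :: X>>)%VS by rewrite eqEdim sub.
by rewrite memv_span ?mem_head.
Qed.

Definition vspan (S : set V) : {vspace V} := projT1 (cid (vspan_exists S)).

Lemma mem_vspan S x : S x -> x \in vspan S.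
Proof. by rewrite /vspan; case: cid => U /= [+ _]; exact. Qed.

Lemma vspan_sub (S : set V) (U : {vspace V}) :
  (forall x, S x -> x \in U) -> (vspan S <= U)%VS.
Proof. by rewrite /vspan; case: cid => U' /= [_ +]; exact. Qed.

Definition stable (U : {vspace V}) (f : V -> V) : Prop :=
  forall x, x \in U -> f x \in U.

Lemma vspan_stable S (f : {linear V -> V}) :
  (forall x, S x -> f x \in vspan S) -> stable (vspan S) f.
Proof.
move=> Sf x; suff /subvP sub : (vspan S <= linfun f @^-1: vspan S)%VS.
  by move=> /sub; rewrite -memv_preim lfunE.
by apply: vspan_sub => y /Sf; rewrite -memv_preim lfunE.
Qed.

(* V/U, realized on a complement of U; the projection is [qproj] below *)
Definition quotv (U : {vspace V}) : vectType k := subvs_of (U^C)%VS.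

Variable U : {vspace V}.

Definition qproj (v : V) : quotv U := vsproj (U^C)%VS (v - projv U v).

Lemma qproj_is_linear : linear qproj.
Proof.
move=> c x y; rewrite /qproj -linearP; congr (vsproj _ _).
by rewrite linearP scalerBr opprD addrACA.
Qed.

HB.instance Definition _ :=
  GRing.isLinear.Build k V (quotv U) _ qproj qproj_is_linear.

Lemma qproj_eq0 v : (qproj v == 0) = (v \in U).
Proof.
apply/eqP/idP => [/(congr1 vsval)|vU]; last first.
  by rewrite /qproj projv_id // subrr linear0.
rewrite vsprojK ?memv_projC // linear0 => /eqP; rewrite subr_eq0 => /eqP ->.
exact: memv_proj.
Qed.

Lemma qprojK (y : quotv U) : qproj (vsval y) = y.
Proof.
have: vsval y \in (U^C)%VS by exact: subvsP.
rewrite /qproj => yU; suff -> : projv U (vsval y) = 0 by rewrite subr0 vsvalK.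
suff: vsval y \in lker (projv U) by rewrite memv_ker => /eqP.
by rewrite lker_proj.
Qed.

(* the endomorphism of V/U induced by f; meaningful only if f preserves U *)
Definition qmap (f : V -> V) : 'End(quotv U) := linfun (qproj \o f \o vsval).

Lemma qmapE (f : {linear V -> V}) v :
  stable U f -> qmap f (qproj v) = qproj (f v).
Proof.
move=> fU; rewrite lfunE /=; apply/eqP.
have vU : vsval (qproj v) - v \in U.
  by rewrite -qproj_eq0 (linearB qproj) /= qprojK subrr.
by rewrite -subr_eq0 -(linearB qproj) qproj_eq0 -(linearB f); exact: fU vU.
Qed.

Variables (C : complexes V) (grU : forall i, stable U (gr C i))
  (dfU : stable U (df C)).

Lemma quot_gr_gr i j (x : quotv U) :
  qmap (gr C i) (qmap (gr C j) x) = if i == j then qmap (gr C j) x else 0.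
Proof.
rewrite -(qprojK x) !qmapE // gr_gr; case: ifP => // _; exact: linear0.
Qed.

Lemma quot_gr_sum (x : quotv U) :
  exists2 s : seq int, uniq s & x = \sum_(i <- s) qmap (gr C i) x.
Proof.
have [s us xs] := gr_sum C (vsval x); exists s => //.
rewrite -{1}(qprojK x) {1}xs linear_sum; apply: eq_bigr => i _ /=.
by rewrite -qmapE // qprojK.
Qed.

Lemma quot_df_gr i (x : quotv U) :
  qmap (df C) (qmap (gr C i) x) = qmap (gr C (i + 1)) (qmap (df C) x).
Proof. by rewrite -(qprojK x) !qmapE // df_gr. Qed.

Lemma quot_df_df (x : quotv U) : qmap (df C) (qmap (df C) x) = 0.
Proof. by rewrite -(qprojK x) !qmapE // df_df linear0. Qed.

Definition quot_complex : complexes (quotv U) :=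
  @Complexes k (quotv U) (fun i => qmap (gr C i)) (qmap (df C))
    quot_gr_gr quot_gr_sum quot_df_gr quot_df_df.

End Quotient.

Section FiniteDimComplex.
Variables (k : fieldType) (V : vectType k) (C : complexes V).

Lemma gr_seq_eq (s : seq int) (x : V) : uniq s ->
  (forall i, i \notin s -> gr C i x = 0) -> x = \sum_(i <- s) gr C i x.
Proof.
move=> us sx; have [t ut tx] := gr_sum C x.
have gt i : i \notin t -> gr C i x = 0.
  move=> it; rewrite tx linear_sum big_seq big1 //= => l lt.
  by rewrite gr_gr; case: eqP => // il; rewrite il lt in it.
rewrite {1}tx (bigID (mem s)) /= [X in _ + X]big1 => [|i]; last exact: sx.
rewrite [RHS](bigID (mem t)) /= [X in _ = _ + X]big1 => [|i]; last exact: gt.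
rewrite !addr0 -[LHS]big_filter -[RHS]big_filter; apply: perm_big.
apply: uniq_perm; rewrite ?filter_uniq // => i.
by rewrite !mem_filter andbC.
Qed.

Lemma gr_bounded : exists2 s : seq int, uniq s &
  forall i x, i \notin s -> gr C i x = 0.
Proof.
pose b := vbasis {:V}.
pose s j := s2val (cid2 (gr_sum C b`_j)).
exists (undup (flatten [seq s j | j <- iota 0 (\dim {:V})])).
  exact: undup_uniq.
move=> i x; rewrite mem_undup => /flattenP/= nis.
rewrite (coord_vbasis (memvf x)) linear_sum big1 //= => j _.
rewrite linearZZ; suff -> : gr C i b`_j = 0 by rewrite scaler0.
rewrite (s2valP' (cid2 (gr_sum C b`_j))) linear_sum big_seq big1 //= => l ls.
rewrite gr_gr; case: eqP => // il; case: nis; exists (s j); last by rewrite il.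
by apply/mapP; exists (j : nat) => //; rewrite mem_iota /=.
Qed.

Lemma gr_finite (T : nmodType) (F : int -> T) :
  (forall i, (forall x, gr C i x = 0) -> F i = 0) ->
  finite_set ([set: int] `&` F @^-1` [set~ 0]).
Proof.
move=> F0; have [s us sC] := gr_bounded.
apply: (@sub_finite_set _ _ [set` s]); last exact: finite_seq.
move=> i [_ /= Fi]; apply: contrapT => /negP nis; apply: Fi; apply: F0 => x.
exact: sC.
Qed.

End FiniteDimComplex.

Lemma fsum_lfunE (k : fieldType) (V W : vectType k) (F : int -> 'Hom(V, W))
    (i : int) (x : V) :
  finite_set ([set: int] `&` F @^-1` [set~ 0]) ->
  (forall j, j != i -> F j x = 0) -> (\sum_(j \in [set: int]) F j) x = F i x.
Proof.
move=> fin F0; rewrite sum_lfunE.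
have [ii|nii] := boolP (i \in finite_support 0 [set: int] F).
  by rewrite (bigD1_seq i) ?finite_support_uniq //= big1 ?addr0.
rewrite big_seq big1 => [|j js]; last first.
  by apply: F0; apply: contraNneq nii => <-.
suff -> : F i = 0 by rewrite lfunE.
apply: contrapT => Fi; case/negP: nii.
by rewrite (in_finite_support fin) inE.
Qed.

Section TensorComplex.
Variables (k : fieldType) (V W : vectType k).
Variables (C : complexes V) (D : complexes W).

Definition tens_gr (n : int) : 'End(tens V W) :=
  \sum_(i \in [set: int]) tmap (gr C i) (gr D (n - i)).

(* the Koszul sign rule: d (v (x) w) = dv (x) w + (-1)^i v (x) dw for v in
   degree i *)
Definition tens_df : 'End(tens V W) :=
  tmap (df C) idfun +
  \sum_(i \in [set: int]) (-1) ^ i *: tmap (gr C i) (df D).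

Definition homog (U : lmodType k) (E : complexes U) (i : int) (x : U) : Prop :=
  gr E i x = x.

Lemma homog_gr (U : lmodType k) (E : complexes U) i x : homog E i (gr E i x).
Proof. by rewrite /homog gr_gr eqxx. Qed.

Lemma gr_homog (U : lmodType k) (E : complexes U) i j x : homog E i x ->
  gr E j x = if j == i then x else 0.
Proof. by move=> <-; rewrite gr_gr. Qed.

Lemma df_homog (U : lmodType k) (E : complexes U) i x :
  homog E i x -> homog E (i + 1) (df E x).
Proof. by move=> h; rewrite /homog -df_gr h. Qed.

Lemma tmap0l (f : {linear V -> V}) (g : {linear W -> W}) :
  (forall v, f v = 0) -> tmap f g = 0.
Proof.
by move=> f0; apply: tens_ext => v w; rewrite tmapE f0 tensor0l lfunE.
Qed.

Lemma tens_gr_homog n i j v w : homog C i v -> homog D j w ->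
  tens_gr n (tensor v w) = if n == i + j then tensor v w else 0.
Proof.
move=> hv hw; rewrite /tens_gr (@fsum_lfunE _ _ _ _ i).
- rewrite tmapE hv (gr_homog _ hw) subr_eq [j + i]addrC.
  by case: ifP => // _; rewrite tensor0r.
- by apply: (gr_finite (C := C)) => l; exact: tmap0l.
- by move=> l /negPf li; rewrite tmapE (gr_homog _ hv) li tensor0l.
Qed.

Lemma tens_df_homog i v w : homog C i v ->
  tens_df (tensor v w) = tensor (df C v) w + (-1) ^ i *: tensor v (df D w).
Proof.
move=> hv; rewrite /tens_df add_lfunE tmapE; congr (_ + _).
rewrite (@fsum_lfunE _ _ _ _ i).
- by rewrite scale_lfunE tmapE hv.
- by apply: (gr_finite (C := C)) => l l0; rewrite tmap0l ?scaler0.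
- move=> l /negPf li.
  by rewrite scale_lfunE tmapE (gr_homog _ hv) li tensor0l scaler0.
Qed.

Lemma tens_homog_ext (f g : 'End(tens V W)) :
  (forall i j v w, homog C i v -> homog D j w ->
     f (tensor v w) = g (tensor v w)) -> f =1 g.
Proof.
move=> fg; apply/lfunP; apply: tens_ext => v w.
have [s _ ->] := gr_sum C v; have [t _ ->] := gr_sum D w.
rewrite tensor_suml (linear_sum f) (linear_sum g); apply: eq_bigr => i _.
rewrite tensor_sumr (linear_sum f) (linear_sum g); apply: eq_bigr => j _.
by apply: (fg i j); exact: homog_gr.
Qed.

Lemma tens_gr_gr i j x :
  tens_gr i (tens_gr j x) = if i == j then tens_gr j x else 0.
Proof.
rewrite -[LHS](comp_lfunE (tens_gr i)).
have [->|/negPf ij] := eqVneq i j; last rewrite -[RHS](@zero_lfunE _ (tens V W) (tens V W) x).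
  apply: (@tens_homog_ext (tens_gr j \o tens_gr j)%VF) => p q v w hv hw.
  rewrite comp_lfunE (tens_gr_homog j hv hw); case: eqP => [->|_].
    by rewrite (tens_gr_homog _ hv hw) eqxx.
  by rewrite linear0.
apply: (@tens_homog_ext (tens_gr i \o tens_gr j)%VF 0) => p q v w hv hw.
rewrite comp_lfunE zero_lfunE (tens_gr_homog j hv hw); case: eqP => [jpq|_].
  by rewrite (tens_gr_homog _ hv hw) -jpq ij.
by rewrite linear0.
Qed.

Lemma tens_gr_sum x : exists2 s : seq int, uniq s & x = \sum_(i <- s) tens_gr i x.
Proof.
have [s us sC] := gr_bounded C; have [t ut tD] := gr_bounded D.
exists (undup [seq i + j | i <- s, j <- t]); first exact: undup_uniq.
rewrite -sum_lfunE; set f := \sum_(i <- _) _.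
rewrite -{1}[x](lfunE idfun) /=.
apply: (@tens_homog_ext (linfun idfun) f) => p q v w hv hw.
rewrite lfunE /= /f sum_lfunE.
have [ps|/sC p0] := boolP (p \in s); last first.
  by rewrite -hv p0 tensor0l big1 // => i _; rewrite linear0.
have [qt|/tD q0] := boolP (q \in t); last first.
  by rewrite -hw q0 tensor0r big1 // => i _; rewrite linear0.
have pq : p + q \in undup [seq i + j | i <- s, j <- t].
  by rewrite mem_undup; exact: allpairs_f.
rewrite (bigD1_seq (p + q)) ?undup_uniq //= (tens_gr_homog _ hv hw) eqxx.
rewrite big1 ?addr0 // => i /negPf ipq.
by rewrite (tens_gr_homog _ hv hw) ipq.
Qed.

Lemma tens_df_gr i x : tens_df (tens_gr i x) = tens_gr (i + 1) (tens_df x).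
Proof.
rewrite -[LHS](comp_lfunE tens_df) -[RHS](comp_lfunE (tens_gr _)).
apply: (@tens_homog_ext (tens_df \o tens_gr i)%VF
  (tens_gr (i + 1) \o tens_df)%VF) => p q v w hv hw.
rewrite !comp_lfunE (tens_gr_homog _ hv hw) (tens_df_homog _ hv).
rewrite linearD linearZ /= (tens_gr_homog _ (df_homog hv) hw).
rewrite (tens_gr_homog _ hv (df_homog hw)) addrAC addrA !(inj_eq (addIr _)).
case: ifP => _; first by rewrite (tens_df_homog _ hv).
by rewrite linear0 scaler0 addr0.
Qed.

Lemma tens_df_df x : tens_df (tens_df x) = 0.
Proof.
rewrite -[RHS](@zero_lfunE _ (tens V W) (tens V W) x) -[LHS](comp_lfunE tens_df).
apply: (@tens_homog_ext (tens_df \o tens_df)%VF 0) => p q v w hv hw.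
rewrite comp_lfunE zero_lfunE (tens_df_homog _ hv) linearD linearZ /=.
rewrite (tens_df_homog _ (df_homog hv)) (tens_df_homog _ hv) !df_df.
rewrite tensor0l tensor0r scaler0 addr0 add0r -scalerDl.
by rewrite exprzDr ?unitrN1 // expr1z mulrN1 addNr scale0r.
Qed.

Definition tens_complex : complexes (tens V W) :=
  @Complexes k (tens V W) (fun n => tens_gr n) tens_df
    tens_gr_gr tens_gr_sum tens_df_gr tens_df_df.

End TensorComplex.

Section Balanced.
Variables (k : fieldType) (V W : vectType k) (S : Type).
Variables (r : S -> {linear V -> V}) (l : S -> {linear W -> W}).

(* the subspace of V (x)_k W spanned by the v.s (x) w - v (x) s.w *)
Definition bal_rel : {vspace tens V W} :=
  vspan [set t | exists s v w, t = tensor (r s v) w - tensor v (l s w)].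

Definition bal_tens : vectType k := quotv bal_rel.

Lemma tmap_stable (f : {linear V -> V}) (g : {linear W -> W}) :
  (forall s v, f (r s v) = r s (f v)) -> (forall s w, g (l s w) = l s (g w)) ->
  stable bal_rel (tmap f g).
Proof.
move=> fr gl; apply: vspan_stable => _ [s [v [w ->]]].
rewrite linearB /= !tmapE fr gl; apply: mem_vspan.
by exists s, (f v), (g w).
Qed.

Variables (C : complexes V) (D : complexes W).
Hypothesis rgr : forall s i v, gr C i (r s v) = r s (gr C i v).
Hypothesis rdf : forall s v, df C (r s v) = r s (df C v).
Hypothesis lgr : forall s i w, gr D i (l s w) = l s (gr D i w).
Hypothesis ldf : forall s w, df D (l s w) = l s (df D w).

Lemma stable_fsum (U : {vspace tens V W}) (F : int -> 'End(tens V W)) :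
  (forall i, stable U (F i)) -> stable U (\sum_(i \in [set: int]) F i : 'End(_)).
Proof.
by move=> FU x xU; rewrite sum_lfunE; apply: memv_suml => i _; exact: FU.
Qed.

Lemma bal_gr_stable i : stable bal_rel (gr (tens_complex C D) i).
Proof.
by apply: stable_fsum => j; apply: tmap_stable => s x; rewrite ?rgr ?lgr.
Qed.

Lemma bal_df_stable : stable bal_rel (df (tens_complex C D)).
Proof.
move=> x xU; rewrite /= add_lfunE memvD //.
  by apply: tmap_stable xU => s y; rewrite ?rdf.
apply: stable_fsum xU => i y yU; rewrite scale_lfunE memvZ //.
by apply: tmap_stable yU => s z; rewrite ?rgr ?ldf.
Qed.

Definition bal_complex : complexes bal_tens :=
  quot_complex bal_gr_stable bal_df_stable.

End Balanced.

Section BimoduleTensor.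
Variables (k : fieldType) (A : falgType k) (V W : vectType k).
Variables (X : bimodule_complex A V) (Y : bimodule_complex A W).

Let T : vectType k := bal_tens (ract X) (lact Y).
Let U := bal_rel (ract X) (lact Y).

Definition bt_complex : complexes T :=
  bal_complex (fun a i => gr_ract X i a) (df_ract X)
    (fun a i => gr_lact Y i a) (df_lact Y).

Definition bt_lact (a : A) : 'End(T) := qmap U (tmap (lact X a) idfun).
Definition bt_ract (a : A) : 'End(T) := qmap U (tmap idfun (ract Y a)).

Lemma bt_lact_stable a : stable U (tmap (lact X a) idfun).
Proof. by apply: tmap_stable => // b x; rewrite lract. Qed.

Lemma bt_ract_stable a : stable U (tmap idfun (ract Y a)).
Proof. by apply: tmap_stable => // b x; rewrite lract. Qed.

Lemma bal_ext (f g : 'End(T)) :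
  (forall v w, f (qproj U (tensor v w)) = g (qproj U (tensor v w))) -> f = g.
Proof.
move=> fg; pose p : 'Hom(tens V W, T) := linfun (qproj U).
apply/lfunP => x; rewrite -(qprojK x).
rewrite [vsval x]tens_decomp (linear_sum (qproj U)) !linear_sum.
apply: eq_bigr => i _; rewrite (linear_sum (qproj U)) !linear_sum.
apply: eq_bigr => j _; rewrite (linearZZ (qproj U)) (linearZZ f) (linearZZ g).
congr (_ *: _); exact: fg.
Qed.

Lemma bt_lactE a v w :
  bt_lact a (qproj U (tensor v w)) = qproj U (tensor (lact X a v) w).
Proof. by rewrite /bt_lact (qmapE _ (@bt_lact_stable a)) /= tmapE. Qed.

Lemma bt_ractE a v w :
  bt_ract a (qproj U (tensor v w)) = qproj U (tensor v (ract Y a w)).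
Proof. by rewrite /bt_ract (qmapE _ (@bt_ract_stable a)) /= tmapE. Qed.

Lemma bt_lact_lin x : linear (fun a => bt_lact a x).
Proof.
move=> c a b; rewrite -scale_lfunE -add_lfunE; suff -> :
  bt_lact (c *: a + b) = c *: bt_lact a + bt_lact b by [].
apply: bal_ext => v w; rewrite add_lfunE scale_lfunE !bt_lactE lact_lin.
by rewrite tensor_linl (linearP (qproj U)).
Qed.

Lemma bt_ract_lin x : linear (fun a => bt_ract a x).
Proof.
move=> c a b; rewrite -scale_lfunE -add_lfunE; suff -> :
  bt_ract (c *: a + b) = c *: bt_ract a + bt_ract b by [].
apply: bal_ext => v w; rewrite add_lfunE scale_lfunE !bt_ractE ract_lin.
by rewrite tensor_linr (linearP (qproj U)).
Qed.

Lemma bt_lact1 x : bt_lact 1 x = x.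
Proof.
rewrite -[RHS](@id_lfunE _ T); suff -> : bt_lact 1 = \1%VF by [].
by apply: bal_ext => v w; rewrite id_lfunE bt_lactE lact1.
Qed.

Lemma bt_ract1 x : bt_ract 1 x = x.
Proof.
rewrite -[RHS](@id_lfunE _ T); suff -> : bt_ract 1 = \1%VF by [].
by apply: bal_ext => v w; rewrite id_lfunE bt_ractE ract1.
Qed.

Lemma bt_lactM a b x : bt_lact (a * b) x = bt_lact a (bt_lact b x).
Proof.
rewrite -[RHS](comp_lfunE (bt_lact a)).
suff -> : bt_lact (a * b) = (bt_lact a \o bt_lact b)%VF by [].
by apply: bal_ext => v w; rewrite comp_lfunE !bt_lactE lactM.
Qed.

Lemma bt_ractM a b x : bt_ract (a * b) x = bt_ract b (bt_ract a x).
Proof.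
rewrite -[RHS](comp_lfunE (bt_ract b)).
suff -> : bt_ract (a * b) = (bt_ract b \o bt_ract a)%VF by [].
by apply: bal_ext => v w; rewrite comp_lfunE !bt_ractE ractM.
Qed.

Lemma bt_lract a b x : bt_lact a (bt_ract b x) = bt_ract b (bt_lact a x).
Proof.
rewrite -[LHS](comp_lfunE (bt_lact a)) -[RHS](comp_lfunE (bt_ract b)).
suff -> : (bt_lact a \o bt_ract b)%VF = (bt_ract b \o bt_lact a)%VF by [].
apply: bal_ext => v w; rewrite !comp_lfunE.
by rewrite bt_ractE !bt_lactE bt_ractE.
Qed.

Definition bt_bimodule : bimodule A T :=
  @Bimodule k A T (fun a => bt_lact a) (fun a => bt_ract a)
    bt_lact_lin bt_ract_lin bt_lact1 bt_ract1 bt_lactM bt_ractM bt_lract.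

Lemma qmap_comm (f g : 'End(tens V W)) (x : T) : stable U f -> stable U g ->
  (f \o g = g \o f)%VF -> qmap U f (qmap U g x) = qmap U g (qmap U f x).
Proof.
move=> fU gU fg; rewrite -(qprojK x) !qmapE //=.
move: (vsval x) => y; congr (qproj U _).
by rewrite -[f (g y)]comp_lfunE -[g (f y)]comp_lfunE fg.
Qed.

Lemma tmap_comm (f f' : {linear V -> V}) (g g' : {linear W -> W}) :
  (forall v, f (f' v) = f' (f v)) -> (forall w, g (g' w) = g' (g w)) ->
  (tmap f g \o tmap f' g' = tmap f' g' \o tmap f g)%VF.
Proof.
by move=> ff gg; apply: tens_ext => v w; rewrite !comp_lfunE !tmapE ff gg.
Qed.

Lemma fsum_comm (h : 'End(tens V W)) (F : int -> 'End(tens V W)) :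
  (forall i, (F i \o h = h \o F i)%VF) ->
  ((\sum_(i \in [set: int]) F i) \o h = h \o (\sum_(i \in [set: int]) F i))%VF.
Proof.
move=> Fh; apply/lfunP => x; rewrite !comp_lfunE !sum_lfunE (linear_sum h).
by apply: eq_bigr => i _; rewrite -[LHS]comp_lfunE Fh comp_lfunE.
Qed.

Lemma tens_gr_comm i (f : {linear V -> V}) (g : {linear W -> W}) :
  (forall j v, gr X j (f v) = f (gr X j v)) ->
  (forall j w, gr Y j (g w) = g (gr Y j w)) ->
  (tens_gr X Y i \o tmap f g = tmap f g \o tens_gr X Y i)%VF.
Proof. by move=> fX gY; apply: fsum_comm => j; exact: tmap_comm. Qed.

Lemma tens_df_comm (f : {linear V -> V}) (g : {linear W -> W}) :
  (forall j v, gr X j (f v) = f (gr X j v)) ->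
  (forall v, df X (f v) = f (df X v)) ->
  (forall w, df Y (g w) = g (df Y w)) ->
  (tens_df X Y \o tmap f g = tmap f g \o tens_df X Y)%VF.
Proof.
move=> fX dX dY; rewrite comp_lfunDl comp_lfunDr; congr (_ + _).
  exact: tmap_comm.
apply: fsum_comm => j; rewrite -(comp_lfunZl _ (tmap _ _)) -(comp_lfunZr _ (tmap _ _)); congr (_ *: _).
exact: tmap_comm.
Qed.

Lemma bt_gr_lact i a x :
  gr bt_complex i (lact bt_bimodule a x) = lact bt_bimodule a (gr bt_complex i x).
Proof.
apply: qmap_comm; [exact: (bal_gr_stable (fun a i => gr_ract X i a)
  (fun a i => gr_lact Y i a))|exact: bt_lact_stable|].
by apply: tens_gr_comm => // j v; rewrite gr_lact.
Qed.

Lemma bt_gr_ract i a x :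
  gr bt_complex i (ract bt_bimodule a x) = ract bt_bimodule a (gr bt_complex i x).
Proof.
apply: qmap_comm; [exact: (bal_gr_stable (fun a i => gr_ract X i a)
  (fun a i => gr_lact Y i a))|exact: bt_ract_stable|].
by apply: tens_gr_comm => // j v; rewrite gr_ract.
Qed.

Lemma bt_df_lact a x :
  df bt_complex (lact bt_bimodule a x) = lact bt_bimodule a (df bt_complex x).
Proof.
apply: qmap_comm; [exact: (bal_df_stable (fun a i => gr_ract X i a)
  (df_ract X) (df_lact Y))|exact: bt_lact_stable|].
by apply: tens_df_comm => // [j v|v]; rewrite (gr_lact, df_lact).
Qed.

Lemma bt_df_ract a x :
  df bt_complex (ract bt_bimodule a x) = ract bt_bimodule a (df bt_complex x).
Proof.
apply: qmap_comm; [exact: (bal_df_stable (fun a i => gr_ract X i a)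
  (df_ract X) (df_lact Y))|exact: bt_ract_stable|].
by apply: tens_df_comm => // v; rewrite df_ract.
Qed.

Definition bimod_tensor : bimodule_complex A T :=
  BimoduleComplex bt_gr_lact bt_gr_ract bt_df_lact bt_df_ract.

End BimoduleTensor.

Section Stalk.
Variables (k : fieldType) (V : lmodType k).

Definition stalk_gr (i : int) : {linear V -> V} :=
  if i == 0 then (idfun : {linear V -> V}) else (\0 : {linear V -> V}).

Lemma stalk_gr_gr i j x :
  stalk_gr i (stalk_gr j x) = if i == j then stalk_gr j x else 0.
Proof.
rewrite /stalk_gr; have [->|ij] := eqVneq i j; first by case: ifP.
have [i0|//] := eqVneq i 0.
by rewrite -i0 eq_sym (negPf ij).
Qed.

Lemma stalk_gr_sum x :
  exists2 s : seq int, uniq s & x = \sum_(i <- s) stalk_gr i x.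
Proof. by exists [:: 0] => //; rewrite big_seq1 /stalk_gr eqxx. Qed.

Lemma stalk_df_gr i x :
  (\0 : {linear V -> V}) (stalk_gr i x) =
  stalk_gr (i + 1) ((\0 : {linear V -> V}) x).
Proof. by rewrite linear0. Qed.

Lemma stalk_df_df x :
  (\0 : {linear V -> V}) ((\0 : {linear V -> V}) x) = 0.
Proof. by []. Qed.

Definition stalk : complexes V :=
  Complexes stalk_gr_gr stalk_gr_sum stalk_df_gr stalk_df_df.

End Stalk.

Section Hochschild.
Variables (k : fieldType) (A : falgType k).

Lemma amullE (a x : A) : amull a x = a * x.
Proof. exact: lfunE. Qed.

Lemma amulrE (a x : A) : amulr a x = x * a.
Proof. exact: lfunE. Qed.

Lemma amull_lin (x : A) : linear (fun a => amull a x).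
Proof. by move=> c a b; rewrite !amullE mulrDl scalerAl. Qed.

Lemma amulr_lin (x : A) : linear (fun a => amulr a x).
Proof. by move=> c a b; rewrite !amulrE mulrDr scalerAr. Qed.

Lemma amull_1 (x : A) : amull 1 x = x.
Proof. by rewrite amullE mul1r. Qed.

Lemma amulr_1 (x : A) : amulr 1 x = x.
Proof. by rewrite amulrE mulr1. Qed.

Lemma amull_M (a b x : A) : amull (a * b) x = amull a (amull b x).
Proof. by rewrite !amullE mulrA. Qed.

Lemma amulr_M (a b x : A) : amulr (a * b) x = amulr b (amulr a x).
Proof. by rewrite !amulrE mulrA. Qed.

Lemma amull_amulr (a b x : A) : amull a (amulr b x) = amulr b (amull a x).
Proof. by rewrite !(amullE, amulrE) mulrA. Qed.

Definition regular_bimodule : bimodule A A :=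
  @Bimodule k A A (fun a => amull a) (fun a => amulr a)
    amull_lin amulr_lin amull_1 amulr_1 amull_M amulr_M amull_amulr.

Variables (W : vectType k) (Y : bimodule_complex A W).

(* A^e is spanned by the a (x) b, which act by x.(a (x) b) = a x b on the
   right of A and by (a (x) b).y = b y a on the left of Y. *)
Definition env_ract (s : A * A) : {linear A -> A} :=
  ract regular_bimodule s.2 \o lact regular_bimodule s.1.
Definition env_lact (s : A * A) : {linear W -> W} :=
  lact Y s.2 \o ract Y s.1.

Lemma env_ract_gr s i x :
  gr (stalk A) i (env_ract s x) = env_ract s (gr (stalk A) i x).
Proof. by rewrite /= /stalk_gr; case: ifP => // _; rewrite /= !linear0. Qed.

Lemma env_ract_df s x : df (stalk A) (env_ract s x) = env_ract s (df (stalk A) x).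
Proof. by rewrite /= !linear0. Qed.

Lemma env_lact_gr s i y : gr Y i (env_lact s y) = env_lact s (gr Y i y).
Proof. by rewrite /= gr_lact gr_ract. Qed.

Lemma env_lact_df s y : df Y (env_lact s y) = env_lact s (df Y y).
Proof. by rewrite /= df_lact df_ract. Qed.

Definition hochschild : complexes (bal_tens env_ract env_lact) :=
  bal_complex env_ract_gr env_ract_df env_lact_gr env_lact_df.

End Hochschild.

Record fd_bimodule_complex (k : fieldType) (A : falgType k) :=
  FdBimoduleComplex {
  fd_space : vectType k;
  fd_complex :> bimodule_complex A fd_space
}.

Section Entropy.
Variables (k : fieldType) (A : falgType k).

(* the (n+1)-fold tensor product of P over A *)
Fixpoint tensor_powerS (P : fd_bimodule_complex A) (n : nat) :
    fd_bimodule_complex A :=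
  match n with
  | 0%N => P
  | n'.+1 => FdBimoduleComplex (bimod_tensor (tensor_powerS P n') P)
  end.

(* A strictly perfect resolution of M: a quasi-isomorphism to M from a bounded
   complex P of finitely generated projective bimodules.  As P has finite
   dimensional total space, each of its terms is (finitely generated)
   projective if and only if their direct sum is. *)
Definition strictly_perfect_resolution (V : lmodType k)
    (M : bimodule_complex A V) (P : fd_bimodule_complex A) : Prop :=
  projective_bimodule P /\
  exists f : {linear fd_space P -> V}, quasi_isomorphism P M f.

Definition perfect (V : lmodType k) (M : bimodule_complex A V) : Prop :=
  exists P, strictly_perfect_resolution M P.

(* The choice of the resolution does not affect the cohomology of the derived
   tensor products below, up to isomorphism. *)
Definition resolution (V : lmodType k) (M : bimodule_complex A V)
  (M_perf : perfect M) : fd_bimodule_complex A := projT1 (cid M_perf).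

(* The total dimension of A (x)^L_{A^e} M^{(x)^L_A n.+1}.  If P is a strictly
   perfect resolution of M, the powers of P are again bounded complexes of
   projective bimodules, so that they compute the derived tensor products. *)
Definition HH_tdim (V : lmodType k) (M : bimodule_complex A V)
    (M_perf : perfect M) (n : nat) : nat :=
  tdim (hochschild (tensor_powerS (resolution M_perf) n)).

Definition HH_entropy (R : realType) (V : lmodType k)
    (M : bimodule_complex A V) (M_perf : perfect M) : \bar R :=
  limn_esup (fun n =>
    ((n.+1%:R^-1 : R)%:E * lne ((HH_tdim M_perf n)%:R : R)%:E)%E).

End Entropy.

Section Cartan.
Variables (k : fieldType) (A : falgType k) (r : nat) (e : 'I_r -> A).

(* the Cartan matrix of the subquotient Z/B of a bimodule, for sub-bimodules
   B and Z with B contained in Z *)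
Definition cartan_subquotient (V : lmodType k) (N : bimodule A V)
    (Z B : set V) : 'M[int]_r :=
  \matrix_(i, j)
    (qdim [set lact N (e j) (ract N (e i) z) | z in Z] B : int).

Definition cartan (V : lmodType k) (N : bimodule A V) : 'M[int]_r :=
  cartan_subquotient N setT [set 0].

Definition cartan_complex (V : lmodType k) (M : bimodule_complex A V) :
    'M[int]_r :=
  \sum_(l \in [set: int])
    (-1) ^ l *: cartan_subquotient M (cocycles M l) (coboundaries M l).

(* The inverse is taken over int: det C_A = 1 or -1 for A elementary of finite
   global dimension. *)
Definition dual_coxeter (V : lmodType k) (M : bimodule_complex A V) :
    'M[int]_r :=
  - (cartan_complex M *m invmx (cartan (regular_bimodule A))).

End Cartan.

Definition spectral_radius (R : realType) (r : nat) (Psi : 'M[int]_r) : R :=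
  sup [set Normc.normc z | z in
    [set z : R[i] | eigenvalue (map_mx (intr : int -> R[i]) Psi) z]].

(* Main.v *)
Require Import Defs.
From HB Require Import structures.
From mathcomp Require Import all_boot all_order all_algebra all_field.
From mathcomp Require Import complex.
From mathcomp Require Import all_classical all_reals all_analysis.

(** Let P be a strictly perfect resolution of M, C the Cartan matrix of A, and
    N = C_M C^-1, so that the dual Coxeter matrix Psi is -N. The theorem rests on
    the identity

      tr (N ^ n) = Euler characteristic of A (x)_{A^e} P^{(x)_A n},

    which bounds |tr (Psi ^ n)| by the total dimension of Hochschild homology
    ([trace_le_HH_tdim]), together with the fact that the traces of the powers of
    a matrix grow at the rate of its spectral radius ([trace_growth]).

    The identity is a count of dimensions. Since A is elementary, an
    indecomposable projective bimodule is some A e_a (x) e_b A, and the terms of P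
    are sums of these ([generators]). This is proved with explicit generators and
    coordinate maps: Nakayama's lemma ([eigenform]) provides simple quotients, and
    projectivity splits off one summand after another. Let m be the matrix of
    signed multiplicities of these summands ([mult]). An Euler characteristic
    depends only on a homogeneous basis of the complex, not on the differential
    ([euler_dual_bases]), and explicit bases give

      C_P = C m C,   C_{X (x)_A P} = C m C_X,   chi (HH (X (x)_A P)) = tr (m C_X)

    ([cartan_free], [cartan_tensor], [hochschild_tdim]) for every bounded
    complex X of finite dimensional bimodules. As C is invertible, C m = N by the
    first formula, and induction on n with X a tensor power of P gives the
    identity for n >= 2. The second and third formulas rest on the decomposition
    of the last factor alone, which is why X may be arbitrary.

    The matrix C is invertible over the integers because the global dimension is
    finite ([peirce_unimodular]): the dimension vector of a projective module is
    an integral combination of the rows of C, hence so is that of a module with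
    a finite resolution by finite dimensional projectives, and the simple
    modules have the unit vectors as dimension vectors. The resolutions that
    are given may be infinite dimensional; dimension shifting transfers them to
    finite dimensional syzygies ([pdim_le_dim_vector]). *)

Set Implicit Arguments.
Unset Strict Implicit.
Unset Printing Implicit Defensive.

Import Order.TTheory GRing.Theory Num.Theory.

Local Open Scope classical_set_scope.
Local Open Scope ring_scope.

(** * Quotient dimensions and Euler characteristics *)

Definition mklin (R : nzRingType) (V W : lmodType R) (f : V -> W)
    (lf : linear f) : {linear V -> W} :=
  HB.pack f (GRing.isLinear.Build R V W _ f lf).

Section LinearFunctions.
Variables (R : nzRingType) (V W : lmodType R) (f : V -> W).
Hypothesis lf : linear f.

Lemma lin0 : f 0 = 0.
Proof. exact: (linear0 (mklin lf)). Qed.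

Lemma linZ c x : f (c *: x) = c *: f x.
Proof. exact: (linearZZ (mklin lf)). Qed.

Lemma linD x y : f (x + y) = f x + f y.
Proof. exact: (linearD (mklin lf)). Qed.

Lemma linB x y : f (x - y) = f x - f y.
Proof. exact: (linearB (mklin lf)). Qed.

Lemma lin_sum I (s : seq I) (P : pred I) (F : I -> V) :
  f (\sum_(i <- s | P i) F i) = \sum_(i <- s | P i) f (F i).
Proof. exact: (linear_sum (mklin lf)). Qed.

End LinearFunctions.

Lemma lin_comb (k : fieldType) (V W : lmodType k) (f g : V -> W) c :
  linear f -> linear g -> linear (fun x => c *: f x + g x).
Proof.
by move=> lf lg d x y; rewrite lf lg !scalerDr !scalerA (mulrC c) addrACA.
Qed.

Definition linear_subspace (k : fieldType) (V : lmodType k) (B : set V) : Prop :=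
  B 0 /\ forall c x y, B x -> B y -> B (c *: x + y).

Section Qdim.
Variables (k : fieldType) (V : lmodType k).
Implicit Types S B : set V.

Lemma subspace_sum B (subB : linear_subspace B) (I : Type) (s : seq I) (c : I -> k)
    (x : I -> V) : (forall i, B (x i)) -> B (\sum_(i <- s) c i *: x i).
Proof.
case: subB => B0 BP Bx; elim: s => [|i s IHs]; first by rewrite big_nil.
by rewrite big_cons; exact: BP.
Qed.

(** The coordinates of one family in the other form a matrix with independent
    rows. *)
Lemma is_qdim_leq S B n m : linear_subspace B -> is_qdim S B n -> is_qdim S B m ->
  (n <= m)%N.
Proof.
move=> subB [b [bS bfree _]] [c [_ _ cgen]].
have /fin_all_exists[M bM] i : exists M : 'I_m -> k, B (b i - \sum_j M j *: c j).
  exact/cgen/bS.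
suff : row_free (\matrix_(i, j) M i j) by move=> /eqP <-; exact: rank_leq_col.
apply: inj_row_free => u uM; apply/rowP => i; rewrite mxE.
apply: (bfree (u 0)).
have -> : \sum_i u 0 i *: b i = \sum_i u 0 i *: (b i - \sum_j M i j *: c j).
  under [RHS]eq_bigr do rewrite scalerBr.
  rewrite sumrB -[LHS]subr0; congr (_ - _).
  under eq_bigr do rewrite scaler_sumr.
  rewrite exchange_big big1 //= => j _.
  under eq_bigr do rewrite scalerA.
  rewrite -scaler_suml; move/rowP/(_ j): uM; rewrite !mxE.
  by under eq_bigr do rewrite mxE; move=> ->; rewrite scale0r.
exact: subspace_sum.
Qed.

Lemma qdimE S B n : linear_subspace B -> is_qdim S B n -> qdim S B = n.
Proof.
move=> subB Sn; rewrite /qdim; case: xgetP => [m _ /= Sm|/(_ n)//].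
by apply/eqP; rewrite eqn_leq !(@is_qdim_leq S B).
Qed.

Lemma coboundaries_subspace (C : complexes V) l : linear_subspace (coboundaries C l).
Proof.
split=> [|c x y [x' hx ->] [y' hy ->]]; first by exists 0; rewrite ?linear0.
by exists (c *: x' + y'); rewrite linearP ?hx ?hy.
Qed.

End Qdim.

Section Vspace.
Variables (k : fieldType) (V : vectType k).

Lemma is_qdim_vspace (S B : set V) (US UB : {vspace V}) :
  (forall x, S x <-> x \in US) -> (UB <= US)%VS ->
  (forall x, x \in US -> (B x <-> x \in UB)) ->
  is_qdim S B (\dim US - \dim UB).
Proof.
move=> SU sub BU.
have <- : \dim (US :\: UB) = (\dim US - \dim UB)%N.
  by rewrite -(dimv_cap_compl US UB) (capv_idPr sub) addKn.
pose b := vbasis (US :\: UB).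
have bD i : b`_i \in (US :\: UB)%VS.
  have [lti|] := ltnP i (size b); first exact/vbasis_mem/mem_nth.
  by move=> /(nth_default 0) ->; rewrite mem0v.
exists (fun i => b`_i); split=> [i|c|x].
- by apply/SU; apply: (subvP (diffvSl US UB)).
- move=> Bs; have sD : \sum_i c i *: b`_i \in (US :\: UB)%VS.
    by apply: memv_suml => i _; exact/memvZ/bD.
  have sU : \sum_i c i *: b`_i \in UB by apply/BU => //; exact: (subvP (diffvSl US UB)).
  have : \sum_i c i *: b`_i \in ((US :\: UB) :&: UB)%VS by rewrite memv_cap sD.
  rewrite capv_diff memv0 => /eqP s0.
  have /basis_free/freeP := vbasisP (US :\: UB); exact.
- move=> /SU xU; have : x \in (US :\: UB + US :&: UB)%VS by rewrite addv_diff_cap.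
  move=> /memv_addP[y yD [z]]; rewrite memv_cap => /andP[zUS zU] xyz.
  exists (fun i => coord b i y); rewrite -(coord_vbasis yD) xyz addrC addKr.
  by apply/BU.
Qed.

(** Dual families replace bases indexed by an initial segment of the integers:
    the index type of a basis of a tensor product is then a product. *)
Definition dual_bases (T : finType) (b : T -> V) (f : T -> V -> k^o) : Prop :=
  [/\ forall t, linear (f t), forall s t, f s (b t) = (s == t)%:R
    & forall v, v = \sum_t f t v *: b t].

Lemma dim_dual_bases (T : finType) (b : T -> V) f (p : pred T) (U : {vspace V}) :
  dual_bases b f -> (forall t, p t -> b t \in U) ->
  (forall t v, v \in U -> ~~ p t -> f t v = 0) -> \dim U = #|p|.
Proof.
case=> fl fb bf pU Up.
pose F v : 'rV[k]_#|p| := \row_i f (enum_val i) v.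
have Fl : linear F by move=> c x y; apply/rowP => i; rewrite !mxE fl.
pose phi : 'Hom(V, 'rV[k]_#|p|) := linfun (mklin Fl).
have phiE v i : phi v 0 i = f (enum_val i) v by rewrite lfunE /= mxE.
rewrite -(limg_dim_eq (f := phi)); last first.
  apply/eqP; rewrite -subv0; apply/subvP => v; rewrite memv_cap memv_ker memv0.
  move=> /andP[vU /eqP v0]; rewrite (bf v) big1 // => t _.
  have [pt|npt] := boolP (p t); last by rewrite Up ?scale0r.
  by move/rowP/(_ (enum_rank_in pt t)): v0; rewrite phiE mxE enum_rankK_in // => ->; rewrite scale0r.
suff -> : (phi @: U)%VS = fullv by rewrite dimvf dim_matrix mul1r.
apply/eqP; rewrite eqEsubv subvf; apply/subvP => r _; apply/memv_imgP.
exists (\sum_i r 0 i *: b (enum_val i)).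
  by apply: memv_suml => i _; apply/memvZ/pU; exact: enum_valP.
apply/rowP => i; rewrite phiE (lin_sum (fl _)) (bigD1 i) //=.
rewrite (linZ (fl _)) fb eqxx -[_ *: _]/(_ * _) mulr1 big1 ?addr0 // => j ji.
by rewrite (linZ (fl _)) fb (inj_eq enum_val_inj) eq_sym (negPf ji) scaler0.
Qed.

End Vspace.

Lemma fsum_seq (T : nmodType) (F : int -> T) (s : seq int) : uniq s ->
  (forall i, i \notin s -> F i = 0) ->
  \sum_(i \in [set: int]) F i = \sum_(i <- s) F i.
Proof.
move=> us F0; rewrite (fsbigE s) //; last by move=> i _ /F0.
by apply: eq_bigl => i; rewrite in_setT.
Qed.

Section Euler.
Variables (k : fieldType) (V : vectType k) (C : complexes V) (g : {linear V -> V}).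
Hypothesis gg : forall x, g (g x) = g x.
Hypothesis g_gr : forall i x, g (gr C i x) = gr C i (g x).
Hypothesis g_df : forall x, g (df C x) = df C (g x).

Let part l : {vspace V} := limg (linfun (g \o gr C l)).

Lemma mem_part l x : (x \in part l) <-> gr C l x = x /\ g x = x.
Proof.
split=> [/memv_imgP[y _ ->]|[lx gx]].
  by rewrite lfunE /= -!g_gr gr_gr eqxx !gg.
by rewrite -{1}gx -{1}lx -[g _]/((g \o gr C l) x) -lfunE memv_img ?memvf.
Qed.

Let Z l := (part l :&: lker (linfun (df C)))%VS.
Let B l := (linfun (df C) @: part (l - 1))%VS.

Lemma dim_part l : \dim (part l) = (\dim (Z l) + \dim (B (l + 1)))%N.
Proof. by rewrite /Z /B addrK limg_ker_dim. Qed.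

Lemma is_qdim_part l :
  is_qdim [set g z | z in cocycles C l] (coboundaries C l) (\dim (Z l) - \dim (B l)).
Proof.
have memZ x : x \in Z l <-> [/\ gr C l x = x, g x = x & df C x = 0].
  rewrite memv_cap memv_ker lfunE /=; split=> [/andP[/mem_part[? ?] /eqP]//|].
  by move=> [? ? /eqP ->]; rewrite andbT; apply/mem_part.
have sub : (B l <= Z l)%VS.
  apply/subvP => _ /memv_imgP[y /mem_part[ly gy] ->]; rewrite lfunE /=.
  apply/memZ; rewrite g_df gy df_df; split=> //.
  by rewrite -{2}ly df_gr subrK.
apply: is_qdim_vspace => // x.
  rewrite memZ; split=> [[z [lz dz] <-]|[lx gx dx]]; last by exists x.
  by rewrite -g_gr lz gg -g_df dz linear0.
move=> /memZ[lx gx dx]; split=> [[y ly xy]|/memv_imgP[y /mem_part[ly gy] ->]].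
  rewrite -gx xy g_df -[df C _](lfunE (df C)) memv_img //; apply/mem_part.
  by rewrite -g_gr ly gg.
by rewrite lfunE; exists y.
Qed.

Lemma dimB_le l : (\dim (B l) <= \dim (Z l))%N.
Proof.
apply: dimvS; apply/subvP => _ /memv_imgP[y /mem_part[ly gy] ->].
rewrite memv_cap memv_ker !lfunE /= df_df eqxx andbT; apply/mem_part.
by rewrite g_df gy -{2}ly df_gr subrK.
Qed.

Lemma part_finite : exists2 s : seq int, uniq s & forall l, l \notin s ->
  [/\ part l = 0%VS, Z l = 0%VS & B l = 0%VS].
Proof.
have [s us s0] := gr_bounded C.
have part0 l : l \notin s -> part l = 0%VS.
  move=> /s0 l0; apply/eqP; rewrite -subv0; apply/subvP => x /mem_part[<- _].
  by rewrite l0 mem0v.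
exists s => // l /part0 l0; have Z0 : Z l = 0%VS by rewrite /Z l0 cap0v.
split=> //; apply/eqP; rewrite -dimv_eq0 -leqn0 (leq_trans (dimB_le l)) //.
by rewrite Z0 dimv0.
Qed.

(** The alternating sum telescopes: a coboundary of degree l + 1 is counted once
    in degree l, as a term modulo cocycles, and once in degree l + 1. *)
Lemma euler_char :
  \sum_(l \in [set: int]) (-1) ^ l *
     (qdim [set g z | z in cocycles C l] (coboundaries C l) : int) =
  \sum_(l \in [set: int]) (-1) ^ l * (\dim (part l) : int).
Proof.
have [s us s0] := part_finite.
have q l : qdim [set g z | z in cocycles C l] (coboundaries C l) =
    (\dim (Z l) - \dim (B l))%N.
  by apply: qdimE (is_qdim_part l); exact: coboundaries_subspace.
have addE F G : (forall i, i \notin s -> F i = 0) -> (forall i, i \notin s -> G i = 0) ->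
    \sum_(l \in [set: int]) (F l + G l) =
    \sum_(l \in [set: int]) F l + \sum_(l \in [set: int]) G l :> int.
  move=> F0 G0; rewrite !(@fsum_seq _ _ s us) // ?big_split // => i si.
  by rewrite F0 // G0.
transitivity (\sum_(l \in [set: int]) ((-1) ^ l * (\dim (Z l) : int) +
    - ((-1) ^ l * (\dim (B l) : int)))).
  by apply: eq_fsbigr => l _; rewrite q -subzn ?dimB_le // mulrBr.
rewrite addE => [|i /s0[_ -> _]|i /s0[_ _ ->]]; rewrite ?dimv0 ?mulr0 ?oppr0 //.
transitivity (\sum_(l \in [set: int]) ((-1) ^ l * (\dim (Z l) : int)) +
  \sum_(l \in [set: int]) ((-1) ^ l * (\dim (B (l + 1)) : int))).
  congr (_ + _); rewrite (@reindex_fsbigT _ _ _ _ _ (fun l : int => l + 1)).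
    apply: eq_fsbigr => l _.
    by rewrite exprzDr ?unitrN1 // expr1z mulrN1 mulNr opprK.
  by exists (fun l => l - 1) => l; rewrite ?addrK ?subrK.
rewrite -addE; first by apply: eq_fsbigr => l _; rewrite dim_part -mulrDr PoszD.
- by move=> i /s0[_ -> _]; rewrite dimv0 mulr0.
- move=> i /s0[p0 _ _]; move/eqP: (dim_part i).
  by rewrite p0 dimv0 eq_sym addn_eq0 => /andP[_ /eqP ->]; rewrite mulr0.
Qed.

(** All Euler characteristics below are computed in this way: the differential
    does not matter, only the degrees of the vectors of a homogeneous basis. *)
Lemma euler_dual_bases (T : finType) (b : T -> V) f (d : T -> int) (p : pred T) :
  dual_bases b f ->
  (forall t, gr C (d t) (b t) = b t) ->
  (forall t, g (b t) = if p t then b t else 0) ->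
  \sum_(l \in [set: int]) (-1) ^ l *
     (qdim [set g z | z in cocycles C l] (coboundaries C l) : int) =
  \sum_(t | p t) (-1) ^ (d t).
Proof.
move=> bf db gb; rewrite euler_char.
have dimp l : \dim (part l) = #|[pred t | p t & d t == l]|.
  apply: (dim_dual_bases bf) => [t /andP[pt /eqP <-]|t v /mem_part[lv gv]].
    by apply/mem_part; rewrite db gb pt.
  case: bf => fl fb bf; rewrite inE negb_and => npt.
  rewrite -gv -lv (bf v) linear_sum linear_sum (lin_sum (fl _)).
  rewrite big1 //= => s _; rewrite !linearZZ -(db s) gr_gr (linZ (fl t)).
  have [ls|] := eqVneq l (d s); last by rewrite linear0 (lin0 (fl t)) scaler0.
  rewrite db gb; case: ifP => ps; rewrite ?(lin0 (fl t)) ?scaler0 //= fb.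
  have [ts|] := eqVneq t s; last by rewrite scaler0.
  by rewrite ts ps ls eqxx in npt.
rewrite (@fsum_seq _ _ (undup [seq d t | t <- enum T])) ?undup_uniq //; last first.
  move=> i; rewrite mem_undup dimp => ni; rewrite eq_card0 ?mulr0 // => t.
  rewrite !inE; apply/negP => /andP[_ /eqP dt]; case/negP: ni; rewrite -dt.
  by apply/mapP; exists t; rewrite ?mem_enum.
transitivity (\sum_(i <- undup [seq d t | t <- enum T])
   \sum_(t | p t) (if d t == i then (-1) ^ (d t) else 0) : int).
  apply: eq_bigr => l _; rewrite -big_mkcondr /= dimp -sum1_card.
  rewrite -natz natr_sum mulr_sumr; apply: eq_big => //= t /andP[_ /eqP ->].
  by rewrite mulr1.
rewrite exchange_big; apply: eq_bigr => t _ /=.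
rewrite (bigD1_seq (d t)) ?undup_uniq //=; last first.
  by rewrite mem_undup; apply/mapP; exists t; rewrite ?mem_enum.
by rewrite eqxx big1 ?addr0 // => i; rewrite eq_sym => /negPf ->.
Qed.

End Euler.

Lemma exprz_sign (l : int) : (-1) ^ l = (-1) ^+ `|l|%N :> int.
Proof. by case: l => n //=; rewrite NegzE /= -[LHS]/((-1) ^- n.+1) invr_sign. Qed.

Section TotalDimension.
Variables (k : fieldType) (V : vectType k) (C : complexes V).

Lemma tdim_ge (T : finType) (b : T -> V) f (d : T -> int) :
  dual_bases b f -> (forall t, gr C (d t) (b t) = b t) ->
  `|\sum_t (-1) ^ (d t) : int| <= (tdim C)%:Z.
Proof.
move=> bf db.
pose I : {linear V -> V} := idfun.
have Z1 l : [set I z | z in cocycles C l] = cocycles C l.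
  by apply/seteqP; split=> [_ [z hz <-]|z hz] //; exists z.
have /= <- := @euler_dual_bases k V C I _ _ _ T b f d xpredT bf db.
2-5: by [].
have [s us s0] := gr_bounded C.
have q0 i : i \notin s -> qdim (cocycles C i) (coboundaries C i) = 0%N.
  move=> /s0 i0; apply: qdimE; first exact: coboundaries_subspace.
  exists (fun=> 0); split=> [i'|c _ []//|x [ix _]]; first by case: i'.
  by exists (fun=> 0); rewrite -ix i0 big_ord0 subr0; exists 0; rewrite ?linear0.
under eq_fsbigr do rewrite Z1.
rewrite /tdim !(@fsum_seq _ _ s us) //; last by move=> i /q0 ->; rewrite mulr0.
rewrite (le_trans (ler_norm_sum _ _ _)) // -natz natr_sum ler_sum // => i _.
by rewrite normrM exprz_sign normr_sign mul1r natz.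
Qed.

End TotalDimension.

(** * Tensor products and Nakayama's lemma for bimodules *)

Section TensorLift.
Variables (k : fieldType) (V W : vectType k) (U : lmodType k).

Definition bilin (f : V -> W -> U) : Prop :=
  (forall w, linear (fun v => f v w)) /\ (forall v, linear (f v)).

Definition tlift (f : V -> W -> U) (X : tens V W) : U :=
  \sum_i \sum_j (X : 'M[k]_(_, _)) i j *: f (vbasis {:V})`_i (vbasis {:W})`_j.

Lemma tlift_linear f : linear (tlift f).
Proof.
move=> c X Y; rewrite /tlift scaler_sumr -big_split; apply: eq_bigr => i _ /=.
rewrite scaler_sumr -big_split; apply: eq_bigr => j _ /=.
by rewrite !mxE scalerDl scalerA.
Qed.

Lemma tens_eq (f g : tens V W -> U) : linear f -> linear g ->
  (forall v w, f (tensor v w) = g (tensor v w)) -> f =1 g.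
Proof.
move=> fl gl fg X; rewrite (tens_decomp X) (lin_sum fl) (lin_sum gl).
apply: eq_bigr => i _; rewrite (lin_sum fl) (lin_sum gl).
by apply: eq_bigr => j _; rewrite (linZ fl) (linZ gl) fg.
Qed.

Lemma tliftE f v w : bilin f -> tlift f (tensor v w) = f v w.
Proof.
move=> [fl fr]; rewrite {2}(coord_vbasis (memvf v)) (lin_sum (fl w)).
rewrite {2}(coord_vbasis (memvf w)); apply: eq_bigr => i _.
rewrite (linZ (fl _)) (lin_sum (fr _)) scaler_sumr; apply: eq_bigr => j _.
by rewrite mxE (linZ (fr _)) scalerA.
Qed.

End TensorLift.

Lemma subspace_vspace (k : fieldType) (V : vectType k) (S : set V) :
  linear_subspace S -> exists U : {vspace V}, forall x, x \in U <-> S x.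
Proof.
move=> subS.
pose P n := `[< exists2 X : seq V, {in X, forall x, S x} & \dim <<X>> = n >].
have exP : exists n, P n.
  by exists (\dim <<[::] : seq V>>); apply/asboolP; exists [::].
have ubP n : P n -> (n <= dim V)%N.
  by move=> /asboolP[X _ <-]; rewrite -dimvf dimvS ?subvf.
have [m /asboolP[X XS dX] maxm] := ex_maxnP exP ubP.
exists <<X>>%VS => x; split=> [/(@coord_span _ _ _ (in_tuple X)) ->|Sx].
  by apply: (subspace_sum subS) => i; apply: XS; exact: mem_nth.
have : (\dim <<x :: X>> <= \dim <<X>>)%N.
  rewrite dX; apply: maxm; apply/asboolP; exists (x :: X) => // y.
  by rewrite inE => /predU1P[->//|/XS].
move=> le; have sub : (<<X>> <= <<x :: X>>)%VS by rewrite span_cons addvSr.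
have /eqP -> : (<<X>> == <<x :: X>>)%VS by rewrite eqEdim sub.
by rewrite memv_span ?mem_head.
Qed.

Section Socle.
Variables (k : fieldType) (A : falgType k) (H : vectType k).
Variables (op : A -> H -> H) (m : A -> A -> A) (J : {vspace A}).
Hypothesis op_linl : forall x, linear (fun a => op a x).
Hypothesis op_linr : forall a, linear (op a).
Hypothesis op1 : forall x, op 1 x = x.
Hypothesis opM : forall a b x, op b (op a x) = op (m a b) x.
Hypothesis Jm : forall a b, a \in J -> m a b \in J.
Hypothesis Junit : forall a, a \in J -> exists b, m (1 - a) b = 1.

(** In a minimal nonzero submodule, J x is either 0 or everything; the latter
    is excluded, since x = a x with 1 - a invertible forces x = 0. The function
    [m] allows for left and for right actions. *)
Lemma socle (D : {vspace H}) : (forall a x, x \in D -> op a x \in D) ->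
  D != 0%VS -> exists2 x, x \in D /\ x != 0 & forall a, a \in J -> op a x = 0.
Proof.
have [n] := ubnP (\dim D); elim: n D => // n IHn D leD Dstable D0.
have [[x [a [xD aJ ax]]]|none] :=
    pselect (exists x a, [/\ x \in D, a \in J & op a x != 0]); last first.
  exists (vpick D) => [|a aJ]; first by rewrite memv_pick vpick0.
  apply/eqP; apply: contrapT => /negP ax; apply: none.
  by exists (vpick D), a; rewrite memv_pick.
pose opx : 'Hom(A, H) := linfun (mklin (op_linl x)).
have opxE b : opx b = op b x by rewrite lfunE.
pose D' := (opx @: J)%VS.
have D'sub : (D' <= D)%VS.
  by apply/subvP => _ /memv_imgP[b _ ->]; rewrite opxE Dstable.
have D'stable b y : y \in D' -> op b y \in D'.
  move=> /memv_imgP[c cJ ->]; rewrite opxE opM -opxE memv_img //; exact: Jm.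
have D'0 : D' != 0%VS.
  apply: contraNneq ax => D'0.
  by rewrite -opxE -memv0 -D'0 memv_img.
have lt : (\dim D' < n)%N.
  rewrite -ltnS (leq_trans _ leD) // ltnS ltn_neqAle dimvS // andbT.
  apply/negP => eqd; have /eqP DD' : (D' == D) by rewrite eqEdim D'sub (eqP eqd) leqnn.
  have : x \in D' by rewrite DD'.
  move=> /memv_imgP[b bJ]; rewrite opxE => xb.
  have [c bc] := Junit bJ; case/eqP: ax.
  suff -> : x = 0 by exact: (lin0 (op_linr a)).
  rewrite -[LHS]op1 -bc -opM (linB (op_linl x)) op1 -xb subrr.
  exact: (lin0 (op_linr c)).
have [y [yD' y0] yJ] := IHn D' lt D'stable D'0.
by exists y => //; split=> //; apply: (subvP D'sub).
Qed.

End Socle.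

Record action (k : fieldType) (A B : falgType k) (V : vectType k) := Action {
  la : A -> {linear V -> V};
  ra : B -> {linear V -> V};
  la_lin : forall x, linear (fun a => la a x);
  ra_lin : forall x, linear (fun a => ra a x);
  la1 : forall x, la 1 x = x;
  ra1 : forall x, ra 1 x = x;
  laM : forall a b x, la (a * b) x = la a (la b x);
  raM : forall a b x, ra (a * b) x = ra b (ra a x);
  lara : forall a b x, la a (ra b x) = ra b (la a x)
}.

(** What is used of an elementary algebra: characters dual to a complete set of
    orthogonal idempotents. Their common kernel is the radical, which matters
    only through the invertibility of the 1 - a. *)
Definition basic (k : fieldType) (A : falgType k) (r : nat) (e : 'I_r -> A)
    (chi : 'I_r -> {lrmorphism A -> k^o}) : Prop :=
  [/\ forall i j, chi i (e j) = (i == j)%:R,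
      forall i j, e i * e j = if i == j then e i else 0,
      \sum_i e i = 1
    & forall a, (forall i, chi i a = 0) -> 1 - a \is a GRing.unit].

Section Characters.
Variables (k : fieldType) (A B : falgType k).
Variables (r q : nat) (e : 'I_r -> A) (f : 'I_q -> B).
Variables (chi : 'I_r -> {lrmorphism A -> k^o}).
Variables (theta : 'I_q -> {lrmorphism B -> k^o}).

Definition eigen (V : vectType k) (X : action A B V) (a : 'I_r) (b : 'I_q)
    (phi : V -> k^o) : Prop :=
  forall x y v, phi (la X x (ra X y v)) = chi a x * theta b y * phi v.

Lemma basic_rad (a : A) i : basic e chi -> exists2 j,
  e i * a = chi i a *: e i + j & forall l, chi l j = 0.
Proof.
case=> chie ee _ _; exists (e i * a - chi i a *: e i); first by rewrite addrC subrK.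
move=> l; rewrite linearB linearZ /= rmorphM /= chie.
case: eqP => [->|_]; last by rewrite mul0r scaler0 subr0.
by rewrite -[_ *: _]/(_ * _) mul1r mulr1 subrr.
Qed.

Lemma basic_rad_r (a : A) i : basic e chi -> exists2 j,
  a * e i = chi i a *: e i + j & forall l, chi l j = 0.
Proof.
case=> chie ee _ _; exists (a * e i - chi i a *: e i); first by rewrite addrC subrK.
move=> l; rewrite linearB linearZ /= rmorphM /= chie.
case: eqP => [->|_]; last by rewrite mulr0 scaler0 subr0.
by rewrite -[_ *: _]/(_ * _) !mulr1 subrr.
Qed.

End Characters.

Section Nakayama.
Variables (k : fieldType) (A B : falgType k).
Variables (r q : nat) (e : 'I_r -> A) (f : 'I_q -> B).
Variables (chi : 'I_r -> {lrmorphism A -> k^o}).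
Variables (theta : 'I_q -> {lrmorphism B -> k^o}).
Hypotheses (basicA : basic e chi) (basicB : basic f theta).

Lemma radical_vspace (A' : falgType k) r' (e' : 'I_r' -> A') chi' :
  basic e' chi' -> exists J : {vspace A'},
  (forall a, a \in J <-> forall i, chi' i a = 0) /\
  [/\ forall a b, a \in J -> a * b \in J, forall a b, a \in J -> b * a \in J,
      forall a, a \in J -> exists b, (1 - a) * b = 1
    & forall a, a \in J -> exists b, b * (1 - a) = 1].
Proof.
case=> _ _ _ unitJ.
have [|J memJ] := @subspace_vspace k A' [set a | forall i, chi' i a = 0].
  split=> [i|c x y hx hy i]; first by rewrite linear0.
  by rewrite linearP /= hx hy scaler0 addr0.
exists J; split=> //; split=> [a b|a b|a|a] /memJ ha.
- by apply/memJ => i; rewrite rmorphM /= ha mul0r.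
- by apply/memJ => i; rewrite rmorphM /= ha mulr0.
- by exists (1 - a)^-1; rewrite mulrV ?unitJ.
- by exists (1 - a)^-1; rewrite mulVr ?unitJ.
Qed.

(** Nakayama's lemma for bimodules, in dual form: the linear forms that vanish
    on U are a bimodule, whose socle is a sum of characters. *)
Lemma eigenform (V : vectType k) (X : action A B V) (U : {vspace V}) :
  (forall x y v, v \in U -> la X x (ra X y v) \in U) -> U != fullv ->
  exists a b phi, [/\ linear phi, exists v, phi v != 0,
    forall u, u \in U -> phi u = 0 & eigen chi theta X a b phi].
Proof.
move=> Ustable Ufull.
have [JA [memJA [JAl JAr JAu JAu']]] := radical_vspace basicA.
have [JB [memJB [JBl JBr JBu JBu']]] := radical_vspace basicB.
pose H : vectType k := 'Hom(V, k^o).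
pose opL a (h : H) : H := (h \o linfun (la X a))%VF.
pose opR a (h : H) : H := (h \o linfun (ra X a))%VF.
have opLE a h v : opL a h v = h (la X a v) by rewrite /opL comp_lfunE lfunE.
have opRE a h v : opR a h v = h (ra X a v) by rewrite /opR comp_lfunE lfunE.
have opL_l h : linear (fun a => opL a h).
  by move=> c a b; apply/lfunP => v; rewrite add_lfunE scale_lfunE !opLE la_lin linearP.
have opR_l h : linear (fun a => opR a h).
  by move=> c a b; apply/lfunP => v; rewrite add_lfunE scale_lfunE !opRE ra_lin linearP.
have opL_r a : linear (opL a).
  by move=> c h h'; apply/lfunP => v; rewrite !(add_lfunE, scale_lfunE, opLE).
have opR_r a : linear (opR a).
  by move=> c h h'; apply/lfunP => v; rewrite !(add_lfunE, scale_lfunE, opRE).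
have opL1 h : opL 1 h = h by apply/lfunP => v; rewrite opLE la1.
have opR1 h : opR 1 h = h by apply/lfunP => v; rewrite opRE ra1.
have opLM a b h : opL b (opL a h) = opL (a * b) h.
  by apply/lfunP => v; rewrite !opLE laM.
have opRM a b h : opR b (opR a h) = opR (b * a) h.
  by apply/lfunP => v; rewrite !opRE raM.
have opLR a b h : opL a (opR b h) = opR b (opL a h).
  by apply/lfunP => v; rewrite !(opLE, opRE) lara.
have [|D0 memD0] := @subspace_vspace k H [set h | forall u, u \in U -> h u = 0].
  split=> [u _|c h h' hU hU' u uU]; first by rewrite zero_lfunE.
  by rewrite add_lfunE scale_lfunE hU // hU' // scaler0 addr0.
have D0_0 : D0 != 0%VS.
  have [v vU] : exists v, v \notin U.
    apply: contrapT => /forallNP all; case/eqP: Ufull; apply/eqP.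
    by rewrite eqEsubv subvf; apply/subvP => v _; apply/negbNE/negP; exact: all.
  (* a coordinate form of a complement of U that does not vanish at v *)
  pose w := v - projv U v.
  have w0 : w != 0.
    rewrite subr_eq0; apply: contraNneq vU => ->; exact: memv_proj.
  pose b := vbasis {:V}.
  have [i wi] : exists i, coord b i w != 0.
    apply: contrapT => /forallNP all; case/eqP: w0.
    rewrite (coord_vbasis (memvf w)) big1 // => i _.
    by have /negP := all i; rewrite negbK => /eqP ->; rewrite scale0r.
  have hl : linear ((fun x => coord b i (x - projv U x)) : V -> k^o).
    move=> c x y; have -> : c *: x + y - projv U (c *: x + y) =
        c *: (x - projv U x) + (y - projv U y).
      by rewrite linearP scalerBr opprD addrACA.
    exact: (coord_is_scalar b i c).
  pose h : H := linfun (mklin hl).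
  have hD0 : h \in D0.
    by apply/memD0 => u uU; rewrite lfunE /= projv_id // subrr linear0.
  apply: contraNneq wi => D00; move: hD0; rewrite D00 memv0 => /eqP h0.
  by move: (lfunE (mklin hl) v); rewrite -/h h0 zero_lfunE /= => <-.
have D0L a h : h \in D0 -> opL a h \in D0.
  move=> /memD0 hU; apply/memD0 => u uU; rewrite opLE hU // -[u](ra1 X).
  exact: Ustable.
have D0R a h : h \in D0 -> opR a h \in D0.
  move=> /memD0 hU; apply/memD0 => u uU; rewrite opRE hU // -[ra _ _ _](la1 X).
  exact: Ustable.
have [h [hD0 h0] hJA] := @socle k A H opL *%R JA opL_l opL_r opL1 opLM JAl JAu _ D0L D0_0.
(* The forms killed by the left radical are stable under the right action, so
   the socle for the right action can be taken among them. *)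
have [|D1 memD1] := @subspace_vspace k H
    [set h | h \in D0 /\ forall a, a \in JA -> opL a h = 0].
  split; first by split=> [|a _]; rewrite ?mem0v ?(lin0 (opL_r a)).
  move=> c x y [xD xJ] [yD yJ]; split; first by rewrite memvD ?memvZ.
  by move=> a aJ; rewrite opL_r xJ // yJ // scaler0 addr0.
have D1_0 : D1 != 0%VS.
  have: h \in D1 by exact/memD1.
  by move=> hD1; apply: contraNneq h0 => D10; rewrite -memv0 -D10.
have D1R a h' : h' \in D1 -> opR a h' \in D1.
  move=> /memD1[hD hJ]; apply/memD1; split=> [|b bJ]; first exact: D0R.
  by rewrite opLR hJ // (lin0 (opR_r a)).
have [g [/memD1[/memD0 gU gJA] g0] gJB] := @socle k B H opR (fun a b => b * a) JB
  opR_l opR_r opR1 opRM (fun a b => JBr a b) JBu' _ D1R D1_0.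
have [chie ee sume _] := basicA; have [thef ff sumf _] := basicB.
have [v gv] : exists v, g v != 0.
  apply: contrapT => /forallNP all; case/eqP: g0; apply/lfunP => v.
  by rewrite zero_lfunE; have /negP := all v; rewrite negbK => /eqP.
have [a [b gab]] : exists a b, g (la X (e a) (ra X (f b) v)) != 0.
  apply: contrapT => all; case/eqP: gv.
  rewrite -[v](la1 X) -sume (lin_sum (@la_lin _ _ _ _ X v)) linear_sum big1 //= => a _.
  rewrite -[v](ra1 X) -sumf (lin_sum (@ra_lin _ _ _ _ X v)) !linear_sum big1 //= => b _.
  by apply/eqP; apply: contrapT => /negP ab; apply: all; exists a, b.
(* Modulo the radical, e a and f b turn the action into a scalar one. *)
pose phi v : k^o := g (la X (e a) (ra X (f b) v)).
have phil : linear phi by move=> c x y; rewrite /phi !linearP.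
exists a, b, phi; split=> //; first by exists v.
  by move=> u uU; rewrite /phi gU // Ustable.
move=> x y w; rewrite /phi.
have [j ej jJ] := basic_rad x a basicA.
have [j' fj j'J] := basic_rad_r y b basicB.
rewrite -!lara -laM -raM ej fj.
have gj z : g (la X j z) = 0 by rewrite -opLE gJA ?zero_lfunE //; apply/memJA.
have gj' z : g (ra X j' z) = 0 by rewrite -opRE gJB ?zero_lfunE //; apply/memJB.
rewrite la_lin [in LHS]linearD /= gj addr0 linearZZ lara ra_lin linearD /= gj' addr0.
by rewrite linearZZ -!lara scalerA.
Qed.

End Nakayama.

(** * Projective bimodules are sums of copies of A e_a (x) f_b B *)

Section LeftFree.
Variables (k : fieldType) (A : falgType k) (W : vectType k).

Definition free_la (a : A) : 'End(tens A W) := tmap (amull a) idfun.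

Lemma free_laE a x y : free_la a (tensor x y) = tensor (a * x) y.
Proof. by rewrite tmapE /= amullE. Qed.

Lemma free_la_lin (X : tens A W) : linear (fun a => free_la a X).
Proof.
move=> c a b; move: X; apply: tens_eq; first exact: linearP.
  by apply: lin_comb => d x y; exact: linearP.
by move=> x y; rewrite !free_laE mulrDl -scalerAl tensor_linl.
Qed.

Lemma free_la1 (X : tens A W) : free_la 1 X = X.
Proof.
move: X; apply: tens_eq => [d x y|d x y|x y]; rewrite ?linearP //.
by rewrite free_laE mul1r.
Qed.

Lemma free_laM a b (X : tens A W) : free_la (a * b) X = free_la a (free_la b X).
Proof.
move: X; apply: tens_eq => [d x y|d x y|x y]; rewrite ?linearP //.
by rewrite !free_laE mulrA.
Qed.

End LeftFree.

Section FreeAction.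
Variables (k : fieldType) (A B : falgType k).

Let E : vectType k := tens A B.

Definition free_ra (b : B) : 'End(E) := tmap idfun (amulr b).

Lemma free_raE b x y : free_ra b (tensor x y) = tensor x (y * b).
Proof. by rewrite tmapE /= amulrE. Qed.

Lemma free_ra_lin (X : E) : linear (fun b => free_ra b X).
Proof.
move=> c a b; move: X; apply: tens_eq; first exact: linearP.
  by apply: lin_comb => d x y; exact: linearP.
by move=> x y; rewrite !free_raE mulrDr -scalerAr tensor_linr.
Qed.

Lemma free_ra1 (X : E) : free_ra 1 X = X.
Proof.
move: X; apply: tens_eq => [d x y|d x y|x y]; rewrite ?linearP //.
by rewrite free_raE mulr1.
Qed.

Lemma free_raM a b (X : E) : free_ra (a * b) X = free_ra b (free_ra a X).
Proof.
move: X; apply: tens_eq => [d x y|d x y|x y]; rewrite ?linearP //.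
by rewrite !free_raE mulrA.
Qed.

Lemma free_lara a b (X : E) : free_la B a (free_ra b X) = free_ra b (free_la B a X).
Proof.
move: X; apply: tens_eq => [d x y|d x y|x y]; rewrite ?linearP //.
by rewrite free_laE !free_raE free_laE.
Qed.

Definition free_action : action A B E :=
  @Action k A B E (fun a => free_la B a) (fun b => free_ra b)
    (@free_la_lin k A B) free_ra_lin (@free_la1 k A B) free_ra1
    (@free_laM k A B) free_raM free_lara.

Lemma free_actionE a b x y :
  la free_action a (ra free_action b (tensor x y)) = tensor (a * x) (y * b).
Proof. by rewrite /= free_raE free_laE. Qed.

Variables (V : vectType k) (X : action A B V).

(** [ev x] is the bimodule map from the free bimodule that sends 1 (x) 1 to x. *)
Definition ev (x : V) (T : E) : V := tlift (fun a b => la X a (ra X b x)) T.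

Lemma ev_linear x : linear (ev x).
Proof. exact: tlift_linear. Qed.

Lemma evE x a b : ev x (tensor a b) = la X a (ra X b x).
Proof.
rewrite /ev tliftE //; split=> [w c v v'|v c w w'].
  by rewrite (la_lin X).
by rewrite (ra_lin X) linearP.
Qed.

Lemma ev_linr T : linear (fun x => ev x T).
Proof.
move=> c x y; move: T; apply: tens_eq; first exact: ev_linear.
  by apply: lin_comb; exact: ev_linear.
by move=> a b; rewrite !evE !linearP.
Qed.

Lemma ev_hom x a b T :
  ev x (la free_action a (ra free_action b T)) = la X a (ra X b (ev x T)).
Proof.
move: T; apply: tens_eq => [d T T'|d T T'|a' b'].
- by rewrite !linearP ev_linear.
- by rewrite ev_linear !linearP.
- by rewrite free_actionE !evE laM raM -!lara.
Qed.

Lemma ev_comm (g : V -> V) (gl : linear g) :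
  (forall a b v, g (la X a (ra X b v)) = la X a (ra X b (g v))) ->
  forall x T, g (ev x T) = ev (g x) T.
Proof.
move=> gX x; apply: tens_eq => [d T T'|d T T'|a b].
- by rewrite ev_linear gl.
- by rewrite ev_linear.
- by rewrite !evE gX.
Qed.

End FreeAction.

Section Truncation.
Variables (k : fieldType) (A B : falgType k) (e : A) (f : B).

(** For idempotents e and f, the projection of A (x) B onto A e (x) f B. *)
Definition trunc : 'End(tens A B) := tmap (amulr e) (amull f).

Lemma truncE x y : trunc (tensor x y) = tensor (x * e) (f * y).
Proof. by rewrite tmapE /= amulrE amullE. Qed.

Lemma trunc_hom a b T : trunc (la (free_action A B) a (ra (free_action A B) b T)) =
  la (free_action A B) a (ra (free_action A B) b (trunc T)).
Proof.
move: T; apply: tens_eq => [d x y|d x y|x y]; rewrite ?linearP //.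
by rewrite free_actionE !truncE free_actionE !mulrA.
Qed.

Lemma trunc_trunc T : e * e = e -> f * f = f -> trunc (trunc T) = trunc T.
Proof.
move=> ee ff; move: T; apply: tens_eq => [d x y|d x y|x y]; rewrite ?linearP //.
by rewrite !truncE -mulrA ee mulrA ff.
Qed.

End Truncation.
Arguments trunc : simpl never.

Section Generators.
Variables (k : fieldType) (A B : falgType k).
Variables (r q : nat) (e : 'I_r -> A) (f : 'I_q -> B).
Variables (chi : 'I_r -> {lrmorphism A -> k^o}).
Variables (theta : 'I_q -> {lrmorphism B -> k^o}).
Hypotheses (basicA : basic e chi) (basicB : basic f theta).

Local Notation E := (free_action A B).

Definition char_form a b : tens A B -> k^o :=
  tlift (fun x y => chi a x * theta b y : k^o).

Lemma char_formE a b x y : char_form a b (tensor x y) = chi a x * theta b y.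
Proof.
rewrite /char_form tliftE //; split=> [w c v v'|v c w w'].
  by rewrite linearP /= mulrDl -[_ *: _]/(_ * _) -mulrA.
by rewrite linearP /= mulrDr -[_ *: _]/(_ * _) mulrCA.
Qed.

Lemma char_form_linear a b : linear (char_form a b).
Proof. exact: tlift_linear. Qed.

Lemma char_form_trunc a b T :
  char_form a b (trunc (e a) (f b) T) = char_form a b T.
Proof.
have [chie _ _ _] := basicA; have [thef _ _ _] := basicB.
move: T; apply: tens_eq => [d x y|d x y|x y].
- by rewrite linearP char_form_linear.
- exact: char_form_linear.
- by rewrite truncE !char_formE !rmorphM /= chie thef !eqxx mulr1 mul1r.
Qed.

Variables (V : vectType k) (X : action A B V) (C : complexes V).
Hypothesis gr_la : forall l a v, gr C l (la X a v) = la X a (gr C l v).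
Hypothesis gr_ra : forall l b v, gr C l (ra X b v) = ra X b (gr C l v).
(* Projectivity enters only through lifts of the maps to simple bimodules. *)
Hypothesis lift_char : forall a b (phi : V -> k^o), linear phi ->
  eigen chi theta X a b phi -> exists h : V -> tens A B,
  [/\ linear h, forall x y v, h (la X x (ra X y v)) = la E x (ra E y (h v))
    & forall v, char_form a b (h v) = phi v].

Let ee a : e a * e a = e a.
Proof. by have [_ -> _ _] := basicA; rewrite eqxx. Qed.

Let ff b : f b * f b = f b.
Proof. by have [_ -> _ _] := basicB; rewrite eqxx. Qed.

(** Independent direct summands of V: with a = al t and b = be t, the t-th one is
    a copy of A e_a (x) f_b B generated by [x t] in degree [d t], and [h t] is the
    projection onto it. *)
Definition gen_family (T : finType) (al : T -> 'I_r) (be : T -> 'I_q)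
    (d : T -> int) (x : T -> V) (h : T -> V -> tens A B) : Prop :=
  [/\ forall t, linear (h t) /\
        forall a b v, h t (la X a (ra X b v)) = la E a (ra E b (h t v)),
      forall t l v, h t (gr C l v) = if l == d t then h t v else 0,
      forall t v, h t v = trunc (e (al t)) (f (be t)) (h t v),
      forall t, gr C (d t) (x t) = x t /\
        la X (e (al t)) (ra X (f (be t)) (x t)) = x t
    & forall s t, h s (x t) =
        if s == t then tensor (e (al t)) (f (be t)) else 0].

Definition gen_span (T : finType) (x : T -> V) : {vspace V} :=
  vspan [set v | exists t a b, v = la X a (ra X b (x t))].

Lemma gen_spanP (T : finType) (x : T -> V) : forall t, x t \in gen_span x.
Proof. by move=> t; apply: mem_vspan; exists t, 1, 1; rewrite la1 ra1. Qed.

Lemma gen_span_stable (T : finType) (x : T -> V) a b v :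
  v \in gen_span x -> la X a (ra X b v) \in gen_span x.
Proof.
move=> vx; have gP c : stable (gen_span x) (ra X c).
  apply: vspan_stable => _ [t [a' [b' ->]]]; apply: mem_vspan.
  by exists t, a', (b' * c); rewrite -lara raM.
have gL c : stable (gen_span x) (la X c).
  apply: vspan_stable => _ [t [a' [b' ->]]]; apply: mem_vspan.
  by exists t, (c * a'), b'; rewrite laM.
by apply: gL; exact: gP.
Qed.

Section Family.
Variables (T : finType) (al : T -> 'I_r) (be : T -> 'I_q).
Variables (d : T -> int) (x : T -> V) (h : T -> V -> tens A B).
Hypothesis gen : gen_family al be d x h.

Let h_lin t : linear (h t). Proof. by case: gen => /(_ t)[]. Qed.

(* the projection along the summands already found *)
Let pr (v : V) : V := v - \sum_t ev X (x t) (h t v).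

Let pr_lin : linear pr.
Proof.
move=> c v w; rewrite /pr.
under eq_bigr do rewrite h_lin ev_linear.
by rewrite big_split -scaler_sumr scalerBr opprD addrACA.
Qed.

Let pr_hom a b v : pr (la X a (ra X b v)) = la X a (ra X b (pr v)).
Proof.
rewrite /pr !linearB !linear_sum /=; congr (_ + _); apply: eq_bigr => t _; congr (- _).
by have [/(_ t)[_ ->] _ _ _ _] := gen; rewrite ev_hom.
Qed.

Let h_ev s t u : h s (ev X (x t) u) =
  if s == t then trunc (e (al t)) (f (be t)) u else 0.
Proof.
have [hh _ _ _ hx] := gen.
move: u; apply: tens_eq => [c u w|c u w|a b].
- by rewrite ev_linear h_lin.
- by case: ifP; rewrite ?linearP // scaler0 addr0.
rewrite evE (proj2 (hh s)) hx; case: eqP => _; last by rewrite !linear0.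
by rewrite free_actionE truncE.
Qed.

Let h_pr s v : h s (pr v) = 0.
Proof.
rewrite /pr (linB (h_lin s)) (lin_sum (h_lin s)) (bigD1 s) //= h_ev eqxx.
rewrite big1 => [|t /negPf ts]; last by rewrite h_ev eq_sym ts.
by have [_ _ <- _ _] := gen; rewrite addr0 subrr.
Qed.

Let pr_pr v : pr (pr v) = pr v.
Proof.
rewrite {1}/pr big1 ?subr0 // => t _.
by rewrite h_pr (lin0 (ev_linear X _)).
Qed.

Let pr_gen t : pr (x t) = 0.
Proof.
rewrite /pr (bigD1 t) //= big1 => [|s st].
  have [_ _ _ /(_ t)[_ xt] ->] := gen; rewrite eqxx evE xt.
  by rewrite addr0 subrr.
by have [_ _ _ _ ->] := gen; rewrite (negPf st) (lin0 (ev_linear X _)).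
Qed.

Let gr_hom l a b v : gr C l (la X a (ra X b v)) = la X a (ra X b (gr C l v)).
Proof. by rewrite gr_la gr_ra. Qed.

Let gr_lin l : linear (gr C l).
Proof. by move=> c v w; rewrite linearP. Qed.

Let pr_gr l v : pr (gr C l v) = gr C l (pr v).
Proof.
rewrite /pr linearB (linear_sum (gr C l)); congr (_ - _); apply: eq_bigr => t _ /=.
have [_ hgr _ xt _] := gen; have [xt1 _] := xt t.
rewrite (ev_comm (gr_lin l)) // hgr -xt1 gr_gr.
by case: eqP => // _; rewrite !(lin0 (ev_linear X _)) (lin0 (ev_linr X _)).
Qed.

Lemma pr_span v : v \in gen_span x -> pr v = 0.
Proof.
suff /subvP sub : (gen_span x <= lker (linfun (mklin pr_lin)))%VS.
  by move=> /sub; rewrite memv_ker lfunE => /eqP.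
apply: vspan_sub => _ [t [a [b ->]]].
by rewrite memv_ker lfunE /= pr_hom pr_gen !linear0.
Qed.

Lemma pr_id v : v - pr v \in gen_span x.
Proof.
rewrite /pr opprB addrCA subrr addr0; apply: memv_suml => t _.
apply: memv_suml => i _; apply: memv_suml => j _; apply/memvZ.
exact/gen_span_stable/gen_spanP.
Qed.

Lemma gr_span l v : v \in gen_span x -> gr C l v \in gen_span x.
Proof.
move=> vx; suff S : stable (gen_span x) (gr C l) by exact: S.
apply: vspan_stable => _ [t [a [b ->]]]; rewrite gr_hom.
have [_ _ _ /(_ t)[xt _] _] := gen; rewrite -xt gr_gr xt.
by case: ifP => _; rewrite ?linear0 ?mem0v //; exact/gen_span_stable/gen_spanP.
Qed.

(** A family that does not generate can be extended: Nakayama's lemma gives a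
    simple quotient of V that kills the submodule generated so far, projectivity
    lifts the quotient map to A e_a (x) f_b B, and the lift is onto because
    A e_a (x) f_b B has a unique simple quotient. A preimage of e_a (x) f_b then
    generates a further summand. *)
Lemma gen_extend : gen_span x != fullv -> exists a b n y g,
  [/\ gen_family (oapp al a) (oapp be b) (oapp d n) (oapp x y) (oapp h g)
    & y \notin gen_span x].
Proof.
move=> xfull.
have [a [b [phi [phil [v phiv] phix phie]]]] := eigenform basicA basicB
  (fun a b v => @gen_span_stable T x a b v) xfull.
have [n phin] : exists n, phi (gr C n v) != 0.
  apply: contrapT => /forallNP all; case/eqP: phiv.
  have [s _ ->] := gr_sum C v; rewrite (lin_sum phil) big1 // => i _.
  by apply/eqP; apply: contrapT => /negP; exact: all.
(* The form may be taken homogeneous, of some degree n. *)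
pose psi w : k^o := phi (gr C n w).
have psil : linear psi by move=> c u w; rewrite /psi linearP phil.
have psie : eigen chi theta X a b psi by move=> u w z; rewrite /psi gr_hom phie.
have psix u : u \in gen_span x -> psi u = 0 by move=> /(gr_span n)/phix.
have [g1 [g1l g1h g1psi]] := lift_char psil psie.
pose g w := trunc (e a) (f b) (g1 (pr (gr C n w))).
have gl : linear g by move=> c u w; rewrite /g linearP pr_lin g1l linearP.
have ghom u w z : g (la X u (ra X w z)) = la E u (ra E w (g z)).
  by rewrite /g gr_hom pr_hom g1h trunc_hom.
have gpsi w : char_form a b (g w) = psi w.
  rewrite char_form_trunc g1psi pr_gr; apply/eqP; rewrite -subr_eq0 -oppr_eq0 opprB.
  rewrite /psi !gr_gr eqxx -(linB phil) -linearB; apply/eqP.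
  exact/phix/gr_span/pr_id.
have ggr l w : g (gr C l w) = if l == n then g w else 0.
  rewrite /g gr_gr eq_sym; case: eqP => [->|_] //.
  by rewrite (lin0 pr_lin) (lin0 g1l) linear0.
have gx t : g (x t) = 0.
  by rewrite /g pr_gr pr_gen linear0 (lin0 g1l) linear0.
(* Otherwise Nakayama's lemma gives a form on A e_a (x) f_b B that kills the image
   of g. It is a multiple of the character form, which does not kill g v. *)
have [w gw] : exists w, g w = tensor (e a) (f b).
  pose S := [set u | exists w, g w = trunc (e a) (f b) u].
  have [|U memU] := @subspace_vspace k (tens A B) S.
    split=> [|c u w [u' hu] [w' hw]]; first by exists 0; rewrite (lin0 gl) linear0.
    by exists (c *: u' + w'); rewrite gl hu hw linearP.
  have [Ufull|Ufull] := eqVneq U fullv.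
    have /memU[w hw] : tensor 1 1 \in U by rewrite Ufull memvf.
    by exists w; rewrite hw truncE mul1r mulr1.
  have [|c [c' [rho [rhol [u0 rho0] rhoU rhoe]]]] :=
      @eigenform _ _ _ _ _ _ _ _ _ basicA basicB _ E U _ Ufull.
    move=> a' b' u /memU[w hw]; apply/memU.
    by exists (la X a' (ra X b' w)); rewrite ghom hw trunc_hom.
  have rhoE u : rho u = rho (tensor 1 1) * char_form c c' u.
    move: u; apply: tens_eq => [z u w|z u w|u w]; first exact: rhol.
      by rewrite char_form_linear mulrDr -[z *: _]/(z * _) mulrCA.
    by rewrite char_formE -[RHS]mulrC -rhoe free_actionE mulr1 mul1r.
  have rho1 : rho (tensor 1 1) != 0.
    by apply: contraNneq rho0 => r0; rewrite rhoE r0 mul0r.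
  have : rho (tensor 1 1 - tensor (e a) (f b)) = 0.
    apply/rhoU/memU; exists 0; rewrite (lin0 gl) linearB /= !truncE ee ff.
    by rewrite mul1r mulr1 subrr.
  rewrite rhoE (linB (char_form_linear _ _)) !char_formE !rmorph1 mulr1.
  have [chie _ _ _] := basicA; have [thef _ _ _] := basicB; rewrite chie thef.
  move=> /eqP; rewrite mulf_eq0 (negPf rho1) /=.
  case: (c =P a) => [ca|_]; last by rewrite mul0r subr0 oner_eq0.
  case: (c' =P b) => [cb _|_]; last by rewrite mulr0 subr0 oner_eq0.
  have : rho (g v) = 0.
    by apply/rhoU/memU; exists v; rewrite /g trunc_trunc.
  rewrite rhoE ca cb gpsi => /eqP; rewrite mulf_eq0 (negPf rho1) /=.
  by rewrite (negPf phin).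
pose y := pr (gr C n (la X (e a) (ra X (f b) w))).
have gy : g y = tensor (e a) (f b).
  rewrite /g /y -pr_gr gr_gr eqxx pr_pr -/(g _) ghom gw.
  by rewrite free_actionE ee ff.
have [hh hgr htr hx hhx] := gen.
exists a, b, n, y, g; split.
  split=> [[t|]|[t|] l u|[t|] u|[t|]|[s|] [t|]] //=.
  - by rewrite /g trunc_trunc.
  - split; first by rewrite /y -pr_gr gr_gr eqxx.
    by rewrite -pr_hom -gr_hom -!lara -laM -raM lara ee ff -lara.
  - exact: h_pr.
apply/negP => /pr_span; rewrite /y pr_pr -/y => y0.
have := char_formE a b (e a) (f b); rewrite -gy y0 (lin0 gl).
rewrite (lin0 (char_form_linear a b)).
have [-> _ _ _] := basicA; have [-> _ _ _] := basicB.
by rewrite !eqxx mulr1 => /eqP; rewrite eq_sym oner_eq0.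
Qed.

Lemma gen_full : gen_span x = fullv ->
  forall v, v = \sum_t ev X (x t) (h t v).
Proof.
move=> xfull v; apply/eqP; rewrite -subr_eq0; apply/eqP.
by apply: pr_span; rewrite xfull memvf.
Qed.

End Family.

(** The Krull-Schmidt decomposition of the terms of a complex of projective
    bimodules, with explicit generators and coordinate maps. The family is
    extended until it generates. *)
Lemma generators : exists (T : finType) (al : T -> 'I_r) (be : T -> 'I_q)
    (d : T -> int) (x : T -> V) (h : T -> V -> tens A B),
  gen_family al be d x h /\ forall v, v = \sum_t ev X (x t) (h t v).
Proof.
suff [T [al [be [d [x [h [gen full]]]]]]] : exists (T : finType)
    (al : T -> 'I_r) (be : T -> 'I_q) (d : T -> int) (x : T -> V)
    (h : T -> V -> tens A B), gen_family al be d x h /\ gen_span x = fullv.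
  by exists T, al, be, d, x, h; split=> //; exact: gen_full gen full.
suff grow n (T : finType) (al : T -> 'I_r) (be : T -> 'I_q) (d : T -> int)
    (x : T -> V) (h : T -> V -> tens A B) : gen_family al be d x h ->
    (\dim {:V} - \dim (gen_span x) < n)%N -> exists (T : finType)
    (al : T -> 'I_r) (be : T -> 'I_q) (d : T -> int) (x : T -> V)
    (h : T -> V -> tens A B), gen_family al be d x h /\ gen_span x = fullv.
  apply: (grow _ void (of_void _) (of_void _) (of_void _) (of_void _)
    (of_void _) _ (ltnSn _)).
  by split=> [[]|[]|[]|[]|[]].
elim: n T al be d x h => // n IHn T al be d x h gen lt.
have [full|nfull] := eqVneq (gen_span x) fullv; first by exists T, al, be, d, x, h.
have [a [b [m [y [g [gen' yx]]]]]] := gen_extend gen nfull.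
apply: IHn gen' _; rewrite ltnS in lt; apply: leq_trans lt; rewrite ltn_sub2l //.
  by rewrite (ltn_leqif (dimv_leqif_eq (subvf _))).
have sub : (gen_span x <= gen_span (oapp x y))%VS.
  apply: vspan_sub => _ [t [a' [b' ->]]].
  exact/gen_span_stable/(gen_spanP (oapp x y) (Some t)).
rewrite (ltn_leqif (dimv_leqif_eq sub)); apply: contraNneq yx => ->.
exact: (gen_spanP (oapp x y) None).
Qed.

End Generators.

(** * The characters of an elementary algebra *)

Section Radical.
Variables (k : fieldType) (A : falgType k).

Lemma left_inverse_unit (x y : A) : x * y = 1 -> y \is a GRing.unit.
Proof.
move=> xy; have ker0 : lker (amull y) == 0%VS.
  rewrite -subv0; apply/subvP => z; rewrite memv_ker memv0 amullE => /eqP yz.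
  by rewrite -[z]mul1r -xy -mulrA yz mulr0.
have := lker0_lfunVK ker0 1; rewrite amullE; set w := (X in _ * X) => yw.
have xw : x = w by rewrite -[LHS]mulr1 -yw mulrA xy mul1r.
by apply/unitrP; exists x; split=> //; rewrite xw.
Qed.

Lemma left_ideal_subspace (J : set A) : left_ideal J -> linear_subspace J.
Proof.
case=> J0 JD JM; split=> // c x y Jx Jy; apply: JD => //.
by rewrite -mulr_algl; exact: JM.
Qed.

(** Left ideals are subspaces, so one of maximal dimension is maximal. *)
Lemma maximal_left_ideal_above (J : set A) : left_ideal J -> ~ J 1 ->
  exists2 J', maximal_left_ideal J' & J `<=` J'.
Proof.
move=> idJ J1.
pose P n := `[< exists U : {vspace A}, [/\ left_ideal [set` U], J `<=` [set` U],
  1 \notin U & \dim U = n] >].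
have exP : exists n, P n.
  have [U UJ] := subspace_vspace (left_ideal_subspace idJ).
  exists (\dim U); apply/asboolP; exists U.
  have -> : [set` U] = J by apply/seteqP; split=> x /= /UJ.
  by split=> //; apply/negP => /UJ.
have ubP n : P n -> (n <= dim A)%N.
  by move=> /asboolP[X [_ _ _ <-]]; rewrite -dimvf dimvS ?subvf.
have [m /asboolP[U [idU JU U1 dU]] maxm] := ex_maxnP exP ubP.
exists [set` U] => //; split=> // [|J' idJ' UJ' J'T].
  by apply/eqP => UT; case/negP: U1; suff: [set` U] 1 by []; rewrite UT.
have [U' memU'] := subspace_vspace (left_ideal_subspace idJ').
have J'E : J' = [set` U'] by apply/seteqP; split=> x /= /memU'.
have U'1 : 1 \notin U'.
  apply/negP => /memU' J'1; case/eqP: J'T; apply/seteqP; split=> // x _.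
  by case: idJ' => _ _ /(_ x 1 J'1); rewrite mulr1.
suff UU' : U' = U by rewrite J'E UU'.
apply/eqP; rewrite eq_sym eqEdim; apply/andP; split.
  by apply/subvP => x /UJ'/memU'.
rewrite dU; apply: maxm; apply/asboolP; exists U'; split=> //; rewrite -J'E //.
exact: subset_trans UJ'.
Qed.

Lemma jacobson_unit a : @jacobson_radical k A a -> 1 - a \is a GRing.unit.
Proof.
move=> radA; apply: contrapT => nunit.
pose J := [set x | exists y, x = y * (1 - a)].
have idJ : left_ideal J.
  split; first by exists 0; rewrite mul0r.
    by move=> _ _ [x ->] [y ->]; exists (x + y); rewrite mulrDl.
  by move=> x _ [y ->]; exists (x * y); rewrite mulrA.
have [[x /esym/left_inverse_unit]//|] := pselect (J 1).
move=> /(maximal_left_ideal_above idJ)[J' maxJ' JJ'].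
have [[J'0 J'D J'M] J'T _] := maxJ'.
have J'1 : J' 1.
  by rewrite -[1](subrK a); apply: J'D; [apply: JJ'; exists 1; rewrite mul1r|exact: radA].
case/eqP: J'T; apply/seteqP; split=> // x _.
by rewrite -[x]mulr1; exact: J'M.
Qed.

(** The right ideals generated by the powers of y become stationary. *)
Lemma nilpotent_of_unit (y : A) : (forall c, 1 - y * c \is a GRing.unit) ->
  exists n, y ^+ n.+1 = 0.
Proof.
move=> yu.
pose P m := `[< exists n, \dim (limg (amull (y ^+ n))) = m >].
have exP : exists m, P m by exists (\dim (limg (amull (y ^+ 0)))); apply/asboolP; exists 0%N.
have [m /asboolP[n dn] minm] := ex_minnP exP.
have : 1 * y ^+ n \in limg (amull (y ^+ n.+1)).
  have -> : limg (amull (y ^+ n.+1)) = limg (amull (y ^+ n)).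
    apply/eqP; rewrite eqEdim; apply/andP; split.
      apply/subvP => _ /memv_imgP[z _ ->].
      by rewrite amullE exprSr -mulrA -(amullE (y ^+ n)) memv_img ?memvf.
    by rewrite dn minm //; apply/asboolP; exists n.+1.
  by have := memv_img (amull (y ^+ n)) (memvf 1); rewrite amullE mulr1 mul1r.
rewrite mul1r => /memv_imgP[c _]; rewrite amullE exprSr -mulrA => yn.
exists n; rewrite exprS; suff -> : y ^+ n = 0 by rewrite mulr0.
apply: (mulIr (yu c)); rewrite mul0r mulrBr mulr1 {1}yn subrr //.
Qed.

End Radical.

(** Primitive idempotents do not split modulo the radical either, since
    idempotents lift along a nil ideal. Each of them is therefore seen by
    exactly one of the characters of A, which puts both in bijection. *)
Lemma elementary_basic (k : fieldType) (A : falgType k) (r : nat) (e : 'I_r -> A) :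
  elementary A -> complete_primitive_idempotents e ->
  exists chi : 'I_r -> {lrmorphism A -> k^o}, basic e chi.
Proof.
move=> [r' [phi [phi_surj phi_rad]]] [prim orth sume].
have radU a : (forall j, phi j a = 0) -> 1 - a \is a GRing.unit.
  by move=> /phi_rad/jacobson_unit.
have ee i j : e i * e j = if i == j then e i else 0.
  by case: eqP => [<-|/eqP ij]; [case: (prim i)|exact: orth].
have phi01 j i : phi j (e i) != 0 -> phi j (e i) = 1.
  move=> h; apply: (mulfI h); rewrite mulr1.
  by rewrite -(rmorphM (phi j)) ee eqxx.
have seen i : exists j, phi j (e i) != 0.
  apply: contrapT => /forallNP all; have [e0 _ _] := prim i.
  case/eqP: e0; have u : 1 - e i \is a GRing.unit.
    by apply: radU => j; apply/eqP; apply: contrapT => /negP; exact: all.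
  by apply: (mulIr u); rewrite mulrBr mulr1 ee eqxx subrr mul0r.
have [sg sgP] := fin_all_exists seen.
have uniq_char i j : phi j (e i) != 0 -> j = sg i.
  move=> /phi01 ji; apply: contrapT => /eqP nj.
  have /phi01 si := sgP i.
  have [a aE] := phi_surj (fun l => (l == j)%:R).
  have [x xE] : exists x, x = e i * a * e i by exists (e i * a * e i).
  have phix l : phi l x = phi l (e i) * (l == j)%:R * phi l (e i).
    by rewrite xE !rmorphM /= aE.
  have ex : e i * x = x by rewrite xE !mulrA ee eqxx.
  have xe : x * e i = x by rewrite xE -!mulrA ee eqxx.
  have [n yn] : exists n, (x * (1 - x)) ^+ n.+1 = 0.
    apply: nilpotent_of_unit => c; apply: radU => l.
    rewrite !rmorphM rmorphB rmorph1 /= phix.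
    have [->|_] := eqVneq l j; last by rewrite mulr0 !mul0r.
    by rewrite ji !mulr1 subrr mulr0 mul0r.
  (* x is idempotent modulo the radical; a Bezout relation between powers of X and
     1 - X, evaluated at x, gives an idempotent F that agrees with x modulo the
     radical. *)
  have /Bezout_eq1_coprimepP[[u v] /= uv] :
      coprimep ('X ^+ n.+1 : {poly k}) ((1 - 'X) ^+ n.+1).
    rewrite coprimep_expl // coprimep_expr //.
    by apply/Bezout_eq1_coprimepP; exists (1, 1); rewrite !mul1r addrC subrK.
  pose ev : {rmorphism {poly k} -> A} := horner_alg x.
  have evX : ev 'X = x by rewrite /ev /= horner_algX.
  have evx p : ev p * x = x * ev p by rewrite -evX -!rmorphM mulrC.
  pose F := ev u * x ^+ n.+1; pose G := ev v * (1 - x) ^+ n.+1.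
  have FG : F + G = 1.
    have ev1X : ev (1 - 'X) = 1 - x by rewrite -evX -[1 in RHS](rmorph1 ev) -rmorphB.
    have -> : F = ev (u * 'X ^+ n.+1) by rewrite (rmorphM ev) (rmorphXn ev) evX.
    have -> : G = ev (v * (1 - 'X) ^+ n.+1).
      by rewrite (rmorphM ev) (rmorphXn ev) ev1X.
    by rewrite -(rmorphD ev) uv (rmorph1 ev).
  have FG0 : F * G = 0.
    have -> : F * G = ev u * ev v * (x * (1 - x)) ^+ n.+1.
      rewrite /F /G exprMn_comm; last by rewrite /GRing.comm mulrBr mulrBl mulr1 mul1r.
      rewrite -!mulrA; congr (_ * _); rewrite !mulrA; congr (_ * _).
      by apply/esym/commrX; exact: evx.
    by rewrite yn mulr0.
  have FF : F * F = F.
    by rewrite -{3}[F]mulr1 -FG mulrDr FG0 addr0.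
  have Fe : F * e i = F by rewrite /F exprSr !mulrA -[_ * x * e i]mulrA xe.
  have eF : e i * F = F.
    have -> : F = x * (x ^+ n * ev u).
      by rewrite /F mulrA -exprS; exact/commrX/evx.
    by rewrite mulrA ex.
  have FeF : F * (e i - F) = 0 by rewrite mulrBr FF Fe subrr.
  have eFF : (e i - F) * F = 0 by rewrite mulrBl FF eF subrr.
  have eFeF : (e i - F) * (e i - F) = e i - F.
    by rewrite mulrBr eFF subr0 mulrBl ee eqxx Fe.
  have eFD : e i = F + (e i - F) by rewrite addrC subrK.
  have [e0 _ /(_ _ _ FF eFeF FeF eFF eFD)] := prim i.
  case=> [F0|/eqP].
    have : phi j F = 1.
      have -> : F = 1 - G by rewrite -FG addrK.
      rewrite rmorphB rmorph1 /G rmorphM rmorphXn /= rmorphB rmorph1 /= phix ji eqxx.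
      by rewrite !mulr1 subrr expr0n mulr0 subr0.
    by rewrite F0 rmorph0 => /eqP; rewrite eq_sym oner_eq0.
  rewrite subr_eq0 => /eqP eiF; have : phi (sg i) (e i) = 0.
    rewrite eiF /F rmorphM rmorphXn /= phix eq_sym (negPf nj) mulr0 mul0r.
    by rewrite expr0n mulr0.
  by move/eqP; rewrite (negPf (sgP i)).
exists (fun i => phi (sg i)); split=> // [i j|a a0].
  have /phi01 si := sgP i; have [<-//|ij] := eqVneq i j.
  by rewrite -[LHS]mul1r -si -(rmorphM (phi (sg i))) ee (negPf ij) rmorph0.
apply: radU => j; have [i ji] : exists i, phi j (e i) != 0.
  apply: contrapT => /forallNP all; have := rmorph1 (phi j).
  rewrite -sume rmorph_sum big1 => [/eqP|i _]; first by rewrite eq_sym oner_eq0.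
  by apply/eqP; apply: contrapT => /negP; exact: all.
by rewrite (uniq_char i j ji).
Qed.

(** * Bases adapted to the Peirce decomposition *)

Section MoreDualBases.
Variables (k : fieldType) (V : vectType k).

Lemma dual_diag (T : finType) (b : T -> V) f (g : V -> V) (p : pred T) :
  dual_bases b f -> linear g -> (forall t, g (b t) = if p t then b t else 0) ->
  forall t v, f t (g v) = if p t then f t v else 0.
Proof.
move=> [fl fb bf] gl gb t v.
rewrite [in LHS](bf v) (lin_sum gl) (lin_sum (fl t)) (bigD1 t) //=.
rewrite (linZ gl) (linZ (fl t)) gb big1 => [|s st].
  by rewrite addr0; case: ifP => _; rewrite ?fb ?eqxx -[_ *: _]/(_ * _) ?mulr1 ?(lin0 (fl t)) ?mulr0.
rewrite (linZ gl) (linZ (fl t)) gb; case: ifP => _; rewrite ?(lin0 (fl t)) ?scaler0 //.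
by rewrite fb eq_sym (negPf st) scaler0.
Qed.

Lemma dim_diag (T : finType) (b : T -> V) f (g : {linear V -> V}) (p : pred T) :
  dual_bases b f -> (forall t, g (b t) = if p t then b t else 0) ->
  \dim (limg (linfun g)) = #|p|.
Proof.
move=> bf gb; apply: (dim_dual_bases bf) => [t pt|t v /memv_imgP[w _ ->] npt].
  by have := memv_img (linfun g) (memvf (b t)); rewrite lfunE /= gb pt.
by rewrite lfunE /= (dual_diag bf _ gb) ?(negPf npt) // => c x y; rewrite linearP.
Qed.

Lemma qdim_image (g : {linear V -> V}) :
  qdim [set g z | z in setT] [set 0] = \dim (limg (linfun g)).
Proof.
have -> : \dim (limg (linfun g)) = (\dim (limg (linfun g)) - \dim (0%VS : {vspace V}))%N.
  by rewrite dimv0 subn0.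
apply: qdimE; first by split=> // c x y -> ->; rewrite scaler0 addr0.
apply: is_qdim_vspace => [x||x _]; last 1 first.
- by rewrite memv0; split=> [->|/eqP].
- split=> [[z _ <-]|/memv_imgP[z _ ->]]; last by exists z; rewrite ?lfunE.
  by rewrite -[g z](lfunE g) memv_img ?memvf.
- exact: sub0v.
Qed.

Lemma sub_dual_bases (T : finType) (A : {pred T}) (b : T -> V) (f : T -> V -> k^o) :
  (forall t, linear (f t)) ->
  (forall s t, s \in A -> t \in A -> f s (b t) = (s == t)%:R) ->
  (forall v, v = \sum_(t in A) f t v *: b t) ->
  dual_bases (fun t : {x in A} => b (val t)) (fun t => f (val t)).
Proof.
move=> fl fb bf; split=> // [[s sA] [t tA]|v]; first by rewrite /= fb.
by rewrite {1}(bf v) big_sub.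
Qed.

Lemma split_basis (I : finType) (g : I -> V -> V) :
  (forall i, linear (g i)) ->
  (forall i j v, g i (g j v) = if i == j then g j v else 0) ->
  (forall v, v = \sum_i g i v) ->
  exists (T : finType) (b : T -> V) f (c : T -> I), dual_bases b f /\
    forall i t, g i (b t) = if i == c t then b t else 0.
Proof.
move=> gl gg gsum.
pose G i : {vspace V} := limg (linfun (mklin (gl i))).
pose bG i := vbasis (G i).
have bGG i m : (m < \dim (G i))%N -> g i (bG i)`_m = (bG i)`_m.
  move=> lt; have /memv_imgP[w _ ->] : (bG i)`_m \in G i.
    by apply/vbasis_mem/mem_nth; rewrite size_tuple.
  by rewrite lfunE /= gg eqxx.
pose T : finType := {i : I & 'I_(\dim (G i))}.
pose b (t : T) : V := (bG (tag t))`_(tagged t).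
pose f (t : T) (v : V) : k^o := coord (bG (tag t)) (tagged t) (g (tag t) v).
have gb i t : g i (b t) = if i == tag t then b t else 0.
  by rewrite -[b t]bGG ?ltn_ord // gg bGG ?ltn_ord.
exists T, b, f, (fun t => tag t); split=> //; split=> [t c x y|s t|v].
- by rewrite /f gl; exact: (coord_is_scalar (bG (tag t)) (tagged t) c).
- rewrite /f gb; case: s t => [i m] [j m'] /=.
  case: (i =P j) => [ij|nij]; last by rewrite linear0 -tag_eqE /tag_eq; case: eqP.
  move: m'; rewrite -ij => m'; rewrite coord_free ?(basis_free (vbasisP _)) //.
  by rewrite -tag_eqE /tag_eq /= eqxx /= tagged_asE eq_sym.
- rewrite {1}(gsum v) -(sig_big_dep xpredT (fun _ _ => true)
    (fun i (m : 'I_(\dim (G i))) => coord (bG i) m (g i v) *: (bG i)`_m)) /=.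
  apply: eq_bigr => i _; apply: coord_vbasis.
  by rewrite -[g i v]/((mklin (gl i)) v) -lfunE memv_img ?memvf.
Qed.

End MoreDualBases.

Section TensorBases.
Variables (k : fieldType) (V W : vectType k).
Variables (S S' : finType) (u : S -> V) (fu : S -> V -> k^o).
Variables (u' : S' -> W) (fu' : S' -> W -> k^o).
Hypotheses (ub : dual_bases u fu) (ub' : dual_bases u' fu').

Definition tens_form s s' : tens V W -> k^o :=
  tlift (fun v w => fu s v * fu' s' w : k^o).

Lemma tens_formE s s' v w : tens_form s s' (tensor v w) = fu s v * fu' s' w.
Proof.
have [fl _ _] := ub; have [fl' _ _] := ub'.
rewrite /tens_form tliftE //; split=> [z c x y|z c x y].
  by rewrite fl mulrDl -[_ *: _]/(_ * _) -mulrA.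
by rewrite fl' mulrDr -[_ *: _]/(_ * _) mulrCA.
Qed.

Lemma tens_form_linear s s' : linear (tens_form s s').
Proof. exact: tlift_linear. Qed.

Lemma tens_dual X : X = \sum_s \sum_s' tens_form s s' X *: tensor (u s) (u' s').
Proof.
have [fl _ bu] := ub; have [fl' _ bu'] := ub'.
move: X; apply: tens_eq => [//|c X Y|v w].
  rewrite scaler_sumr -big_split; apply: eq_bigr => s _ /=.
  rewrite scaler_sumr -big_split; apply: eq_bigr => s' _ /=.
  by rewrite tens_form_linear scalerDl scalerA.
rewrite {1}(bu v) {1}(bu' w) tensor_suml; apply: eq_bigr => s _.
rewrite tensor_sumr; apply: eq_bigr => s' _.
by rewrite tensorZl tensorZr scalerA tens_formE.
Qed.

End TensorBases.

(** A basis of the algebra adapted to the Peirce decomposition by the [e i]. *)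
Definition peirce_basis (k : fieldType) (A : falgType k) (r : nat) (e : 'I_r -> A)
    (S : finType) (u : S -> A) (fu : S -> A -> k^o) (l rr : S -> 'I_r) : Prop :=
  [/\ dual_bases u fu, forall s j, e j * u s = if j == l s then u s else 0
    & forall s i, u s * e i = if i == rr s then u s else 0].

Section FreeBasis.
Variables (k : fieldType) (A B : falgType k).
Variables (r q : nat) (e : 'I_r -> A) (f : 'I_q -> B).
Variables (S S' : finType) (u : S -> A) (fu : S -> A -> k^o) (lA rA : S -> 'I_r).
Variables (u' : S' -> B) (fu' : S' -> B -> k^o) (lB rB : S' -> 'I_q).
Hypotheses (uA : peirce_basis e u fu lA rA) (uB : peirce_basis f u' fu' lB rB).

Lemma tens_form_trunc s s' a b T :
  tens_form fu fu' s s' (trunc (e a) (f b) T) =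
  if (a == rA s) && (b == lB s') then tens_form fu fu' s s' T else 0.
Proof.
have [uf ul ur] := uA; have [uf' ul' ur'] := uB.
have [fl _ _] := uf; have [fl' _ _] := uf'.
move: T; apply: tens_eq => [c x y|c x y|x y].
- by rewrite linearP tens_form_linear.
- by case: ifP; rewrite ?tens_form_linear // scaler0 addr0.
rewrite truncE !(tens_formE uf uf').
rewrite (dual_diag (p := fun s => a == rA s) uf (g := fun x => x * e a)) //; last first.
  by move=> c v w; rewrite mulrDl scalerAl.
rewrite (dual_diag (p := fun s => b == lB s) uf' (g := fun x => f b * x)) //; last first.
  by move=> c v w; rewrite mulrDr scalerAr.
by do 2!case: eqP => _; rewrite /= ?mul0r ?mulr0.
Qed.

Variables (V : vectType k) (X : action A B V) (C : complexes V).
Variables (T : finType) (al : T -> 'I_r) (be : T -> 'I_q).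
Variables (d : T -> int) (x : T -> V) (h : T -> V -> tens A B).
Hypothesis gen : gen_family e f X C al be d x h.
Hypothesis full : forall v, v = \sum_t ev X (x t) (h t v).

Definition free_index : {pred T * S * S'} :=
  [pred p | (al p.1.1 == rA p.1.2) && (be p.1.1 == lB p.2)].

Definition free_basis (p : T * S * S') : V :=
  la X (u p.1.2) (ra X (u' p.2) (x p.1.1)).

Definition free_form (p : T * S * S') (v : V) : k^o :=
  tens_form fu fu' p.1.2 p.2 (h p.1.1 v).

Lemma sum_free_index (c : T -> int) (w : S -> int) (P1 : pred S) (P2 : pred S') :
  \sum_(p : {p in free_index} | P1 (val p).1.2 && P2 (val p).2)
     c (val p).1.1 * w (val p).1.2 =
  \sum_t c t * (\sum_(s | P1 s && (rA s == al t)) w s) *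
     (#|[pred s' | P2 s' && (lB s' == be t)]| : int).
Proof.
rewrite -(big_sub_cond free_index (fun p => P1 p.1.2 && P2 p.2)
  (fun p => c p.1.1 * w p.1.2)).
transitivity (\sum_t \sum_s \sum_s' if P1 s && (rA s == al t) then
    if P2 s' && (lB s' == be t) then c t * w s else 0 else 0); last first.
  apply: eq_bigr => t _; rewrite mulr_sumr mulr_suml [RHS]big_mkcond /=.
  apply: eq_bigr => s _; case: ifP => _; last by rewrite big1.
  by rewrite -big_mkcond -natz mulr_natr -sumr_const; apply: eq_bigl => s'; rewrite inE.
rewrite [RHS]pair_bigA [RHS]pair_bigA [LHS]big_mkcond /=.
apply: eq_bigr => [[[t s] s'] _] /=; rewrite inE /= ![al t == _]eq_sym ![be t == _]eq_sym.
by case: (P1 s); case: (P2 s'); case: (rA s == _); case: (lB s' == _).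
Qed.

(** Each summand A e_a (x) f_b B has the products of a basis of A e_a and one of
    f_b B as a basis. *)
Lemma free_dual_bases : dual_bases (fun p : {p in free_index} => free_basis (val p))
  (fun p => free_form (val p)).
Proof.
have [hh hgr htr hx hhx] := gen.
have [uf ul ur] := uA; have [uf' ul' ur'] := uB.
apply: sub_dual_bases => [t c v w|[[t s] s'] [[t1 s1] s1']|v].
- by rewrite /free_form (proj1 (hh _)) tens_form_linear.
- rewrite !inE /= => /andP[/eqP st /eqP st'] /andP[/eqP st1 /eqP st1'].
  rewrite /free_form /free_basis /= (proj2 (hh _)) hhx !xpair_eqE.
  case: (t =P t1) => [_|_] /=; last by rewrite !linear0 (lin0 (tens_form_linear _ _ _ _)).
  have -> : tensor (e (al t1)) (f (be t1)) = trunc (e (al t1)) (f (be t1)) (tensor 1 1).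
    by rewrite truncE mul1r mulr1.
  rewrite -trunc_hom tens_form_trunc free_actionE mul1r mulr1.
  have [_ fb _] := uf; have [_ fb' _] := uf'.
  rewrite (tens_formE uf uf') fb fb' -natrM mulnb.
  case: (s =P s1) => [->|_]; last by rewrite if_same.
  case: (s' =P s1') => [->|_]; last by rewrite if_same.
  by rewrite st1 st1' !eqxx.
- rewrite {1}(full v) [RHS]big_mkcond /=.
  rewrite -(pair_bigA _ (fun p s' => if (p, s') \in free_index then
    free_form (p, s') v *: free_basis (p, s') else 0)) /=.
  rewrite -(pair_bigA _ (fun t s => \sum_s' (if (t, s, s') \in free_index then
    free_form (t, s, s') v *: free_basis (t, s, s') else 0))) /=.
  apply: eq_bigr => t _; rewrite {1}(tens_dual uf uf' (h t v)).
  rewrite (lin_sum (ev_linear X _)); apply: eq_bigr => s _.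
  rewrite (lin_sum (ev_linear X _)); apply: eq_bigr => s' _.
  rewrite (linZ (ev_linear X _)) evE htr tens_form_trunc inE /=.
  by case: ifP => _; rewrite ?scale0r // /free_form /free_basis /= [in RHS]htr tens_form_trunc; case: ifP.
Qed.

Lemma free_basis_la j p : la X (e j) (free_basis p) =
  if j == lA p.1.2 then free_basis p else 0.
Proof.
have [_ ul _] := uA; rewrite /free_basis -laM ul; case: ifP => // _.
by rewrite (lin0 (@la_lin _ _ _ _ X _)).
Qed.

Lemma free_basis_ra i p : ra X (f i) (free_basis p) =
  if i == rB p.2 then free_basis p else 0.
Proof.
have [_ _ ur] := uB; rewrite /free_basis -lara -raM ur; case: ifP => // _.
by rewrite (lin0 (@ra_lin _ _ _ _ X _)) linear0.
Qed.

Lemma free_basis_gr p : (forall l a v, gr C l (la X a v) = la X a (gr C l v)) ->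
  (forall l b v, gr C l (ra X b v) = ra X b (gr C l v)) ->
  gr C (d p.1.1) (free_basis p) = free_basis p.
Proof.
move=> gl grr; have [_ _ _ hx _] := gen.
by rewrite /free_basis gl grr (proj1 (hx _)).
Qed.

End FreeBasis.

Definition adapted_basis (k : fieldType) (A : falgType k) (r : nat) (e : 'I_r -> A)
    (V : vectType k) (X : bimodule A V) (C : complexes V) (T : finType)
    (b : T -> V) (f : T -> V -> k^o) (l rr : T -> 'I_r) (d : T -> int) : Prop :=
  [/\ dual_bases b f, forall t j, lact X (e j) (b t) = if j == l t then b t else 0,
      forall t i, ract X (e i) (b t) = if i == rr t then b t else 0
    & forall t, gr C (d t) (b t) = b t].

(** The left and right idempotents and the projections to the homogeneous
    components all commute, so they split V simultaneously. *)
Lemma exists_adapted_basis (k : fieldType) (A : falgType k) (r : nat) (e : 'I_r -> A)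
    (V : vectType k) (X : bimodule A V) (C : complexes V) :
  (forall i j, e i * e j = if i == j then e i else 0) -> \sum_i e i = 1 ->
  (forall i a v, gr C i (lact X a v) = lact X a (gr C i v)) ->
  (forall i a v, gr C i (ract X a v) = ract X a (gr C i v)) ->
  exists (T : finType) (b : T -> V) f l rr d, adapted_basis e X C b f l rr d (T := T).
Proof.
move=> ee sume gl grr.
have [s us s0] := gr_bounded C.
pose I : finType := ('I_r * 'I_r * 'I_(size s))%type.
pose g (i : I) v := lact X (e i.1.1) (ract X (e i.1.2) (gr C (nth 0 s i.2) v)).
have gll i : linear (g i) by move=> c v w; rewrite /g !linearP.
have gg i j v : g i (g j v) = if i == j then g j v else 0.
  case: i j => [[a b] m] [[a' b'] m']; rewrite /g /= !(gl, grr) gr_gr.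
  rewrite -!lract -lactM -ractM !ee !xpair_eqE (nth_uniq 0 (ltn_ord m) (ltn_ord m') us) /= [b' == b]eq_sym.
  case: (a =P a') => [<-|_] /=; last by rewrite (lin0 (@lact_lin _ _ _ X _)).
  case: (b =P b') => [<-|_] /=; last by rewrite (lin0 (@ract_lin _ _ _ X _)) linear0.
  by rewrite -(inj_eq val_inj m m') /=; case: eqP; rewrite ?linear0.
have gsum v : v = \sum_i g i v.
  rewrite -(pair_bigA _ (fun p m => g (p, m) v)) /=.
  rewrite -(pair_bigA _ (fun a b => \sum_m g (a, b, m) v)) /=.
  have vs : v = \sum_(m < size s) gr C (nth 0 s m) v.
    rewrite {1}(@gr_seq_eq _ _ C s v us) => [|i /s0 //].
    by rewrite (big_nth 0) big_mkord.
  rewrite -{1}[v](lact1 X) -sume (lin_sum (@lact_lin _ _ _ X v)).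
  apply: eq_bigr => a _; rewrite -{1}[v](ract1 X) -sume (lin_sum (@ract_lin _ _ _ X v)).
  rewrite linear_sum; apply: eq_bigr => b _ /=.
  by rewrite {1}vs !linear_sum.
have [T [b [f [c [bf gb]]]]] := split_basis gll gg gsum.
have bE t : b t = g (c t) (b t) by rewrite gb eqxx.
exists T, b, f, (fun t => (c t).1.1), (fun t => (c t).1.2), (fun t => nth 0 s (c t).2).
split=> // [t j|t i|t]; rewrite [b t]bE /g.
- rewrite -lactM ee; case: (j =P _) => [->|_] //.
  by rewrite (lin0 (@lact_lin _ _ _ X _)).
- rewrite -lract -ractM ee eq_sym; case: (i =P _) => [_|_] //.
  by rewrite (lin0 (@ract_lin _ _ _ X _)) linear0.
- by rewrite gl grr gr_gr eqxx.
Qed.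

(** * Finite global dimension makes the Cartan matrix unimodular *)

(** The A-module underlying a bimodule, as an alias of its carrier. *)
Definition lmod_of (k : fieldType) (A B : falgType k) (W : vectType k)
  (X : action A B W) : Type := Vector.sort W.

Section LmodOf.
Variables (k : fieldType) (A B : falgType k) (W : vectType k) (X : action A B W).

HB.instance Definition _ := GRing.Zmodule.copy (lmod_of X) (Vector.sort W).

Let scale (a : A) (v : lmod_of X) : lmod_of X := la X a v.

Fact lmod_scaleA a b v : scale a (scale b v) = scale (a * b) v.
Proof. by rewrite /scale laM. Qed.

Fact lmod_scale1 : left_id 1 scale.
Proof. by move=> v; rewrite /scale la1. Qed.

Fact lmod_scaleDr : right_distributive scale +%R.
Proof. by move=> a v w; exact: (linearD (la X a)). Qed.

Fact lmod_scaleDl v : {morph scale^~ v : a b / a + b}.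
Proof. by move=> a b; exact: (linD (@la_lin _ _ _ _ X v)). Qed.

HB.instance Definition _ := GRing.Zmodule_isLmodule.Build A (lmod_of X)
  lmod_scaleA lmod_scale1 lmod_scaleDr lmod_scaleDl.

Lemma la_alg (c : k) v : la X c%:A v = c *: v.
Proof. by rewrite (linZ (@la_lin _ _ _ _ X v)) la1. Qed.

End LmodOf.

Section LmodMaps.
Variables (k : fieldType) (A B : falgType k) (W W' : vectType k).
Variables (X : action A B W) (Y : action A B W').

Lemma lmod_linear (f : W -> W') : linear f ->
  (forall a v, f (la X a v) = la Y a (f v)) ->
  linear (f : lmod_of X -> lmod_of Y).
Proof.
move=> fl fla a v w; rewrite [LHS](_ : _ = f (la X a v + w)) // (linD fl).
by rewrite fla.
Qed.

Lemma linear_of_lmod (f : {linear lmod_of X -> lmod_of Y}) :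
  linear (f : W -> W').
Proof.
move=> c v w; rewrite -(la_alg X) -(la_alg Y).
exact: (linearP f c%:A v w).
Qed.

End LmodMaps.

Section CharAction.
Variables (k : fieldType) (A B : falgType k).
Variables (chi : {lrmorphism A -> k^o}) (theta : {lrmorphism B -> k^o}).

Fact scale_linear (c : k) : linear (fun v : k^o => c * v : k^o).
Proof. by move=> d v w; rewrite mulrDr -[d *: v]/(d * v) mulrCA. Qed.

(** The simple bimodule with characters [chi] and [theta]. *)
Definition char_action : action A B k^o.
Proof.
refine (@Action k A B k^o (fun a => mklin (scale_linear (chi a)))
  (fun b => mklin (scale_linear (theta b))) _ _ _ _ _ _ _) => /=.
- by move=> v c a b /=; rewrite linearP /= mulrDl -[c *: _]/(c * _) -mulrA.
- by move=> v c a b /=; rewrite linearP /= mulrDl -[c *: _]/(c * _) -mulrA.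
- by move=> v; rewrite rmorph1 mul1r.
- by move=> v; rewrite rmorph1 mul1r.
- by move=> a b v; rewrite rmorphM -mulrA.
- by move=> a b v; rewrite rmorphM /= mulrAC mulrC mulrA.
- by move=> a b v; rewrite mulrCA.
Defined.

Lemma char_la a v : la char_action a v = chi a * v. Proof. by []. Qed.

End CharAction.

Section ScalarAction.
Variables (k : fieldType) (A : falgType k) (W : vectType k).

Lemma ra_scalar (X : action A k^o W) (c : k) v : ra X c v = c *: v.
Proof.
by rewrite -[c in LHS]mulr1 -[c * 1]/(c *: (1 : k^o)) (linZ (@ra_lin _ _ _ _ X v)) ra1.
Qed.

Fact zscale_linear (c : k) : linear (fun v : W => c *: v).
Proof. by move=> d v w; rewrite scalerDr !scalerA mulrC. Qed.

Variable L : A -> {linear W -> W}.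
Hypotheses (L_lin : forall x, linear (fun a => L a x)) (L1 : forall x, L 1 x = x).
Hypothesis LM : forall a b x, L (a * b) x = L a (L b x).

Definition left_action : action A k^o W.
Proof.
refine (@Action k A k^o W L (fun c => mklin (zscale_linear c)) L_lin _ L1 _ LM _ _) => /=.
- by move=> v c a b /=; rewrite scalerDl -scalerA.
- by move=> v; rewrite scale1r.
- by move=> a b v; rewrite scalerA mulrC.
- by move=> a b v; rewrite linearZ.
Defined.

End ScalarAction.

Section SubAction.
Variables (k : fieldType) (A B : falgType k) (W : vectType k) (X : action A B W).
Variable U : {vspace W}.
Hypothesis Ula : forall a v, v \in U -> la X a v \in U.
Hypothesis Ura : forall b v, v \in U -> ra X b v \in U.

Fact sub_linear (g : {linear W -> W}) :
  linear (fun v : subvs_of U => vsproj U (g (vsval v))).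
Proof. by move=> c v w; rewrite !linearP. Qed.

Lemma sub_laK a (v : subvs_of U) : vsval (vsproj U (la X a (vsval v))) = la X a (vsval v).
Proof. by rewrite vsprojK //; apply: Ula; exact: subvsP. Qed.

Lemma sub_raK b (v : subvs_of U) : vsval (vsproj U (ra X b (vsval v))) = ra X b (vsval v).
Proof. by rewrite vsprojK //; apply: Ura; exact: subvsP. Qed.

Definition sub_action : action A B (subvs_of U).
Proof.
refine (@Action k A B (subvs_of U) (fun a => mklin (sub_linear (la X a)))
  (fun b => mklin (sub_linear (ra X b))) _ _ _ _ _ _ _) => /=.
- by move=> v c a b /=; rewrite (la_lin X) linearP.
- by move=> v c a b /=; rewrite (ra_lin X) linearP.
- by move=> v; rewrite la1 vsvalK.
- by move=> v; rewrite ra1 vsvalK.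
- by move=> a b v; rewrite sub_laK laM.
- by move=> a b v; rewrite sub_raK raM.
- by move=> a b v; rewrite sub_laK sub_raK lara.
Defined.

Lemma sub_laE a v : vsval (la sub_action a v) = la X a (vsval v).
Proof. exact: sub_laK. Qed.

End SubAction.

Section DimensionVectors.
Variables (k : fieldType) (A : falgType k) (r : nat) (e : 'I_r -> A).
Variables (S : finType) (u : S -> A) (fu : S -> A -> k^o) (lA rA : S -> 'I_r).
Variable chi : 'I_r -> {lrmorphism A -> k^o}.
Hypotheses (uA : peirce_basis e u fu lA rA) (basicA : basic e chi).

(** The dimension of e_j A e_i. *)
Definition peirce_dim (i j : 'I_r) : nat := #|[pred s | (lA s == j) && (rA s == i)]|.

Definition dim_vector (W : vectType k) (X : action A k^o W) (j : 'I_r) : nat :=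
  \dim (limg (linfun (la X (e j)))).

Definition in_cartan_span (d : 'I_r -> nat) : Prop :=
  exists c : 'I_r -> int, forall j, (d j)%:Z = \sum_a c a * (peirce_dim a j)%:Z.

Lemma scalar_basic : basic (fun _ : 'I_1 => 1 : k^o) (fun _ => idfun).
Proof.
split=> [i j|i j||a a0] /=.
- by rewrite !ord1.
- by rewrite !ord1 mulr1.
- by rewrite big_ord1.
- by have -> : a = 0 by [exact: (a0 ord0)]; rewrite subr0 unitr1.
Qed.

Lemma scalar_dual_bases : @dual_bases k k^o unit (fun=> 1) (fun=> id).
Proof.
split=> // v; rewrite (bigD1 tt) //= big1 => [|[]//].
by rewrite addr0 -[v *: _]/(v * _) mulr1.
Qed.

Lemma scalar_peirce : peirce_basis (fun _ : 'I_1 => 1 : k^o) (S := unit)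
  (fun=> 1) (fun=> id) (fun=> ord0) (fun=> ord0).
Proof.
by split=> [|s j|s j]; rewrite ?ord1 ?eqxx ?mulr1 //; exact: scalar_dual_bases.
Qed.

(** Left modules are bimodules over A and k, so that [generators] makes a projective
    one a sum of modules A e_a. *)
Lemma dim_vector_projective (W : vectType k) (Q : action A k^o W) :
  projective_module (lmod_of Q) -> in_cartan_span (dim_vector Q).
Proof.
move=> projQ.
have [|||T [al [be [d [x [h [gen full]]]]]]] := @generators k A k^o r 1 e (fun=> 1) chi
  (fun=> idfun) basicA scalar_basic W Q (stalk W).
- by move=> l a v; rewrite /= /stalk_gr; case: ifP; rewrite //= linear0.
- by move=> l a v; rewrite /= /stalk_gr; case: ifP; rewrite //= linear0.
- move=> a b phi phil phie.
  pose Y := char_action (chi a) (idfun : {lrmorphism k^o -> k^o}).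
  have char_la' x T : char_form chi (fun=> idfun) a b (la (free_action A k^o) x T) =
      la Y x (char_form chi (fun=> idfun) a b T).
    move: T; apply: tens_eq => [c v w|c v w|v w]; first by rewrite linearP char_form_linear.
      by rewrite char_form_linear linearP.
    by rewrite /= free_laE !char_formE rmorphM -mulrA.
  have phi_la x v : phi (la Q x v) = la Y x (phi v).
    by rewrite -[v in LHS](ra1 Q) phie /= mulr1.
  have fl := lmod_linear (char_form_linear chi (fun=> idfun) a b) char_la'.
  have gl := lmod_linear phil phi_la.
  have [y|h hE] := projQ _ _ (mklin fl) (mklin gl).
    pose T1 : tens A k^o := tensor 1 1.
    exists ((y : k) *: T1); rewrite /= /T1.
    rewrite (linZ (char_form_linear _ _ _ _)) char_formE !rmorph1 mulr1.
    by rewrite -[_ *: _]/(_ * _) mulr1.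
  have hk := linear_of_lmod h.
  have hla x w : (h : W -> tens A k^o) (la Q x w) = la (free_action A k^o) x (h w).
    exact: (linearZZ h x w).
  exists h; split=> [|x y v|v]; first exact: hk.
    by rewrite !ra_scalar hla (linZ hk).
  exact: hE.
have bf := free_dual_bases uA scalar_peirce gen full.
exists (fun a => \sum_t (al t == a)%:Z) => j.
rewrite /dim_vector (dim_diag (p := fun p => (lA (val p).1.2 == j) && xpredT (val p).2) bf); last first.
  move=> t; rewrite andbT eq_sym. exact: (free_basis_la _ uA).
rewrite -sum1_card -natz natr_sum.
transitivity (\sum_t (\sum_(s | (lA s == j) && (rA s == al t)) 1) *
    (#|[pred s' : unit | xpredT s' && (ord0 == be t)]| : int)).
  have := @sum_free_index r 1 S unit rA (fun=> ord0) T al be (fun=> 1) (fun=> 1)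
    (fun s => lA s == j) xpredT.
  move=> H; transitivity (\sum_t 1 * (\sum_(s | (lA s == j) && (rA s == al t)) 1) *
    (#|[pred s' : unit | xpredT s' && (ord0 == be t)]| : int)).
    by rewrite -H; apply: eq_bigr => p _; rewrite mulr1.
  by apply: eq_bigr => t _; rewrite mul1r.
under [RHS]eq_bigr do rewrite mulr_suml.
rewrite exchange_big; apply: eq_bigr => t _ /=.
rewrite (bigD1 (al t)) //= eqxx mul1r [X in _ + X]big1 ?addr0 => [|a]; last first.
  by rewrite eq_sym => /negPf ->; rewrite mul0r.
have -> : #|[pred s' : unit | xpredT s' && (ord0 == be t)]| = 1%N.
  by rewrite -[RHS]card_unit; apply: eq_card => s'; rewrite !inE [be t]ord1.
by rewrite mulr1 sumr_const natz.
Qed.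

(* Finite free covers, by which any resolution can be replaced by a finite
   dimensional one. *)
Section FreeCover.
Variables (W : vectType k) (Y : action A k^o W).

Definition cover : action A k^o (tens A W) :=
  left_action (@free_la_lin k A W) (@free_la1 k A W) (@free_laM k A W).

Let n := \dim {:W}.
Let b := vbasis {:W}.

Let acoord (j : 'I_n) : tens A W -> A := tlift (fun a w => coord b j w *: a).

Let acoordE j a w : acoord j (tensor a w) = coord b j w *: a.
Proof.
rewrite /acoord tliftE //; split=> [z c v v'|z c v v'].
  by rewrite scalerDr !scalerA mulrC.
by rewrite linearP /= scalerDl scalerA.
Qed.

Let acoord_la j a T : acoord j (la cover a T) = a * acoord j T.
Proof.
move: T; apply: tens_eq => [c v w|c v w|x w].
- by rewrite linearP; exact: tlift_linear.
- by rewrite /acoord tlift_linear mulrDr scalerAr.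
- by rewrite [la _ _ _]free_laE !acoordE scalerAr.
Qed.

Let cover_decomp T : T = \sum_j la cover (acoord j T) (tensor 1 b`_j).
Proof.
move: T; apply: tens_eq => [//|c v w|x w].
  rewrite scaler_sumr -big_split; apply: eq_bigr => j _.
  by rewrite /acoord tlift_linear (la_lin cover).
rewrite {1}(coord_vbasis (memvf w)) tensor_sumr; apply: eq_bigr => j _.
by rewrite acoordE [la _ _ _]free_laE mulr1 tensorZl tensorZr.
Qed.

Lemma cover_projective : projective_module (lmod_of cover).
Proof.
move=> X1 Y1 f g fsurj.
have /fin_all_exists[x xE] (j : 'I_n) : exists x, f x = g (tensor 1 b`_j : tens A W) by exact: fsurj.
pose h (T : lmod_of cover) : X1 := \sum_j acoord j T *: x j.
have hl : linear h.
  move=> a T T'; rewrite /h scaler_sumr -big_split; apply: eq_bigr => j _ /=.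
  rewrite scalerA -scalerDl; congr (_ *: _).
  rewrite -acoord_la /acoord; exact: (linD (tlift_linear _)).
exists (mklin hl) => T /=; rewrite /h linear_sum [in RHS](cover_decomp T).
rewrite [RHS](linear_sum g); apply: eq_bigr => j _.
rewrite (linearZZ f) xE.
exact: (esym (linearZZ g (acoord j T) (tensor 1 b`_j : tens A W))).
Qed.

Definition cover_map : tens A W -> W := tlift (fun a w => la Y a w).

Lemma cover_mapE a w : cover_map (tensor a w) = la Y a w.
Proof.
rewrite /cover_map tliftE //; split=> [z c v v'|z c v v'].
  by rewrite (la_lin Y).
by rewrite linearP.
Qed.

Lemma cover_map_la a T : cover_map (la cover a T) = la Y a (cover_map T).
Proof.
move: T; apply: tens_eq => [c v w|c v w|x w].
- by rewrite linearP; exact: tlift_linear.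
- by rewrite /cover_map tlift_linear linearP.
- by rewrite [la _ _ _]free_laE !cover_mapE laM.
Qed.

Lemma cover_map_linear : linear (cover_map : lmod_of cover -> lmod_of Y).
Proof. by apply: lmod_linear; [exact: tlift_linear|exact: cover_map_la]. Qed.

Let K := lker (linfun (mklin (tlift_linear (fun a w => la Y a w)))).

Lemma memK T : (T \in K) = (cover_map T == 0).
Proof. by rewrite memv_ker lfunE. Qed.

Fact coverK_la a T : T \in K -> la cover a T \in K.
Proof. by rewrite !memK cover_map_la => /eqP ->; rewrite linear0. Qed.

Fact coverK_ra c T : T \in K -> ra cover c T \in K.
Proof. by move=> TK; rewrite ra_scalar memvZ. Qed.

Definition syzygy : action A k^o (subvs_of K) := sub_action coverK_la coverK_ra.

Lemma dim_vector_syzygy j : dim_vector cover j = (dim_vector syzygy j + dim_vector Y j)%N.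
Proof.
pose p : 'Hom(tens A W, W) := linfun (mklin (tlift_linear (fun a w => la Y a w))).
have pE T : p T = cover_map T by rewrite lfunE.
rewrite /dim_vector -(limg_ker_dim p); congr (_ + _)%N.
  pose i : 'Hom(subvs_of K, tens A W) := linfun vsval.
  rewrite -(limg_dim_eq (f := i) (U := limg (linfun (la syzygy (e j))))); last first.
    apply/eqP; rewrite -subv0; apply/subvP => v; rewrite memv_cap memv_ker => /andP[_].
    by rewrite lfunE /= memv0 -(inj_eq subvs_inj) linear0.
  congr (\dim _); apply/eqP; rewrite eqEsubv; apply/andP; split.
    apply/subvP => T; rewrite memv_cap => /andP[/memv_imgP[T' _ TT'] TK].
    have [_ ee _ _] := basicA; have eT : la cover (e j) T = T.
      by rewrite TT' lfunE -[RHS](lfunE (la cover (e j))) !lfunE -laM ee eqxx.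
    apply/memv_imgP; exists (la syzygy (e j) (vsproj K T)).
      by rewrite -[X in X \in _](lfunE (la syzygy (e j))) memv_img ?memvf.
    have := sub_laE coverK_la coverK_ra (e j) (vsproj K T).
    by rewrite vsprojK // eT => h; rewrite lfunE; exact: esym h.
  apply/subvP => _ /memv_imgP[_ /memv_imgP[v _ ->] ->].
  have iv : i (linfun (la syzygy (e j)) v) = la cover (e j) (vsval v).
    by rewrite !lfunE; exact: sub_laE.
  rewrite memv_cap; apply/andP; split; last by rewrite lfunE; exact: subvsP.
  by rewrite iv -[X in X \in _](lfunE (la cover (e j))) memv_img ?memvf.
congr (\dim _); apply/eqP; rewrite eqEsubv; apply/andP; split.
  apply/subvP => _ /memv_imgP[_ /memv_imgP[T _ ->] ->]; rewrite pE lfunE /= cover_map_la.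
  by rewrite -[X in X \in _](lfunE (la Y (e j))) memv_img ?memvf.
apply/subvP => _ /memv_imgP[v _ ->]; rewrite lfunE /=; apply/memv_imgP.
exists (la cover (e j) (tensor 1 v)).
  by rewrite -[X in X \in _](lfunE (la cover (e j))) memv_img ?memvf.
by rewrite pE cover_map_la cover_mapE la1.
Qed.

End FreeCover.

(** Dimension shifting. The modules in a projective resolution need not be finite
    dimensional; a finite dimensional Y is followed along its own syzygies,
    knowing only that the identity of Y factors through X up to maps that factor
    through a projective. This property passes to syzygies: lifted to the
    covers, the factorization holds up to a map [eps] into the kernel. On the
    kernel the part through Q vanishes, and [eps] factors through the cover. *)
Lemma pdim_le_dim_vector (n : nat) : forall X : lmodType A, pdim_le n X ->
  forall (W : vectType k) (Y : action A k^o W) (Q : lmodType A)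
    (al : {linear lmod_of Y -> X}) (be : {linear X -> lmod_of Y})
    (ga : {linear lmod_of Y -> Q}) (de : {linear Q -> lmod_of Y}),
  projective_module Q -> (forall y, y = be (al y) + de (ga y)) ->
  in_cartan_span (dim_vector Y).
Proof.
elim: n => [|n IHn] X /= => [projX|[P [K [i [f [projP injI exI fsurj pdK]]]]]] W Y Q al be ga de projQ idY.
  apply: dim_vector_projective => X1 X2 g h gsurj.
  have [h1 h1E] := projX _ _ g (h \o be) gsurj.
  have [h2 h2E] := projQ _ _ g (h \o de) gsurj.
  exists ((h1 \o al) \+ (h2 \o ga)) => y /=.
  by rewrite linearD h1E h2E /= -linearD -idY.
pose F := cover W; pose pi := mklin (cover_map_linear Y).
have piE T : pi T = cover_map Y T by [].
have pisurj y : exists T, pi T = y.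
  by exists (tensor 1 y : tens A W); rewrite piE cover_mapE la1.
have projF : projective_module (lmod_of F) := @cover_projective W.
have [al1 al1E] := projF _ _ f (al \o pi) fsurj.
have [be1 be1E] := projP _ _ pi (be \o f) pisurj.
have [de1 de1E] := projQ _ _ pi de pisurj.
(* the failure of the lifts to compose to the identity on the cover *)
pose eps : {linear lmod_of F -> lmod_of F} :=
  (idfun \- (be1 \o al1)) \- (de1 \o (ga \o pi)).
have epsE T : eps T = T - be1 (al1 T) - de1 (ga (pi T)) by [].
have eps_lin : linear eps by move=> a T T'; rewrite linearP.
have pi_eps T : pi (eps T) = 0.
  have b : pi (be1 (al1 T)) = be (al (pi T)).
    by rewrite be1E; congr (be _); exact: al1E.
  rewrite epsE !(linearB pi) b (de1E (ga (pi T))) {1}(idY (pi T)).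
  by rewrite addrAC addrK subrr.
pose S' := syzygy Y.
pose Ker := lker (linfun (mklin (tlift_linear (fun a w => la Y a w)))).
have memKer T : T \in Ker -> pi T = 0 by rewrite memv_ker lfunE => /eqP.
have Kermem T : pi T = 0 -> T \in Ker by move=> T0; rewrite memv_ker lfunE /= -[_ == _]/(pi T == 0) T0.
have ker0 (y : lmod_of S') : pi (vsval y) = 0 by apply: memKer; exact: subvsP.
have val_lin : linear ((fun y => vsval y) : lmod_of S' -> lmod_of F).
  by apply: lmod_linear => [a v w|a v]; [rewrite linearP|exact: sub_laE].
have proj_lin (Z : lmodType A) (g : Z -> lmod_of F) : linear g ->
    (forall z, pi (g z) = 0) -> linear ((fun z => vsproj Ker (g z)) : Z -> lmod_of S').
  move=> gl g0 a z z'; apply: subvs_inj.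
  rewrite [RHS](val_lin a (vsproj Ker (g z)) (vsproj Ker (g z'))).
  by rewrite !vsprojK ?gl //; apply: Kermem => //; rewrite -gl.
have /choice[z zE] (y : lmod_of S') : exists z, al1 (vsval y) = i z.
  by apply/exI; rewrite al1E -[LHS]/(al (pi (vsval y))) ker0 linear0.
have z_lin : linear z.
  by move=> a y y'; apply: injI; rewrite -zE val_lin !linearP /= -!zE.
have be_i x : pi (be1 (i x)) = 0.
  by rewrite be1E /=; have -> : f (i x) = 0 by [apply/exI; exists x]; rewrite linear0.
have beK_lin := proj_lin _ _ (fun a x y => linearP (be1 \o i) a x y) be_i.
have epsK_lin := proj_lin _ _ eps_lin pi_eps.
have [c cE] := dim_vector_projective projF.
have [|c' c'E] := IHn K pdK _ S' (lmod_of F) (mklin z_lin) (mklin beK_lin)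
  (mklin val_lin) (mklin epsK_lin) projF.
  move=> y; have v1 : vsval (vsproj Ker (be1 (i (z y)))) = be1 (i (z y)).
    by apply/vsprojK/Kermem/be_i.
  have v2 : vsval (vsproj Ker (eps (vsval y))) = eps (vsval y).
    by apply/vsprojK/Kermem/pi_eps.
  apply: subvs_inj; rewrite [RHS](linearD vsval) [X in _ = X + _]v1 [X in _ = _ + X]v2.
  by rewrite -zE epsE ker0 !linear0 addr0 addrC subrK.
exists (fun a => c a - c' a) => j.
under eq_bigr do rewrite mulrBl.
by rewrite sumrB -cE -c'E (dim_vector_syzygy Y) PoszD addrC addKr.
Qed.

(** The simple module with character [chi a] has the a-th unit vector as its
    dimension vector, so that the dimension vectors of the A e_a generate the
    lattice of all integral vectors. *)
Lemma peirce_unimodular : finite_global_dimension A ->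
  (\matrix_(i, j) (peirce_dim i j : int) : 'M[int]_r) \in unitmx.
Proof.
move=> [n gld].
have /fin_all_exists[c cE] (a : 'I_r) : exists c : 'I_r -> int,
    forall j, ((a == j)%:R : int) = \sum_b c b * (peirce_dim b j)%:Z.
  pose Y := char_action (chi a) (idfun : {lrmorphism k^o -> k^o}).
  pose Q := lmod_of (cover k^o).
  pose zYQ : {linear lmod_of Y -> Q} := \0; pose zQY : {linear Q -> lmod_of Y} := \0.
  have [|c cE] := pdim_le_dim_vector (gld (lmod_of Y)) (Y := Y) (al := idfun) (be := idfun)
    (ga := zYQ) (de := zQY) (@cover_projective k^o).
    by move=> y; rewrite /= addr0.
  exists c => j; rewrite -cE /dim_vector (dim_diag (p := fun=> a == j) scalar_dual_bases).
    by case: (a == j); rewrite ?card_unit // eq_card0.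
  move=> t; have [chie _ _ _] := basicA; rewrite char_la chie.
  by case: (a == j); rewrite ?mulr1 ?mul0r.
suff : (\matrix_(i, j) c i j : 'M[int]_r) *m (\matrix_(i, j) (peirce_dim i j : int)) = 1%:M.
  by move=> /mulmx1_unit[].
by apply/matrixP => i j; rewrite !mxE cE; apply: eq_bigr => b _; rewrite !mxE.
Qed.

End DimensionVectors.

(** * Cartan matrices of complexes *)

Section Conversions.
Variables (k : fieldType) (A : falgType k) (V : vectType k).

Definition action_of_bimodule (X : bimodule A V) : action A A V :=
  Action (lact_lin X) (ract_lin X) (@lact1 _ _ _ X) (@ract1 _ _ _ X)
    (@lactM _ _ _ X) (@ractM _ _ _ X) (@lract _ _ _ X).

Definition bimodule_of_action (X : action A A V) : bimodule A V :=
  Bimodule (la_lin X) (ra_lin X) (@la1 _ _ _ _ X) (@ra1 _ _ _ _ X)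
    (@laM _ _ _ _ X) (@raM _ _ _ _ X) (@lara _ _ _ _ X).

End Conversions.

Section CartanMatrices.
Variables (k : fieldType) (A : falgType k) (r : nat) (e : 'I_r -> A).
Hypothesis ee : forall i j, e i * e j = if i == j then e i else 0.

Section PeircePart.
Variables (V : lmodType k) (X : bimodule_complex A V).

Definition peirce_part (i j : 'I_r) : {linear V -> V} :=
  lact X (e j) \o ract X (e i).

Lemma peirce_part_id i j x : peirce_part i j (peirce_part i j x) = peirce_part i j x.
Proof. by rewrite /= -lract -lactM -ractM !ee !eqxx. Qed.

Lemma peirce_part_gr i j l x :
  peirce_part i j (gr X l x) = gr X l (peirce_part i j x).
Proof. by rewrite /= gr_lact gr_ract. Qed.

Lemma peirce_part_df i j x : peirce_part i j (df X x) = df X (peirce_part i j x).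
Proof. by rewrite /= df_lact df_ract. Qed.

End PeircePart.

(** Cohomology is finite dimensional on the resolution, so a quasi-isomorphism
    carries a basis of each Peirce component of it to a basis. *)
Lemma cartan_quasi_iso (V : vectType k) (W : lmodType k)
    (P : bimodule_complex A V) (M : bimodule_complex A W) (f : {linear V -> W}) :
  quasi_isomorphism P M f -> cartan_complex e M = cartan_complex e P.
Proof.
move=> [fhom fgr fdf finj fsurj].
have fpp i j x : f (peirce_part P i j x) = peirce_part M i j (f x).
  by rewrite /= (proj1 (fhom _ _)) (proj2 (fhom _ _)).
have fB l x : coboundaries P l x -> coboundaries M l (f x).
  by move=> [y ly ->]; exists (f y); rewrite ?fdf // -fgr ly.
have ppZ U (X : bimodule_complex A U) i j l z :
    cocycles X l z -> cocycles X l (peirce_part X i j z).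
  by move=> [lz dz]; split; rewrite -?peirce_part_gr -?peirce_part_df ?lz ?dz ?linear0.
have ppB U (X : bimodule_complex A U) i j l z :
    coboundaries X l z -> coboundaries X l (peirce_part X i j z).
  move=> [y ly ->]; exists (peirce_part X i j y); first by rewrite -peirce_part_gr ly.
  by rewrite peirce_part_df.
apply: eq_fsbigr => l _; congr (_ *: _); apply/matrixP => i j; rewrite !mxE; congr Posz.
have Pq := is_qdim_part (C := P) (g := peirce_part P i j) (@peirce_part_id _ P i j)
  (@peirce_part_gr _ P i j) (@peirce_part_df _ P i j) l.
rewrite (qdimE _ Pq); last exact: coboundaries_subspace.
apply: qdimE; first exact: coboundaries_subspace.
have [b [bS bfree bgen]] := Pq.
have bZ m : cocycles P l (b m) by have [z zZ <-] := bS m; exact: ppZ.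
exists (fun m => f (b m)); split=> [m|c|x [z zZ <-]].
- have [z [lz dz] bz] := bS m; exists (f z); last by rewrite -bz fpp.
  by split; rewrite -?fgr -?fdf ?lz ?dz ?linear0.
- have -> : \sum_m c m *: f (b m) = f (\sum_m c m *: b m).
    by rewrite linear_sum; apply: eq_bigr => m _; rewrite linearZZ.
  move=> /finj h; apply: bfree; apply: h; split.
    by rewrite linear_sum; apply: eq_bigr => m _; rewrite linearZZ (bZ m).1.
  by rewrite linear_sum big1 // => m _; rewrite linearZZ (bZ m).2 scaler0.
- have [y yZ zy] := fsurj l z zZ.
  have [c yc] := bgen (peirce_part P i j y) (ex_intro2 _ _ y yZ erefl).
  exists c; have -> : \sum_m c m *: f (b m) = f (\sum_m c m *: b m).
    by rewrite linear_sum; apply: eq_bigr => m _; rewrite linearZZ.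
  have -> : peirce_part M i j z - f (\sum_m c m *: b m) =
      peirce_part M i j (z - f y) + f (peirce_part P i j y - \sum_m c m *: b m).
    by rewrite linearB linearB -fpp addrA subrK.
  have [_ BD] := coboundaries_subspace M l.
  by rewrite -[X in X + _]scale1r; apply: BD; [exact: ppB|exact: fB].
Qed.

Lemma cartan_adapted (V : vectType k) (X : bimodule_complex A V) (T : finType)
    (b : T -> V) f l rr d i j : adapted_basis e X X b f l rr d (T := T) ->
  cartan_complex e X i j = \sum_(t | (l t == j) && (rr t == i)) (-1) ^ (d t).
Proof.
move=> [bf bl br bd].
pose p t := (l t == j) && (rr t == i).
have pb t : peirce_part X i j (b t) = if p t then b t else 0.
  rewrite /= br /p [i == _]eq_sym [_ && _]andbC; case: ifP => _ /=; last by rewrite linear0.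
  by rewrite bl eq_sym.
rewrite -(euler_dual_bases (g := peirce_part X i j) (@peirce_part_id _ X i j)
  (@peirce_part_gr _ X i j) (@peirce_part_df _ X i j) bf bd pb).
have [s us s0] := gr_bounded X.
have q0 a c m : m \notin s ->
    qdim [set peirce_part X a c z | z in cocycles X m] (coboundaries X m) = 0%N.
  move=> /s0 m0; apply: qdimE; first exact: coboundaries_subspace.
  exists (fun=> 0); split=> [[]//|c' _ []//|x [z [mz _] <-]].
  by exists (fun=> 0); rewrite -mz m0 linear0 big_ord0 subr0; exists 0; rewrite ?linear0.
rewrite /cartan_complex (@fsum_seq _ _ s us) => [|m ms]; last first.
  by apply/matrixP => a c; rewrite !mxE q0 // mulr0.
rewrite (@fsum_seq _ _ s us) => [|m ms]; last by rewrite q0 // mulr0.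
by rewrite summxE; apply: eq_bigr => m _; rewrite !mxE.
Qed.

End CartanMatrices.

(** * Complexes of projective bimodules *)

Section BalancedLift.
Variables (k : fieldType) (V W : vectType k) (S : Type).
Variables (r : S -> {linear V -> V}) (l : S -> {linear W -> W}).
Local Notation U := (bal_rel r l).

(** The class of v (x) w in the balanced tensor product. *)
Definition btens (v : V) (w : W) : bal_tens r l := qproj U (tensor v w).

Lemma btens_bilin : bilin btens.
Proof.
split=> [w c v v'|v c w w']; rewrite /btens.
  by rewrite tensor_linl (linearP (qproj U)).
by rewrite tensor_linr (linearP (qproj U)).
Qed.

Lemma btens_balanced s v w : btens (r s v) w = btens v (l s w).
Proof.
apply/eqP; rewrite -subr_eq0 /btens -(linearB (qproj U)) qproj_eq0.
by apply: mem_vspan; exists s, v, w.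
Qed.

Lemma bal_eq (Z : lmodType k) (f g : bal_tens r l -> Z) : linear f -> linear g ->
  (forall v w, f (btens v w) = g (btens v w)) -> f =1 g.
Proof.
move=> fl gl fg y; rewrite -(qprojK y); move: (vsval y); apply: tens_eq.
- by move=> c x x'; rewrite (linearP (qproj U)) fl.
- by move=> c x x'; rewrite (linearP (qproj U)) gl.
- exact: fg.
Qed.

Variable Z : lmodType k.

Definition bal_lift (f : V -> W -> Z) (y : bal_tens r l) : Z := tlift f (vsval y).

Lemma bal_lift_linear f : linear (bal_lift f).
Proof. by move=> c x y; rewrite /bal_lift linearP tlift_linear. Qed.

Lemma bal_liftE f v w : bilin f -> (forall s v w, f (r s v) w = f v (l s w)) ->
  bal_lift f (btens v w) = f v w.
Proof.
move=> fb fbal; rewrite -(tliftE v w fb) /bal_lift.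
have fU x : x \in U -> tlift f x = 0.
  have [|K memK] := @subspace_vspace k (tens V W) [set x | tlift f x = 0].
    split=> [|c x1 x2 h1 h2]; first exact: (lin0 (tlift_linear f)).
    by rewrite /= tlift_linear h1 h2 scaler0 addr0.
  suff /subvP sub : (U <= K)%VS by move=> /sub/memK.
  apply: vspan_sub => _ [s [v' [w' ->]]]; apply/memK => /=.
  by rewrite (linB (tlift_linear f)) !tliftE // fbal subrr.
apply/eqP; rewrite -subr_eq0 -(linB (tlift_linear f)); apply/eqP/fU.
by rewrite -qproj_eq0 (linearB (qproj U)) /= qprojK subrr.
Qed.

End BalancedLift.

Section ProjectiveComplex.
Variables (k : fieldType) (A : falgType k) (r : nat) (e : 'I_r -> A).
Variable chi : 'I_r -> {lrmorphism A -> k^o}.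
Hypothesis basicA : basic e chi.
Variables (S : finType) (u : S -> A) (fu : S -> A -> k^o) (lA rA : S -> 'I_r).
Hypothesis uA : peirce_basis e u fu lA rA.

Let ee i j : e i * e j = if i == j then e i else 0.
Proof. by case: basicA. Qed.

Lemma projective_generators (V : vectType k) (P : bimodule_complex A V) :
  projective_bimodule P ->
  exists (T : finType) (al be : T -> 'I_r) (d : T -> int) (x : T -> V)
    (h : T -> V -> tens A A),
  gen_family e e (action_of_bimodule P) P al be d x h /\
  forall v, v = \sum_t ev (action_of_bimodule P) (x t) (h t v).
Proof.
move=> projP; apply: (generators basicA basicA).
- by move=> l a v; exact: gr_lact.
- by move=> l a v; exact: gr_ract.
move=> a b phi phil phie.
pose Y := bimodule_of_action (char_action (chi a) (chi b)).
pose X := bimodule_of_action (free_action A A).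
pose f := mklin (char_form_linear chi chi a b); pose g := mklin phil.
have fhom : bimodule_hom X Y f.
  move=> x T; split; move: T.
    apply: tens_eq => [c v w|c v w|v w]; first by rewrite !linearP.
      by rewrite !linearP.
    by rewrite /= free_laE !char_formE rmorphM mulrA.
  apply: tens_eq => [c v w|c v w|v w]; first by rewrite !linearP.
    by rewrite !linearP.
  by rewrite /= free_raE !char_formE rmorphM /= mulrA mulrC.
have ghom : bimodule_hom P Y g.
  move=> x v; split; rewrite /=.
    by rewrite -[v in LHS](ract1 P) [LHS]phie rmorph1 mulr1.
  by rewrite -[ract P x v](lact1 P) [LHS]phie rmorph1 mul1r.
have [y|h hhom hE] := projP _ _ X Y f g fhom ghom.
  pose T1 : tens A A := tensor 1 1; exists ((y : k) *: T1).
  rewrite /= /T1 (linZ (char_form_linear _ _ _ _)) char_formE !rmorph1 mulr1.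
  by rewrite -[_ *: _]/(_ * _) mulr1.
exists h; split=> [|x z v|v]; first by move=> c v w; rewrite linearP.
  by rewrite (proj1 (hhom _ _)) (proj2 (hhom _ _)).
exact: hE.
Qed.

Section FixedComplex.
Variables (V : vectType k) (P : bimodule_complex A V).
Variables (T : finType) (al be : T -> 'I_r) (d : T -> int) (x : T -> V).
Variable h : T -> V -> tens A A.
Local Notation aP := (action_of_bimodule P).
Hypothesis gen : gen_family e e aP P al be d x h.
Hypothesis full : forall v, v = \sum_t ev aP (x t) (h t v).

(** [mult b a] counts the summands A e_a (x) e_b A of the complex P with signs. *)
Definition mult : 'M[int]_r :=
  \matrix_(b, a) \sum_(t | (be t == b) && (al t == a)) (-1) ^ (d t).

Local Notation CA := (\matrix_(i, j) (peirce_dim lA rA i j : int) : 'M[int]_r).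

Lemma sum_mult (F : 'I_r -> 'I_r -> int) :
  \sum_t (-1) ^ (d t) * F (al t) (be t) = \sum_b \sum_a mult b a * F a b.
Proof.
under [RHS]eq_bigr do under eq_bigr do rewrite mxE mulr_suml.
rewrite pair_bigA /= (exchange_big_dep xpredT) //=; apply: eq_bigr => t _.
rewrite (bigD1 (be t, al t)) /= ?eqxx // big1 ?addr0 // => -[b a] /=.
by move=> /andP[/andP[/eqP -> /eqP ->]]; rewrite eqxx.
Qed.

(** The summand A e_a (x) e_b A contributes the product of the dimensions of
    e_j A e_a and e_b A e_i to the entry (i, j). *)
Lemma cartan_free : cartan_complex e P = CA *m mult *m CA.
Proof.
apply/matrixP => i j.
have bP : adapted_basis e P P
  (fun p : {p in free_index rA lA al be} => free_basis u u aP x (val p))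
  (fun p => free_form fu fu h (val p))
  (fun p => lA (val p).1.2) (fun p => rA (val p).2) (fun p => d (val p).1.1).
  split.
  - exact: (free_dual_bases uA uA gen full).
  - by move=> t l; exact: (free_basis_la u uA aP).
  - by move=> t l; exact: (free_basis_ra u uA aP).
  - by move=> t; apply: (free_basis_gr _ _ gen) => l a v; [exact: gr_lact|exact: gr_ract].
rewrite (cartan_adapted ee i j bP).
have := sum_free_index (q := r) rA lA al be (fun t => (-1) ^ d t) (fun=> 1)
  (fun s => lA s == j) (fun s => rA s == i).
under eq_bigr do rewrite mulr1.
move=> ->.
transitivity (\sum_t (-1) ^ d t * ((peirce_dim lA rA (al t) j)%:Z * (peirce_dim lA rA i (be t))%:Z)).
  apply: eq_bigr => t _; rewrite -mulrA; congr (_ * (_ * _)).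
    by rewrite sumr_const natz.
  by congr Posz; apply: eq_card => s; rewrite !inE andbC.
rewrite (sum_mult (fun a b => (peirce_dim lA rA a j)%:Z * (peirce_dim lA rA i b)%:Z)).
rewrite mxE exchange_big /=; apply: eq_bigr => a _; rewrite !mxE mulr_suml.
by apply: eq_bigr => b _; rewrite !mxE mulrCA mulrA [RHS]mulrAC mulrC !mulrA.
Qed.

End FixedComplex.

End ProjectiveComplex.

(** * Tensor powers and Hochschild homology *)

Section TensorGrading.
Variables (k : fieldType) (V W : vectType k) (S : Type).
Variables (r : S -> {linear V -> V}) (l : S -> {linear W -> W}).
Variables (C : complexes V) (D : complexes W).
Hypothesis rgr : forall s i v, gr C i (r s v) = r s (gr C i v).
Hypothesis rdf : forall s v, df C (r s v) = r s (df C v).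
Hypothesis lgr : forall s i w, gr D i (l s w) = l s (gr D i w).
Hypothesis ldf : forall s w, df D (l s w) = l s (df D w).

Lemma bal_gr_btens i j v w : gr C i v = v -> gr D j w = w ->
  gr (bal_complex rgr rdf lgr ldf) (i + j) (btens r l v w) = btens r l v w.
Proof.
move=> hv hw; rewrite /btens /= (qmapE _ (@bal_gr_stable _ _ _ _ _ _ _ _ rgr lgr (i + j))) /=.
by rewrite (tens_gr_homog _ hv hw) eqxx.
Qed.

End TensorGrading.

Section TensorProduct.
Variables (k : fieldType) (A : falgType k) (r : nat) (e : 'I_r -> A).
Variable chi : 'I_r -> {lrmorphism A -> k^o}.
Hypothesis basicA : basic e chi.
Variables (S : finType) (u : S -> A) (fu : S -> A -> k^o) (lA rA : S -> 'I_r).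
Hypothesis uA : peirce_basis e u fu lA rA.
Variables (V : vectType k) (P : bimodule_complex A V).
Variables (T : finType) (al be : T -> 'I_r) (d : T -> int) (x : T -> V).
Variable h : T -> V -> tens A A.
Local Notation aP := (action_of_bimodule P).
Hypothesis gen : gen_family e e aP P al be d x h.
Hypothesis full : forall v, v = \sum_t ev aP (x t) (h t v).

Variables (W : vectType k) (X : bimodule_complex A W).
Variables (TX : finType) (bX : TX -> W) (fX : TX -> W -> k^o).
Variables (lX rX : TX -> 'I_r) (dX : TX -> int).
Hypothesis basisX : adapted_basis e X X bX fX lX rX dX.

Local Notation CA := (\matrix_(i, j) (peirce_dim lA rA i j : int) : 'M[int]_r).
Local Notation xp := (btens (ract X) (lact P)).

Let ee i j : e i * e j = if i == j then e i else 0.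
Proof. by case: basicA. Qed.

Let fX_lin s : linear (fX s). Proof. by have [[]] := basisX. Qed.
Let fu_lin s : linear (fu s). Proof. by have [[]] := uA. Qed.

Let fX_part s i j y : fX s (lact X (e i) (ract X (e j) y)) =
  if (i == lX s) && (j == rX s) then fX s y else 0.
Proof.
have [bf bl br _] := basisX.
apply: (dual_diag (g := fun y => lact X (e i) (ract X (e j) y))
  (p := fun s => (i == lX s) && (j == rX s)) bf) => [c v w|t].
  by rewrite !linearP.
rewrite br; case: (j == rX t); rewrite ?andbT ?andbF ?linear0 //. 
Qed.

Let fX_r s j y : fX s (ract X (e j) y) = if j == rX s then fX s y else 0.
Proof.
have [bf _ br _] := basisX.
by apply: (dual_diag (p := fun s => j == rX s) bf) => // c v w; rewrite linearP.
Qed.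

Let fu_l s j y : fu s (e j * y) = if j == lA s then fu s y else 0.
Proof.
have [uf ul _] := uA.
apply: (dual_diag (g := fun y => e j * y) (p := fun s => j == lA s) uf) => // c v w.
by rewrite mulrDr scalerAr.
Qed.

Let h_lin t : linear (h t). Proof. by case: gen => /(_ t)[]. Qed.

Let h_la t a v : h t (lact P a v) = la (free_action A A) a (h t v).
Proof.
have [/(_ t)[_ hh] _ _ _ _] := gen.
by rewrite -[v in LHS](ra1 aP) hh ra1.
Qed.

Let h_ra t a v : h t (ract P a v) = ra (free_action A A) a (h t v).
Proof.
have [/(_ t)[_ hh] _ _ _ _] := gen.
by rewrite -[ract P a v](la1 aP) hh la1.
Qed.

(* the coordinates of y u (x) x_t w, as functions of u (x) w *)
Let form (s : TX) (s' : S) (y : W) : tens A A -> k^o :=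
  tlift (fun a b => fX s (ract X a y) * fu s' b : k^o).

Let formE s s' y a b : form s s' y (tensor a b) = fX s (ract X a y) * fu s' b.
Proof.
rewrite /form tliftE //; split=> [w c v v'|v c w w'].
  by rewrite (ract_lin X) fX_lin mulrDl -[c *: _]/(c * _) -mulrA.
by rewrite fu_lin mulrDr -[c *: _]/(c * _) mulrCA.
Qed.

Let form_lin s s' y : linear (form s s' y).
Proof. exact: tlift_linear. Qed.

Let form_linr s s' Y : linear (fun y => form s s' y Y).
Proof.
move=> c y y'; move: Y; apply: tens_eq; first exact: form_lin.
  by apply: lin_comb; exact: form_lin.
by move=> a b; rewrite !formE linearP fX_lin mulrDl -mulrA.
Qed.

Let form_trunc s s' y t Y : form s s' y (trunc (e (al t)) (e (be t)) Y) =
  if (al t == rX s) && (be t == lA s') then form s s' y Y else 0.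
Proof.
move: Y; apply: tens_eq => [c a b|c a b|a b].
- by rewrite linearP form_lin.
- by case: ifP; rewrite ?form_lin // scaler0 addr0.
rewrite truncE !formE ractM fX_r fu_l.
by do 2!case: eqP => _; rewrite /= ?mul0r ?mulr0.
Qed.

Let form_bal s s' a y Y :
  form s s' (ract X a y) Y = form s s' y (la (free_action A A) a Y).
Proof.
move: Y; apply: tens_eq => [|c b b'|b b']; first exact: form_lin.
  by rewrite linearP form_lin.
by rewrite [la _ _ _]free_laE !formE ractM.
Qed.

Let xp_expand y t Y : xp y (ev aP (x t) Y) =
  \sum_s \sum_s' form s s' y Y *: xp (bX s) (ract P (u s') (x t)).
Proof.
have [xpl xpr] := btens_bilin (ract X) (lact P).
have [[_ _ bf] _ _ _] := basisX; have [[_ _ uf] _ _] := uA.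
move: Y; apply: tens_eq => [c a b|c a b|a b].
- by rewrite ev_linear xpr.
- rewrite scaler_sumr -big_split; apply: eq_bigr => s _ /=.
  rewrite scaler_sumr -big_split; apply: eq_bigr => s' _ /=.
  by rewrite form_lin scalerDl scalerA.
rewrite evE /= -btens_balanced {1}(bf (ract X a y)) (lin_sum (xpl _)).
apply: eq_bigr => s _; rewrite (linZ (xpl _)) {1}(uf b).
rewrite (lin_sum (@ract_lin _ _ _ P (x t))) (lin_sum (xpr _)) scaler_sumr.
apply: eq_bigr => s' _; rewrite (linZ (@ract_lin _ _ _ P (x t))) (linZ (xpr _)).
by rewrite scalerA formE.
Qed.

Let ti := free_index rX lA al be.

Let tbasis (p : T * TX * S) := xp (bX p.1.2) (ract P (u p.2) (x p.1.1)).

Let tform (p : T * TX * S) : bal_tens (ract X) (lact P) -> k^o :=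
  bal_lift (fun y v => form p.1.2 p.2 y (h p.1.1 v)).

Let tform_lin p : linear (tform p).
Proof. exact: bal_lift_linear. Qed.

Let tformE p y v : tform p (xp y v) = form p.1.2 p.2 y (h p.1.1 v).
Proof.
rewrite /tform bal_liftE //.
  by split=> [w|w c v1 v2]; [exact: form_linr|rewrite h_lin form_lin].
by move=> a y' v'; rewrite form_bal -h_la.
Qed.

(** The tensor product of X with A e_a (x) e_b A is X e_a (x) e_b A. *)
Lemma tensor_dual_bases : dual_bases (fun p : {p in ti} => tbasis (val p))
  (fun p => tform (val p)).
Proof.
have [hh hgr htr hx hhx] := gen.
have [uf ul ur] := uA; have [bf bl br _] := basisX.
apply: sub_dual_bases => [p|[[t s] s'] [[t1 s1] s1']|v].
- exact: bal_lift_linear.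
- rewrite !inE /= => /andP[/eqP st /eqP st'] /andP[/eqP st1 /eqP st1'].
  rewrite tformE /= h_ra hhx !xpair_eqE.
  case: (t =P t1) => [_|_] /=; last by rewrite linear0 (lin0 (form_lin _ _ _)).
  rewrite free_raE formE st1 br eqxx st1' ul eqxx.
  have [_ fb _] := bf; have [_ fb' _] := uf.
  by rewrite fb fb' -natrM mulnb.
- rewrite [RHS]big_mkcond /=; move: v; apply: bal_eq => [//|c v v'|y v].
    rewrite scaler_sumr -big_split; apply: eq_bigr => p _ /=.
    by case: ifP => _; rewrite ?scaler0 ?addr0 // tform_lin scalerDl scalerA.
  have [_ xpr] := btens_bilin (ract X) (lact P).
  transitivity (\sum_t \sum_s \sum_s' (if (t, s, s') \in ti then
      tform (t, s, s') (xp y v) *: tbasis (t, s, s') else 0)); last first.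
    rewrite pair_bigA pair_bigA /=.
    by apply: eq_bigr => -[[t s] s'].
  rewrite {1}(full v) (lin_sum (xpr _)); apply: eq_bigr => t _.
  rewrite xp_expand; apply: eq_bigr => s _; apply: eq_bigr => s' _.
  rewrite htr form_trunc inE /=; case: ifP => stP; last by rewrite scale0r.
  by rewrite tformE /= [in RHS]htr form_trunc stP.
Qed.

Lemma cartan_tensor :
  cartan_complex e (bimod_tensor X P) = CA *m mult al be d *m cartan_complex e X.
Proof.
have [bf bl br bd] := basisX; have [_ ul ur] := uA.
have bT : adapted_basis e (bimod_tensor X P) (bimod_tensor X P)
  (fun p : {p in ti} => tbasis (val p)) (fun p => tform (val p))
  (fun p => lX (val p).1.2) (fun p => rA (val p).2)
  (fun p => dX (val p).1.2 + d (val p).1.1).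
  split; first exact: tensor_dual_bases.
  - move=> t j; rewrite [LHS]bt_lactE bl; case: ifP => // _.
    by rewrite tensor0l linear0.
  - move=> t i; rewrite [LHS]bt_ractE -ractM ur; case: ifP => // _.
    by rewrite (lin0 (@ract_lin _ _ _ P _)) tensor0r linear0.
  - move=> t; apply: bal_gr_btens; first exact: bd.
    by have [_ _ _ hx _] := gen; rewrite gr_ract (proj1 (hx _)).
apply/matrixP => i j; rewrite (cartan_adapted ee i j bT).
have := sum_free_index (q := r) rX lA al be (fun t => (-1) ^ d t) (fun s => (-1) ^ dX s)
  (fun s => lX s == j) (fun s => rA s == i).
under eq_bigr do rewrite -exprzDr ?unitrN1 // addrC.
move=> ->.
transitivity (\sum_t (-1) ^ d t * (cartan_complex e X (al t) j * (peirce_dim lA rA i (be t))%:Z)).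
  apply: eq_bigr => t _; rewrite -mulrA; congr (_ * (_ * _)).
    by rewrite (cartan_adapted ee _ _ basisX).
  by congr Posz; apply: eq_card => s; rewrite !inE andbC.
rewrite (sum_mult al be d (fun a b => cartan_complex e X a j * (peirce_dim lA rA i b)%:Z)).
rewrite mxE exchange_big /=; apply: eq_bigr => a _; rewrite !mxE mulr_suml.
by apply: eq_bigr => b _; rewrite !mxE mulrCA mulrA [RHS]mulrAC mulrC !mulrA.
Qed.

Local Notation Y := (bimod_tensor X P).
Local Notation er := (@env_ract k A).
Local Notation el := (env_lact Y).
Local Notation hh := (btens er el).

Let env_move a y : hh a y = hh 1 (lact Y a y).
Proof.
have -> : a = er (1, a) 1 by rewrite /= amullE amulrE !mul1r.
by rewrite btens_balanced /= bt_ract1 amullE amulrE !mul1r.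
Qed.

Let env_cycle a y : hh 1 (ract Y a y) = hh 1 (lact Y a y).
Proof.
rewrite -env_move; have {2}-> : a = er (a, 1) 1 by rewrite /= amullE amulrE !mulr1.
by rewrite btens_balanced /= bt_lact1.
Qed.

(* u (x) w sends the class of y (x) u x_t w to the coordinate of w y u *)
Let cform (s : TX) (y : W) : tens A A -> k^o :=
  tlift (fun a b => fX s (lact X b (ract X a y))).

Let cformE s y a b : cform s y (tensor a b) = fX s (lact X b (ract X a y)).
Proof.
rewrite /cform tliftE //; split=> [w c v v'|v c w w'].
  by rewrite (ract_lin X) linearP fX_lin.
by rewrite (lact_lin X) fX_lin.
Qed.

Let cform_lin s y : linear (cform s y).
Proof. exact: tlift_linear. Qed.

Let cform_linr s Z : linear (fun y => cform s y Z).
Proof.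
move=> c y y'; move: Z; apply: tens_eq; first exact: cform_lin.
  by apply: lin_comb; exact: cform_lin.
by move=> a b; rewrite !cformE !linearP fX_lin.
Qed.

Let cform_trunc s y t Z : cform s y (trunc (e (al t)) (e (be t)) Z) =
  if (be t == lX s) && (al t == rX s) then cform s y Z else 0.
Proof.
move: Z; apply: tens_eq => [c a b|c a b|a b].
- by rewrite linearP cform_lin.
- by case: ifP; rewrite ?cform_lin // scaler0 addr0.
by rewrite truncE !cformE lactM ractM [lact X b _]lract fX_part.
Qed.

Let cform_bal s a y Z :
  cform s (ract X a y) Z = cform s y (la (free_action A A) a Z).
Proof.
move: Z; apply: tens_eq => [|c b b'|b b']; first exact: cform_lin.
  by rewrite linearP cform_lin.
by rewrite [la _ _ _]free_laE !cformE ractM.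
Qed.

Let cform_bal' s a y Z :
  cform s (lact X a y) Z = cform s y (ra (free_action A A) a Z).
Proof.
move: Z; apply: tens_eq => [|c b b'|b b']; first exact: cform_lin.
  by rewrite linearP cform_lin.
by rewrite [ra _ _ _]free_raE !cformE lactM [lact X a (ract _ _ _)]lract.
Qed.

Let yform (t : T) (s : TX) (a : A) : bal_tens (ract X) (lact P) -> k^o :=
  bal_lift (fun y v => cform s (lact X a y) (h t v)).

Let yformE t s a y v : yform t s a (xp y v) = cform s (lact X a y) (h t v).
Proof.
rewrite /yform bal_liftE //.
  split=> [w c v1 v2|w c v1 v2]; first by rewrite linearP cform_linr.
  by rewrite h_lin cform_lin.
by move=> b y' v'; rewrite lract cform_bal -h_la.
Qed.

Let yform_lin t s a : linear (yform t s a).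
Proof. exact: bal_lift_linear. Qed.

Let hform (p : T * TX) : bal_tens er el -> k^o :=
  bal_lift (fun a y => yform p.1 p.2 a y).

Let hformE p a y : hform p (hh a y) = yform p.1 p.2 a y.
Proof.
rewrite /hform bal_liftE //.
  split=> [w c a1 a2|w]; last exact: yform_lin.
  move: w; apply: bal_eq; first exact: yform_lin.
    by apply: lin_comb; exact: yform_lin.
  by move=> y' v; rewrite !yformE (lact_lin X) cform_linr.
move=> [b c] a'; apply: bal_eq; first exact: yform_lin.
  by move=> z w w'; rewrite linearP yform_lin.
move=> y' v; rewrite /= /btens bt_ractE bt_lactE -!/(btens _ _ _ _) !yformE.
by rewrite amullE amulrE h_ra -cform_bal' -!lactM.
Qed.

Let hi : {pred T * TX} := [pred p | (be p.1 == lX p.2) && (al p.1 == rX p.2)].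

Let hbasis (p : T * TX) := hh 1 (xp (bX p.2) (x p.1)).

Let hform_lin p : linear (hform p).
Proof. exact: bal_lift_linear. Qed.

Let hh_expand t y Z : hh 1 (xp y (ev aP (x t) Z)) =
  \sum_s cform s y Z *: hbasis (t, s).
Proof.
have [xpl xpr] := btens_bilin (ract X) (lact P).
have [_ hhr] := btens_bilin er el.
have [[_ _ bf] _ _ _] := basisX.
move: Z; apply: tens_eq => [c a b|c a b|a b].
- by rewrite ev_linear xpr hhr.
- rewrite scaler_sumr -big_split; apply: eq_bigr => s _ /=.
  by rewrite cform_lin scalerDl scalerA.
have -> : xp y (ev aP (x t) (tensor a b)) = ract Y b (xp (ract X a y) (x t)).
  by rewrite evE [RHS]bt_ractE -/(btens _ _ _ _) btens_balanced.
rewrite env_cycle [lact Y b _]bt_lactE -/(btens _ _ _ _).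
rewrite {1}(bf (lact X b (ract X a y))) (lin_sum (xpl _)) (lin_sum (hhr _)).
by apply: eq_bigr => s _; rewrite (linZ (xpl _)) (linZ (hhr _)) cformE.
Qed.

(** The tensor product of A with X e_a (x) e_b A over the enveloping algebra is
    e_b X e_a: factors in A can be moved around cyclically. *)
Lemma hochschild_dual_bases : dual_bases (fun p : {p in hi} => hbasis (val p))
  (fun p => hform (val p)).
Proof.
have [_ _ htr hx hhx] := gen.
have [bf bl br _] := basisX.
apply: sub_dual_bases => [p|[t s] [t1 s1]|v].
- exact: hform_lin.
- rewrite !inE /= => /andP[/eqP st /eqP st'] /andP[/eqP st1 /eqP st1'].
  rewrite hformE yformE /= hhx !xpair_eqE lact1.
  case: (t =P t1) => [_|_] /=; last by rewrite (lin0 (cform_lin _ _)).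
  rewrite cformE st1' br eqxx st1 bl eqxx.
  by have [_ fb _] := bf; rewrite fb.
- rewrite [RHS]big_mkcond /=; move: v; apply: bal_eq => [//|c v v'|a y].
    rewrite scaler_sumr -big_split; apply: eq_bigr => p _ /=.
    by case: ifP => _; rewrite ?scaler0 ?addr0 // hform_lin scalerDl scalerA.
  rewrite env_move.
  move: (lact Y a y); have [_ hhr] := btens_bilin er el.
  have [_ xpr] := btens_bilin (ract X) (lact P).
  apply: bal_eq => [c v v'|c v v'|z v]; first by rewrite hhr.
    rewrite scaler_sumr -big_split; apply: eq_bigr => p _ /=.
    by case: ifP => _; rewrite ?scaler0 ?addr0 // hhr hform_lin scalerDl scalerA.
  transitivity (\sum_t \sum_s (if (t, s) \in hi then
      hform (t, s) (hh 1 (xp z v)) *: hbasis (t, s) else 0)); last first.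
    by rewrite pair_bigA /=; apply: eq_bigr => -[t s].
  rewrite {1}(full v) (lin_sum (xpr _)) (lin_sum (hhr _)); apply: eq_bigr => t _.
  rewrite hh_expand; apply: eq_bigr => s _.
  rewrite htr cform_trunc inE /=; case: ifP => stP; last by rewrite scale0r.
  by rewrite hformE yformE lact1 [in RHS]htr cform_trunc stP.
Qed.

(** The trace is an Euler characteristic, to which a summand A e_a (x) e_b A of P
    contributes the signed dimension of e_b X e_a. *)
Lemma hochschild_tdim :
  `|\tr (mult al be d *m cartan_complex e X)| <= (tdim (hochschild Y))%:Z.
Proof.
have [_ _ _ bd] := basisX; have [_ _ _ hx _] := gen.
have gb (p : {p in hi}) : gr (hochschild Y) (dX (val p).2 + d (val p).1) (hbasis (val p)) =
    hbasis (val p).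
  rewrite -[_ + _]add0r; apply: bal_gr_btens; first by [].
  by apply: bal_gr_btens; [exact: bd|exact: (proj1 (hx _))].
have := tdim_ge hochschild_dual_bases gb; rewrite -(big_sub hi (fun p => (-1) ^ (dX p.2 + d p.1))).
suff -> : \sum_(p in hi) (-1) ^ (dX p.2 + d p.1) = \tr (mult al be d *m cartan_complex e X) by [].
rewrite /mxtrace; under [RHS]eq_bigr do rewrite mxE.
rewrite -(sum_mult al be d (fun a b => cartan_complex e X a b)).
transitivity (\sum_t \sum_s (if (t, s) \in hi then (-1) ^ d t * (-1) ^ dX s else 0 : int)).
  rewrite pair_bigA big_mkcond; apply: eq_bigr => -[t s] _ /=.
  by rewrite exprzDr ?unitrN1 // mulrC.
apply: eq_bigr => t _; rewrite (cartan_adapted ee _ _ basisX) mulr_sumr [RHS]big_mkcond.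
by apply: eq_bigr => s _; rewrite inE /= eq_sym [al t == _]eq_sym.
Qed.

End TensorProduct.

(** * Growth of the traces of powers of a matrix *)

Lemma trig_exp (F : fieldType) (n : nat) (T : 'M[F]_n) (m : nat) : is_trig_mx T ->
  is_trig_mx (T ^+ m) /\ forall i, (T ^+ m) i i = T i i ^+ m.
Proof.
move=> /is_trig_mxP Ttrig; elim: m => [|m [/is_trig_mxP IHt IHd]].
  split=> [|i]; last by rewrite !expr0 mxE eqxx.
  by apply/is_trig_mxP => i j ij; rewrite expr0 mxE; case: eqP ij => // ->; rewrite ltnn.
split=> [|i]; first apply/is_trig_mxP => i j ij.
  rewrite exprS mxE big1 // => l _; have [il|li] := ltnP i l.
    by rewrite Ttrig ?mul0r.
  by rewrite IHt ?mulr0 // (leq_ltn_trans li).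
rewrite exprS mxE (bigD1 i) //= IHd -exprS big1 ?addr0 // => l li.
have [il|il] := ltnP i l; first by rewrite Ttrig ?mul0r.
by rewrite IHt ?mulr0 // ltn_neqAle il andbT.
Qed.

Lemma trace_power_sum (C : numClosedFieldType) (n : nat) (A : 'M[C]_n) :
  exists t : 'I_n -> C, (forall m, \tr (A ^+ m) = \sum_i t i ^+ m) /\
    forall z, eigenvalue A z -> exists i, t i = z.
Proof.
case: n A => [|n] A.
  exists (fun=> 0); split=> [m|z /eigenvalueP[v _]].
    by rewrite /mxtrace !big_ord0.
  by rewrite [v]thinmx0 eqxx.
have [P Punit Ptrig] := Schur A (ltn0Sn n).
have Pu := unitarymx_unit Punit.
pose T := conjmx P A.
have TE : T = P *m A *m invmx P by exact: conjumx.
have PA : P *m A = T *m P by rewrite TE mulmxKV.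
have Ttrig : is_trig_mx T by move: Ptrig; rewrite /similar_to.
have PAm m : P *m A ^+ m = T ^+ m *m P.
  elim: m => [|m IHm]; first by rewrite !expr0 mulmx1 mul1mx.
  by rewrite !exprSr -[in LHS]mulmxE mulmxA IHm -mulmxA PA mulmxA.
exists (fun i => T i i); split=> [m|z /eigenvalueP[v vA v0]].
  rewrite -[A ^+ m](mulKmx Pu) PAm mxtrace_mulC -mulmxA mulmxV // mulmx1.
  by apply: eq_bigr => i _; rewrite (proj2 (trig_exp m Ttrig)).
have : eigenvalue T z.
  apply/eigenvalueP; exists (v *m invmx P).
    by rewrite TE !mulmxA mulmxKV // vA scalemxAl.
  by apply: contraNneq v0 => vP; rewrite -[v](mulmxKV Pu) vP mul0mx.
rewrite eigenvalue_root_char char_poly_trig // rootE horner_prod => /prodf_eq0[i _].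
by rewrite hornerXsubC subr_eq0 => /eqP ->; exists i.
Qed.

Lemma bernoulli_ineq (R : realFieldType) (x : R) (m : nat) : 0 <= x ->
  1 + x *+ m <= (1 + x) ^+ m.
Proof.
move=> x0; elim: m => [|m IHm]; first by rewrite mulr0n addr0 expr0.
rewrite exprS; apply: le_trans (ler_wpM2l _ IHm); last by rewrite addr_ge0.
rewrite mulrDl mul1r mulrDr mulr1 mulrSr addrA lerD2l -[X in X <= _]addr0 lerD2l.
by rewrite mulr_ge0 // mulrn_wge0.
Qed.

Lemma geometric_domination (R : realType) (a mu c K : R) (N : nat) :
  0 < mu -> 0 < c -> (forall m, (N <= m)%N -> a ^+ m * c <= mu ^+ m * K) -> a <= mu.
Proof.
move=> mu0 c0 le; rewrite leNgt; apply/negP => lt.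
pose x := a / mu - 1.
have x0 : 0 < x by rewrite subr_gt0 ltr_pdivlMr // mul1r.
have [m mP] : exists m : nat, K / c < m%:R * x.
  have [M KM] : exists M : nat, K / c / x < M%:R.
    exists (Num.bound `|K / c / x|).
    by apply: le_lt_trans (ler_norm _) (archi_boundP (normr_ge0 _)).
  by exists M; rewrite -ltr_pdivrMr.
pose m' := maxn m N.
have := le m' (leq_maxr _ _).
have -> : a = mu * (1 + x) by rewrite /x addrC subrK mulrC divfK ?gt_eqF.
rewrite exprMn -mulrA ler_pM2l ?exprn_gt0 // -ler_pdivlMr //; apply/negP; rewrite -ltNge.
apply: lt_le_trans mP _; apply: le_trans (bernoulli_ineq m' (ltW x0)).
rewrite -[x *+ m']mulr_natl -[X in X <= _]add0r; apply: lerD; first exact: ler01.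
by apply: ler_wpM2r; [exact: ltW|rewrite ler_nat leq_maxl].
Qed.

Local Notation "x %:C" := (real_complex_def (Phant _) x) : ring_scope.

(** Traces of powers are power sums of the eigenvalues. Evaluating at them a
    polynomial that vanishes at all of them but [z] isolates the contribution
    of [z], with its multiplicity, as a fixed combination of boundedly many
    consecutive traces; these cannot all be much smaller than a power of [z]. *)
Lemma trace_growth (R : realType) (r : nat) (Psi : 'M[int]_r) (z : R[i]) (mu : R)
    (N : nat) : 0 < mu -> eigenvalue (map_mx (intr : int -> R[i]) Psi) z ->
  (forall m, (N <= m)%N -> (`|\tr (Psi ^+ m)|%:~R : R) <= mu ^+ m) ->
  Normc.normc z <= mu.
Proof.
move=> mu0 eigz trle.
pose A : 'M[R[i]]_r := map_mx intr Psi.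
have [t [trA eigA]] := trace_power_sum A.
have [i0 ti0] := eigA z eigz.
have normE (w : R[i]) : `|w| = (Normc.normc w)%:C by [].
have trAle m : (N <= m)%N -> `|\tr (A ^+ m)| <= (mu ^+ m)%:C.
  move=> /trle le.
  have -> : \tr (A ^+ m) = (\tr (Psi ^+ m))%:~R.
    rewrite /A; have -> : map_mx (intr : int -> R[i]) Psi ^+ m = map_mx intr (Psi ^+ m).
      elim: (m) => [|l IHl]; first by rewrite !expr0; apply/matrixP => i j; rewrite !mxE rmorph_nat.
      by rewrite !exprS IHl -[in RHS]/(Psi *m _) map_mxM.
    by rewrite raddf_sum; apply: eq_bigr => i _; rewrite mxE.
  rewrite -intr_norm -[X in X <= _](rmorph_int (real_complex R)) lecR.
  exact: le.
(* q vanishes at all eigenvalues but z. *)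
pose q := \prod_(j | t j != z) ('X - (t j)%:P).
have qt j : t j != z -> q.[t j] = 0.
  move=> tj; rewrite /q horner_prod (bigD1 j) //= hornerXsubC subrr mul0r //.
have qz : q.[z] != 0.
  rewrite /q horner_prod; apply/prodf_neq0 => j tj.
  by rewrite hornerXsubC subr_eq0 eq_sym.
have comb m : \sum_(l < size q) q`_l * \tr (A ^+ (m + l)) =
    z ^+ m * (#|[pred j | t j == z]|%:R * q.[z]).
  under eq_bigr do rewrite trA mulr_sumr.
  rewrite exchange_big /=.
  have -> : \sum_i \sum_(l < size q) q`_l * t i ^+ (m + l) = \sum_i t i ^+ m * q.[t i].
    apply: eq_bigr => i _; rewrite horner_coef mulr_sumr; apply: eq_bigr => l _.
    by rewrite exprD mulrCA.
  rewrite (bigID (fun i => t i == z)) /= [X in _ + X]big1 ?addr0 => [|i /qt ->]; last by rewrite mulr0.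
  rewrite (eq_bigr (fun=> z ^+ m * q.[z])) => [|i /eqP ->] //.
  by rewrite sumr_const mulrCA [RHS]mulrC mulr_natr.
apply: (@geometric_domination R (Normc.normc z) mu
  (#|[pred j | t j == z]|%:R * Normc.normc q.[z])
  (\sum_(l < size q) Normc.normc q`_l * mu ^+ l) N mu0) => [|m Nm].
  rewrite mulr_gt0 ?ltr0n //.
    by apply/card_gt0P; exists i0; rewrite inE ti0.
  by rewrite -(ltcR _ _) -normE normr_gt0.
rewrite -lecR !rmorphM /= !rmorphXn /= -!normE rmorph_nat -normrX.
rewrite -[X in _ * (X * _)]normr_nat -!normrM -comb.
apply: (le_trans (ler_norm_sum _ _ _)); rewrite rmorph_sum mulr_sumr.
apply: ler_sum => l _; rewrite normrM rmorphM /= -normE mulrCA ler_wpM2l //.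
have -> : mu%:C ^+ m * (mu ^+ l)%:C = (mu ^+ (m + l))%:C.
  by rewrite exprD rmorphM /= !rmorphXn.
apply: trAle.
by rewrite (leq_trans Nm) ?leq_addr.
Qed.

(** * The entropy estimate *)

(** A bound above the upper limit is a bound of all but finitely many terms.
    Terms with t n = 0 have logarithm -oo and satisfy the conclusion trivially. *)
Lemma entropy_bound (R : realType) (t : nat -> nat) (c : R) :
  (limn_esup (fun n => ((n.+1%:R^-1 : R)%:E * lne ((t n)%:R : R)%:E)%E) < c%:E)%E ->
  exists N, forall n, (N <= n)%N -> ((t n)%:R : R) <= expR c ^+ n.+1.
Proof.
move=> /ereal_inf_lt[_ [B [N _ NB] <-]] supB.
exists N => n Nn; have [->|tn] := posnP (t n); first by rewrite exprn_ge0 ?expR_ge0.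
have tn0 : 0 < (t n)%:R :> R by rewrite ltr0n.
have : ((n.+1%:R^-1 : R)%:E * lne ((t n)%:R : R)%:E < c%:E)%E.
  by apply: le_lt_trans supB; apply: ereal_sup_ubound; exists n => //; exact: NB.
rewrite lne_EFin // -EFinM lte_fin ltr_pdivrMl ?ltr0n // => ltc.
rewrite -expRM_natl -[X in X <= _]lnK ?posrE // ler_expR.
exact: ltW.
Qed.

Section Trace.
Variables (k : fieldType) (A : falgType k) (r : nat) (e : 'I_r -> A).
Variables (V : lmodType k) (M : bimodule_complex A V) (M_perf : perfect M).
Hypotheses (elemA : elementary A) (gldA : finite_global_dimension A).
Hypothesis idem : complete_primitive_idempotents e.

Lemma cartan_regular (chi : 'I_r -> {lrmorphism A -> k^o}) (S : finType)
    (u : S -> A) fu lA rA : basic e chi -> peirce_basis e u fu lA rA ->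
  cartan e (regular_bimodule A) =
  \matrix_(i, j) (peirce_dim lA rA i j : int).
Proof.
move=> basicA [uf ul ur]; apply/matrixP => i j; rewrite !mxE; congr Posz.
rewrite (qdim_image (lact (regular_bimodule A) (e j) \o ract (regular_bimodule A) (e i))).
apply: (dim_diag uf) => s; rewrite /= amullE amulrE ur.
rewrite /= [lA s == j]eq_sym [rA s == i]eq_sym andbC.
by case: (i == rA s); rewrite ?mulr0 // ul.
Qed.

(** The Lefschetz-type formula behind the theorem: up to sign, the trace of a
    power of the dual Coxeter matrix is the Euler characteristic of Hochschild
    homology, hence bounded by its total dimension. The exponent starts at 2
    because this homology is computed for products X (x)_A P, by means of the
    decomposition of P. *)
Lemma trace_le_HH_tdim (n : nat) :
  `|\tr (dual_coxeter e M ^+ n.+2)| <= (HH_tdim M_perf n.+1)%:Z.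
Proof.
have [chi basicA] := elementary_basic elemA idem.
have [_ ee sume _] := basicA.
rewrite /HH_tdim; have [projP [f qf]] := projT2 (cid M_perf).
rewrite -/(resolution M_perf) in projP f qf *; move: (resolution M_perf) projP f qf => P projP f qf.
have [||S [u [fu [lA [rA [d0 [uf ul ur _]]]]]]] :=
  @exists_adapted_basis k A r e A (regular_bimodule A) (stalk A) ee sume.
- by move=> i a v; rewrite /= /stalk_gr; case: ifP => //= _; rewrite linear0.
- by move=> i a v; rewrite /= /stalk_gr; case: ifP => //= _; rewrite linear0.
have uA : peirce_basis e u fu lA rA.
  by split=> // s j; [have := ul s j|have := ur s j]; rewrite /= ?amullE ?amulrE.
have [T [al [be [d [x [h [gen full]]]]]]] := projective_generators basicA projP.
have CAE := cartan_regular basicA uA.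
set CA := cartan e (regular_bimodule A) in CAE *.
have CAunit : CA \in unitmx by rewrite CAE; exact: peirce_unimodular uA basicA gldA.
have CP : cartan_complex e P = CA *m mult al be d *m CA.
  by rewrite CAE; exact: (cartan_free basicA uA gen full).
pose N := CA *m mult al be d.
have psi : dual_coxeter e M = - N.
  by rewrite /dual_coxeter (cartan_quasi_iso ee qf) CP mulmxK.
have CX m : cartan_complex e (tensor_powerS P m) = N ^+ m.+1 *m CA.
  elim: m => [|m IHm]; first by rewrite expr1 -CP.
  have [||TX [bX [fX [lX [rX [dX basisX]]]]]] :=
    @exists_adapted_basis k A r e _ (tensor_powerS P m) (tensor_powerS P m) ee sume.
  - by move=> i a v; exact: gr_lact.
  - by move=> i a v; exact: gr_ract.
  have := cartan_tensor basicA uA gen full basisX; rewrite -CAE => ->.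
  by rewrite IHm mulmxA -/N -[N *m _]/(N * _) -exprS.
have [||TX [bX [fX [lX [rX [dX basisX]]]]]] :=
  @exists_adapted_basis k A r e _ (tensor_powerS P n) (tensor_powerS P n) ee sume.
- by move=> i a v; exact: gr_lact.
- by move=> i a v; exact: gr_ract.
have := hochschild_tdim basicA gen full basisX; rewrite CX.
rewrite mulmxA mxtrace_mulC mulmxA -/N -[N *m _]/(N * _) -exprS psi.
rewrite exprNn -signr_odd; case: (odd _); rewrite ?expr1 ?expr0 ?mul1r ?mulN1r //.
by rewrite raddfN normrN.
Qed.

End Trace.

Theorem theoremC (R : realType) (k : fieldType) (A : falgType k)
    (r : nat) (e : 'I_r -> A)
    (V : lmodType k) (M : bimodule_complex A V) (M_perf : perfect M) :
  elementary A ->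
  finite_global_dimension A ->
  complete_primitive_idempotents e ->
  (lne (spectral_radius R (dual_coxeter e M))%:E <= HH_entropy R M_perf)%E.
Proof.
move=> elemA gldA idem; rewrite leNgt; apply/negP => lt.
set rho := spectral_radius R _ in lt.
have rho0 : 0 < rho.
  rewrite ltNge; apply/negP => le0; move: lt.
  by rewrite le0_lneNy ?lee_fin // ltNge leNye.
move: lt; rewrite lne_EFin // => lt.
have [c hc crho] : exists2 c : R, (HH_entropy R M_perf < c%:E)%E & c < ln rho.
  case: (HH_entropy R M_perf) lt => [x| |] //; rewrite ?lte_fin => lt.
    by exists ((x + ln rho) / 2); rewrite ?lte_fin ?midf_lt.
  by exists (ln rho - 1); rewrite ?ltNyr // ltrBlDr ltrDl.
have mu_rho : expR c < rho by rewrite -[rho]lnK ?posrE // ltr_expR.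
have [N HN] := entropy_bound hc.
have [_ [z eigz <-] ltz] : exists2 y, [set Normc.normc z | z in
    [set z : R[i] | eigenvalue (map_mx (intr : int -> R[i]) (dual_coxeter e M)) z]] y &
    expR c < y.
  apply: sup_gt mu_rho; apply/set0P/eqP => E0.
  by move: rho0; rewrite /rho /spectral_radius E0 sup0 ltxx.
move: ltz; rewrite ltNge => /negP; apply.
apply: (trace_growth (N := N.+2) (expR_gt0 c) eigz) => -[|[|m]] // Nm.
apply: le_trans (HN m.+1 (ltnW Nm)).
rewrite -[X in _ <= X]/((HH_tdim M_perf m.+1)%:Z%:~R) ler_int.
exact: trace_le_HH_tdim.
Qed.
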